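(* Let $d\ge1$ and let $\Omega\subset\mathbb{R}^{2d}$ be a measurable subset of finite measure. Then $$\|L_\Omega\|_{\mathrm{HS}}\le\|L_{\Omega^*}\|_{\mathrm{HS}},$$ where $\Omega^*\subset\mathbb{R}^{2d}$ is the open ball centered at $0$ with measure $|\Omega^*|=|\Omega|$. Equality occurs if and only if $\Omega$ is equivalent, up to a set of measure zero, to a ball.
   Context: $|\cdot|$ denotes Lebesgue measure on $\mathbb{R}^{2d}$. Let $\varphi(x)=2^{d/4}e^{-\pi|x|^2}$, $x\in\mathbb{R}^d$, and for $f\in L^2(\mathbb{R}^d)$ let $\mathcal{V}f(x,\omega)=\int_{\mathbb{R}^d}f(y)\overline{\varphi(y-x)}e^{-2\pi i\omega\cdot y}\,dy$, $(x,\omega)\in\mathbb{R}^d\times\mathbb{R}^d$, be the short-time Fourier transform with Gaussian window; $\mathcal{V}:L^2(\mathbb{R}^d)\to L^2(\mathbb{R}^{2d})$ is an isometry. For a measurable $\Omega\subset\mathbb{R}^{2d}$ of finite measure, the time-frequency localization operator is $L_\Omega=\mathcal{V}^*\chi_\Omega\mathcal{V}:L^2(\mathbb{R}^d)\to L^2(\mathbb{R}^d)$, i.e. $\langle L_\Omega f,g\rangle=\int_\Omega \mathcal{V}f(z)\overline{\mathcal{V}g(z)}\,dz$. $\|\cdot\|_{\mathrm{HS}}$ is the Hilbert-Schmidt norm. In the degenerate case $|\Omega|=0$, $\Omega^*$ is the empty set, regarded as the open ball of radius $0$. *)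

(* Defs.v *)
From HB Require Import structures.
From mathcomp Require Import all_boot all_order all_algebra.
From mathcomp Require Import complex.
From mathcomp Require Import all_classical all_reals all_analysis.

Set Implicit Arguments.
Unset Strict Implicit.
Unset Printing Implicit Defensive.
Import Order.TTheory GRing.Theory Num.Theory.
Import numFieldNormedType.Exports.

Local Open Scope classical_set_scope.
Local Open Scope ring_scope.

(* The Borel sigma-algebra of R^n: it is generated by the coordinates. *)

Definition borelRn (R : realType) (n : nat) : Type := 'rV[R]_n.

Section borelRn.
Context (R : realType) (n : nat).

Let coord (i : 'I_n) (x : borelRn R n) : R := (x : 'rV[R]_n) ord0 i.

HB.instance Definition _ := Pointed.copy (borelRn R n) 'rV[R]_n.

Let borel0 : g_sigma_preimage coord set0.
Proof. exact: sigma_algebra0. Qed.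

Let borelC A : g_sigma_preimage coord A -> g_sigma_preimage coord (~` A).
Proof. exact: sigma_algebraC. Qed.

Let borel_bigcup (F : (set (borelRn R n))^nat) :
  (forall i, g_sigma_preimage coord (F i)) ->
  g_sigma_preimage coord (\bigcup_i F i).
Proof. exact: sigma_algebra_bigcup. Qed.

HB.instance Definition _ := @isMeasurable.Build default_measure_display
  (borelRn R n) (g_sigma_preimage coord) borel0 borelC borel_bigcup.

Lemma measurable_borelRn_coord (i : 'I_n) :
  measurable_fun [set: borelRn R n] (fun x : borelRn R n => (x : 'rV[R]_n) ord0 i).
Proof.
move=> _ Y mY; rewrite setTI; apply: sub_sigma_algebra => /=.
rewrite -bigcup_seq/=; exists i => /=; first by rewrite mem_index_enum.
by exists Y => //; rewrite setTI.
Qed.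

Lemma measurable_fun_borelRn d (T : measurableType d) (f : T -> borelRn R n) :
  (forall i : 'I_n, measurable_fun [set: T] (fun t => (f t : 'rV[R]_n) ord0 i)) ->
  measurable_fun [set: T] f.
Proof.
move=> mf _ Y mY; rewrite setTI.
move: Y mY; apply: smallest_sub.
  split; first by rewrite /= preimage_set0.
    by move=> A /= mA; rewrite setTD preimage_setC; exact: measurableC.
  by move=> A /= mA; rewrite preimage_bigcup; exact: bigcup_measurable.
move=> A; rewrite -bigcup_seq/= => -[i _] [B mB <-].
have := mf i measurableT B mB; rewrite setTI.
by rewrite setTI.
Qed.

End borelRn.

(* R x R^n = R^(n+1) *)
Section consRn.
Context (R : realType) (n : nat).

Definition consRn (p : measurableTypeR R * borelRn R n) : borelRn R n.+1 :=
  row_mx (p.1 : R)%:M (p.2 : 'rV[R]_n).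

Definition unconsRn (x : borelRn R n.+1) : measurableTypeR R * borelRn R n :=
  (lsubmx (x : 'rV[R]_(1 + n)) ord0 ord0, rsubmx (x : 'rV[R]_(1 + n))).

Lemma consRnK : cancel consRn unconsRn.
Proof.
move=> [a x]; rewrite /unconsRn /consRn /= row_mxKl row_mxKr.
by rewrite mxE eqxx mulr1n.
Qed.

Lemma measurable_consRn : measurable_fun [set: measurableTypeR R * borelRn R n] consRn.
Proof.
apply: measurable_fun_borelRn => i /=.
case: (@splitP 1 n i) => j ij.
- rewrite (_ : (fun _ => _) = fst); first exact: measurable_fst.
  apply/funext => -[a x] /=; rewrite /consRn.
  rewrite (_ : i = lshift n j); last exact: val_inj.
  rewrite [LHS](row_mxEl (a%:M : 'M[R]_1) (x : 'rV[R]_n)).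
  by rewrite mxE [j]ord1 eqxx mulr1n.
- rewrite (_ : (fun _ => _) =
    (fun x : borelRn R n => (x : 'rV[R]_n) ord0 j) \o snd).
    exact: measurableT_comp (measurable_borelRn_coord j) measurable_snd.
  apply/funext => -[a x] /=; rewrite /consRn.
  rewrite (_ : i = rshift 1 j); last exact: val_inj.
  exact: (row_mxEr (a%:M : 'M[R]_1) (x : 'rV[R]_n)).
Qed.

Lemma measurable_unconsRn : measurable_fun [set: borelRn R n.+1] unconsRn.
Proof.
apply: measurable_fun_pair => /=.
  rewrite (_ : (fun _ => _) = (fun x : borelRn R n.+1 =>
    (x : 'rV[R]_n.+1) ord0 (lshift n (ord0 : 'I_1)))).
    exact: measurable_borelRn_coord.
  by apply/funext => x; rewrite mxE.
apply: measurable_fun_borelRn => i /=.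
rewrite (_ : (fun _ => _) = (fun x : borelRn R n.+1 =>
  (x : 'rV[R]_n.+1) ord0 (rshift 1 i))); first exact: measurable_borelRn_coord.
by apply/funext => x; rewrite mxE.
Qed.

Variable m : {sigma_finite_measure set (borelRn R n) -> \bar R}.

Definition consRn_measure : set (borelRn R n.+1) -> \bar R :=
  pushforward (@lebesgue_measure R \x m)%E consRn.

Let consRn_measure0 : consRn_measure set0 = 0%E.
Proof. by rewrite /consRn_measure /pushforward preimage_set0 measure0. Qed.

Let consRn_measure_ge0 A : (0 <= consRn_measure A)%E.
Proof. by rewrite /consRn_measure /pushforward measure_ge0. Qed.

Let consRn_measure_sigma_additive : semi_sigma_additive consRn_measure.
Proof.
move=> F mF tF mUF; rewrite /consRn_measure /pushforward preimage_bigcup.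
have mc A : measurable A -> measurable (consRn @^-1` A).
  by move=> mA; rewrite -[X in measurable X]setTI; exact: measurable_consRn.
apply: measure_semi_sigma_additive.
- by move=> k; exact: mc.
- apply/trivIsetP => /= i j _ _ ij; rewrite -preimage_setI.
  by move/trivIsetP : tF => /(_ _ _ _ _ ij) ->//; rewrite preimage_set0.
- by rewrite -preimage_bigcup; exact: mc.
Qed.

HB.instance Definition _ := isMeasure.Build _ _ _ consRn_measure
  consRn_measure0 consRn_measure_ge0 consRn_measure_sigma_additive.

Let consRn_measure_sigma_finite : sigma_finite setT consRn_measure.
Proof.
have /sigma_finiteP[F [TF ndF Foo]] := sigma_finiteT (@lebesgue_measure R).
have /sigma_finiteP[G [TG ndG Goo]] := sigma_finiteT m.
exists (fun k => unconsRn @^-1` (F k `*` G k)).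
  rewrite -preimage_bigcup (_ : \bigcup_k (F k `*` G k) = setT)//.
  apply/seteqP; split => // -[a x] _.
  have [k _ Fka] : (\bigcup_k F k) a by rewrite -TF.
  have [l _ Glx] : (\bigcup_k G k) x by rewrite -TG.
  exists (maxn k l) => //; split => /=.
  - by move: a Fka; exact/subsetPset/ndF/leq_maxl.
  - by move: x Glx; exact/subsetPset/ndG/leq_maxr.
move=> k; have [mF Fk] := Foo k; have [mG Gk] := Goo k; split.
  rewrite -[X in measurable X]setTI.
  by apply: measurable_unconsRn => //; exact: measurableX.
rewrite /consRn_measure /pushforward -comp_preimage.
rewrite (_ : unconsRn \o consRn = id) ?preimage_id; last exact/funext/consRnK.
by rewrite product_measure1E// lte_mul_pinfty// ge0_fin_numE.
Qed.

HB.instance Definition _ := @Measure_isSigmaFinite.Build _ _ _ consRn_measure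
  consRn_measure_sigma_finite.

End consRn.

(* The n-fold product of the Lebesgue measure of R. *)
Fixpoint borel_lebesgue (R : realType) (n : nat) :
    {sigma_finite_measure set (borelRn R n) -> \bar R} :=
  match n with
  | 0 => @dirac _ (borelRn R 0) (0 : 'rV[R]_0) R
  | k.+1 => consRn_measure (borel_lebesgue R k)
  end.

(* The measurable sets of lebesgueRn R n are the Lebesgue measurable subsets of
   R^n, and lebesgue R n is the Lebesgue measure, i.e., the completion of
   the n-fold product measure. *)
Definition lebesgueRn (R : realType) (n : nat) :=
  caratheodory_type (borel_lebesgue R n)^*%mu.

Definition lebesgue (R : realType) (n : nat) :
    {measure set (lebesgueRn R n) -> \bar R} :=
  @completed_measure_extension _ _ _ (borel_lebesgue R n).

Section localization.
Context (R : realType).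
Local Open Scope complex_scope.

Definition dotprod n (x y : 'rV[R]_n) : R := \sum_(i < n) x ord0 i * y ord0 i.

Definition enorm n (x : 'rV[R]_n) : R := Num.sqrt (dotprod x x).

Definition eball n (c : 'rV[R]_n) (r : R) : set 'rV[R]_n :=
  [set x | enorm (x - c) < r].

Definition cintegral n (f : 'rV[R]_n -> R[i]) : R[i] :=
  (\int[lebesgue R n]_x complex.Re (f x)) +i*
  (\int[lebesgue R n]_x complex.Im (f x)).

Definition l2norm n (f : 'rV[R]_n -> R[i]) : \bar R :=
  ('N[lebesgue R n]_(2%:E)[EFin \o (fun x => Normc.normc (f x))])%E.

(* Elements of L^2(R^n) are represented by functions, two functions that are
   equal almost everywhere representing the same element. *)
Definition L2 n (f : 'rV[R]_n -> R[i]) : Prop :=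
  [/\ measurable_fun [set: lebesgueRn R n] (fun x => complex.Re (f x)),
      measurable_fun [set: lebesgueRn R n] (fun x => complex.Im (f x)) &
      (l2norm f < +oo)%E].

Definition inner n (f g : 'rV[R]_n -> R[i]) : R[i] :=
  cintegral (fun x => f x * (g x)^*).

(* Completeness: only the zero vector is orthogonal to B. *)
Definition orthonormal_basis n (B : set ('rV[R]_n -> R[i])) : Prop :=
  [/\ forall e, B e -> L2 e,
      forall e e', B e -> B e' -> inner e e' = (e == e')%:R &
      forall f, L2 f -> (forall e, B e -> inner f e = 0) -> l2norm f = 0%E].

(* Such a set exists by Zorn's lemma, so the default value is not used. *)
Definition onb n : set ('rV[R]_n -> R[i]) :=
  xget set0 [set B | orthonormal_basis B].

(* Hilbert-Schmidt norm of an operator on L^2(R^n); it does not depend on the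
   orthonormal basis. *)
Definition hs_norm n (T : ('rV[R]_n -> R[i]) -> 'rV[R]_n -> R[i]) : \bar R :=
  ((\esum_(e in @onb n) l2norm (T e) ^+ 2) `^ 2^-1)%E.

(* Hilbert adjoint of a bounded T : L^2(R^m) -> L^2(R^n): it exists by the Riesz
   representation theorem and its values are determined up to equality almost
   everywhere. *)
Definition adjoint m n (T : ('rV[R]_m -> R[i]) -> 'rV[R]_n -> R[i])
    (g : 'rV[R]_n -> R[i]) : 'rV[R]_m -> R[i] :=
  xget (fun=> 0)
    [set h | L2 h /\ forall f, L2 f -> inner (T f) g = inner f h].

Definition gaussian d (x : 'rV[R]_d) : R :=
  2 `^ (d%:R / 4) * expR (- pi * enorm x ^+ 2).

Definition expi (t : R) : R[i] := cos t +i* sin t.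

(* A point (x, omega) of R^d x R^d is a row vector of length d + d. *)
Definition stft d (f : 'rV[R]_d -> R[i]) (z : 'rV[R]_(d + d)) : R[i] :=
  let x := lsubmx z in
  let omega := rsubmx z in
  cintegral (fun y : 'rV[R]_d =>
    f y * ((gaussian (y - x))%:C)^* * expi (- (2 * pi * dotprod omega y))).

Definition localization d (Omega : set 'rV[R]_(d + d))
    (f : 'rV[R]_d -> R[i]) : 'rV[R]_d -> R[i] :=
  adjoint (@stft d) (fun z => (\1_Omega z)%:C * stft f z).

(* The open ball centered at 0 with the same measure as A. For n > 0 and A of
   finite measure, the radius exists and is unique; it is 0, and the ball is
   empty, when A has measure 0. *)
Definition symmetrization n (A : set 'rV[R]_n) : set 'rV[R]_n :=
  eball 0 (xget 0 [set r | 0 <= r /\ lebesgue R n (eball 0 r) = lebesgue R n A]).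

End localization.

(* Main.v *)
(* The functions phi_z = coherent z (the time-frequency shifts of the Gaussian)
   satisfy |<phi_z, phi_w>|^2 = exp (- pi |z - w|^2), and L_Omega is an integral
   operator with kernel K (x, y) = \int_Omega phi_z(x) conj(phi_z(y)) dz. By
   Parseval, ||L_Omega||_HS^2 = \int\int |K|^2, and by Fubini this is the energy
   \int_Omega \int_Omega exp (- pi |z - w|^2) dw dz.
   The inequality is then Riesz' rearrangement inequality for one set and a
   strictly decreasing radial kernel, proved by polarization: reflecting across
   a hyperplane does not decrease the energy, and a suitable hyperplane brings
   the set closer to the ball by a definite amount.
   For the equality case, center a ball B of measure |Omega| at a maximum point c
   of the potential of Omega. If Omega and B differed, some reflection would
   strictly increase the energy, or else the potential at the reflection of c
   would exceed the one at c. *)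

Require Import Defs.
From HB Require Import structures.
From mathcomp Require Import all_boot all_order all_algebra.
From mathcomp Require Import complex.
From mathcomp Require Import all_classical all_reals all_analysis.
From mathcomp Require Import measurable_realfun ring lra.

Set Implicit Arguments.
Unset Strict Implicit.
Unset Printing Implicit Defensive.
Import Order.TTheory GRing.Theory Num.Theory.
Import numFieldNormedType.Exports.
Local Open Scope classical_set_scope.
Local Open Scope ring_scope.

(** * Borel-Lebesgue measure on R^n *)

(** The definite amount comes from a fixed scale r. The measure [Wnear] of the pairs at distance
    less than r that straddle the boundary of a set is small compared with the volume of an r-ball
    as r tends to 0, and polarization cannot increase it, because proximity is itself a decreasing
    radial kernel. So one r serves all steps: each reflection brings at least half the volume of an
    r-ball into the target, and finitely many reach any tolerance. For equality, the obstacle is a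
    reflection that only moves the set as a whole, without gain of energy; centering at a maximum of
    the potential excludes it. Reflections preserve the measure by a Gaussian double integral that
    uses translations only, so no determinant or change of variables occurs. Fubini's theorem is
    applied to Borel product measures while the data are Lebesgue measurable; hence the Borel
    representatives. The basis [onb] may a priori be uncountable: Bessel's inequality for the
    coherent states leaves countably many relevant elements before a sum and an integral are
    exchanged. *)

Section borel_lebesgue_theory.
Context (R : realType).
Local Open Scope ereal_scope.

Lemma ge0_integral_consRn n (f : borelRn R n.+1 -> \bar R) :
  measurable_fun [set: _] f -> (forall x, 0 <= f x) ->
  \int[borel_lebesgue R n.+1]_x f x =
  \int[lebesgue_measure]_a \int[borel_lebesgue R n]_x f (consRn (a, x)).
Proof.
move=> mf f0.
have mfc : measurable_fun [set: measurableTypeR R * borelRn R n] (f \o @consRn R n).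
  by apply: measurableT_comp => //; exact: measurable_consRn.
rewrite -(fubini_tonelli1 (f \o @consRn R n))//; last by move=> x; exact: f0.
rewrite -[RHS](ge0_integral_pushforward (@measurable_consRn R n) _ measurableT)//.
Qed.

Lemma measurable_integral_consRn n (f : borelRn R n.+1 -> \bar R) :
  measurable_fun [set: _] f -> (forall x, 0 <= f x) ->
  measurable_fun [set: measurableTypeR R]
    (fun a => \int[borel_lebesgue R n]_x f (consRn (a, x))).
Proof.
move=> mf f0; apply: (measurable_fun_fubini_tonelli_F (f \o @consRn R n)).
- by apply: measurableT_comp => //; exact: measurable_consRn.
- by move=> x; exact: f0.
Qed.

(** The translated measure gives every half-open interval its length, and Lebesgue measure is the
    only measure doing so. *)
Lemma lebesgue_measureD (t : R) (A : set R) : measurable A ->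
  pushforward (@lebesgue_measure R) (fun x : measurableTypeR R => x + t : measurableTypeR R)%R A
  = lebesgue_measure A.
Proof.
move=> mA; apply/esym.
have mt : measurable_fun setT (fun x : measurableTypeR R => x + t : measurableTypeR R)%R.
  by apply: measurable_funD.
pose H := isMeasurableFun.Build _ _ _ _ _ mt.
pose phi : {mfun _ >-> _} := HB.pack (fun x : measurableTypeR R => x + t : measurableTypeR R)%R H.
apply: (@lebesgue_measure_unique _ (pushforward lebesgue_measure phi)) => //= _ [[a b]] _ <-.
rewrite /pushforward.
have -> : (fun x : R => x + t)%R @^-1` `]a, b] = `](a - t)%R, (b - t)%R]%classic.
  by apply/seteqP; split => x /=; rewrite !in_itv/= ltrBlDr lerBrDr.
rewrite !lebesgue_measure_itv/= !lte_fin ltrD2r.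
by case: ifP => // _; rewrite -!EFinB; congr EFin; ring.
Qed.

Lemma ge0_integral_translate1 (t : R) (f : R -> \bar R) :
  measurable_fun [set: _] f -> (forall x, 0 <= f x) ->
  \int[lebesgue_measure]_x f (x + t)%R = \int[lebesgue_measure]_x f x.
Proof.
move=> mf f0.
have mt : measurable_fun setT (fun x : measurableTypeR R => x + t : measurableTypeR R)%R.
  by apply: measurable_funD.
have H : forall y, y \in [set: measurableTypeR R] -> 0 <= f y by move=> y _; exact: f0.
have := @ge0_integral_pushforward _ _ _ _ R _ mt lebesgue_measure setT f measurableT mf H.
rewrite preimage_setT => <-.
by apply: eq_measure_integral => A mA _; exact: lebesgue_measureD.
Qed.

Lemma measurable_borelRn_translate n (t : 'rV[R]_n) :
  measurable_fun [set: borelRn R n] (fun x : borelRn R n => x + t : borelRn R n)%R.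
Proof.
apply: measurable_fun_borelRn => i.
rewrite (_ : (fun _ => _) = (fun x : borelRn R n => (x : 'rV[R]_n) ord0 i + t ord0 i)%R).
  by apply: measurable_funD => //; exact: measurable_borelRn_coord.
by apply/funext => x; rewrite mxE.
Qed.

Lemma consRnD n (a b : R) (x y : 'rV[R]_n) :
  (consRn (a, x) + consRn (b, y) = consRn (a + b, x + y))%R.
Proof. by rewrite /consRn [LHS](@add_row_mx _ 1 1 n) -raddfD. Qed.

Lemma consRnE n (x : 'rV[R]_n.+1) : x = consRn (unconsRn x).
Proof.
rewrite /consRn /unconsRn/= -[LHS](@hsubmxK _ 1 1 n) -mx11_scalar//.
Qed.

Lemma measurable_consRn2 n (a : R) :
  measurable_fun [set: borelRn R n] (fun x => consRn (a, x)).
Proof.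
by apply: measurableT_comp; [exact: measurable_consRn|exact: pair1_measurable].
Qed.

(** Induction on the dimension: Tonelli isolates the first coordinate, where one-dimensional
    invariance applies, and each slice is handled by the induction hypothesis. *)
Lemma ge0_integral_translate n (t : 'rV[R]_n) (f : borelRn R n -> \bar R) :
  measurable_fun [set: _] f -> (forall x, 0 <= f x) ->
  \int[borel_lebesgue R n]_x f (x + t)%R = \int[borel_lebesgue R n]_x f x.
Proof.
elim: n t f => [|n IHn] t f mf f0.
  apply: eq_integral => x _; congr f.
  by apply/rowP => -[].
have mft : measurable_fun [set: borelRn R n.+1] (fun x => f (x + t)%R).
  by apply: measurableT_comp mf (measurable_borelRn_translate t).
rewrite (ge0_integral_consRn mft (fun x => f0 _)) (ge0_integral_consRn mf f0).
rewrite -[RHS](ge0_integral_translate1 (unconsRn t).1); last 2 first.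
- exact: (measurable_integral_consRn mf f0).
- by move=> a; apply: integral_ge0 => x _; exact: f0.
apply: eq_integral => a _.
rewrite -[RHS](IHn (unconsRn t).2); last 2 first.
- apply: (measurableT_comp mf); exact: measurable_consRn2.
- by move=> x; exact: f0.
apply: eq_integral => x _; rewrite {1}(consRnE t).
by case: (unconsRn t) => b y /=; rewrite consRnD.
Qed.

End borel_lebesgue_theory.

(** * Measurability of vector-valued maps *)

Section borelRn_measurability.
Context (R : realType).

Lemma measurable_fun_coord n d (T : measurableType d) (f : T -> borelRn R n)
    (i : 'I_n) : measurable_fun [set: T] f ->
  measurable_fun [set: T] (fun t => (f t : 'rV[R]_n) ord0 i).
Proof. by move=> mf; exact: (measurableT_comp (measurable_borelRn_coord i) mf). Qed.

Lemma measurable_fun_dotprod n d (T : measurableType d) (f g : T -> borelRn R n) :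
  measurable_fun [set: T] f -> measurable_fun [set: T] g ->
  measurable_fun [set: T] (fun t => dotprod (f t) (g t)).
Proof.
move=> mf mg; apply: measurable_sum => i.
by apply: measurable_funM; [exact: (measurable_fun_coord i mf)|exact: (measurable_fun_coord i mg)].
Qed.

Lemma measurable_borelRnD n d (T : measurableType d) (f g : T -> borelRn R n) :
  measurable_fun [set: T] f -> measurable_fun [set: T] g ->
  measurable_fun [set: T] (fun t => f t + g t : borelRn R n).
Proof.
move=> mf mg; apply: measurable_fun_borelRn => i.
rewrite (_ : (fun _ => _) = (fun t => (f t : 'rV[R]_n) ord0 i + (g t : 'rV[R]_n) ord0 i)).
  by apply: measurable_funD; [exact: (measurable_fun_coord i mf)|exact: (measurable_fun_coord i mg)].
by apply/funext => t; rewrite mxE.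
Qed.

Lemma measurable_borelRnZ n d (T : measurableType d) (a : T -> R) (f : T -> borelRn R n) :
  measurable_fun [set: T] a -> measurable_fun [set: T] f ->
  measurable_fun [set: T] (fun t => a t *: f t : borelRn R n).
Proof.
move=> ma mf; apply: measurable_fun_borelRn => i.
rewrite (_ : (fun _ => _) = (fun t => a t * (f t : 'rV[R]_n) ord0 i)).
  by apply: measurable_funM => //; exact: (measurable_fun_coord i mf).
by apply/funext => t; rewrite mxE.
Qed.

Lemma measurable_borelRnB n d (T : measurableType d) (f g : T -> borelRn R n) :
  measurable_fun [set: T] f -> measurable_fun [set: T] g ->
  measurable_fun [set: T] (fun t => f t - g t : borelRn R n).
Proof.
move=> mf mg; rewrite (_ : (fun _ => _) = (fun t => f t + (-1) *: g t : borelRn R n)).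
  by apply: measurable_borelRnD => //; apply: measurable_borelRnZ.
by apply/funext => t; rewrite scaleN1r.
Qed.

Lemma measurable_fun_lsubmx m n d (T : measurableType d) (f : T -> borelRn R (m + n)) :
  measurable_fun [set: T] f ->
  measurable_fun [set: T] (fun t => lsubmx (f t : 'rV_(m + n)) : borelRn R m).
Proof.
move=> mf; apply: measurable_fun_borelRn => i.
rewrite (_ : (fun _ => _) = (fun t => (f t : 'rV[R]_(m + n)) ord0 (lshift n i))).
  exact: (measurable_fun_coord _ mf).
by apply/funext => t; rewrite mxE.
Qed.

Lemma measurable_fun_rsubmx m n d (T : measurableType d) (f : T -> borelRn R (m + n)) :
  measurable_fun [set: T] f ->
  measurable_fun [set: T] (fun t => rsubmx (f t : 'rV_(m + n)) : borelRn R n).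
Proof.
move=> mf; apply: measurable_fun_borelRn => i.
rewrite (_ : (fun _ => _) = (fun t => (f t : 'rV[R]_(m + n)) ord0 (rshift m i))).
  exact: (measurable_fun_coord _ mf).
by apply/funext => t; rewrite mxE.
Qed.

Lemma measurable_fun_expR d (T : measurableType d) (f : T -> R) :
  measurable_fun [set: T] f -> measurable_fun [set: T] (fun t => expR (f t)).
Proof. by move=> mf; exact: (measurableT_comp (@measurable_expR R) mf). Qed.

End borelRn_measurability.

(** * The Euclidean inner product and norm *)

Section dotprod_theory.
Context (R : realType) (n : nat).
Implicit Types (x y z : 'rV[R]_n) (a : R).

Lemma dotprodC x y : dotprod x y = dotprod y x.
Proof. by apply: eq_bigr => i _; rewrite mulrC. Qed.

Lemma dotprodDl x y z : dotprod (x + y) z = dotprod x z + dotprod y z.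
Proof. by rewrite -big_split; apply: eq_bigr => i _; rewrite mxE mulrDl. Qed.

Lemma dotprodZl a x z : dotprod (a *: x) z = a * dotprod x z.
Proof. by rewrite mulr_sumr; apply: eq_bigr => i _; rewrite mxE mulrA. Qed.

Lemma dotprodNl x z : dotprod (- x) z = - dotprod x z.
Proof. by rewrite -scaleN1r dotprodZl mulN1r. Qed.

Lemma dotprodBl x y z : dotprod (x - y) z = dotprod x z - dotprod y z.
Proof. by rewrite dotprodDl dotprodNl. Qed.

Lemma dotprodDr x y z : dotprod z (x + y) = dotprod z x + dotprod z y.
Proof. by rewrite dotprodC dotprodDl !(dotprodC z). Qed.

Lemma dotprodZr a x z : dotprod z (a *: x) = a * dotprod z x.
Proof. by rewrite dotprodC dotprodZl (dotprodC z). Qed.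

Lemma dotprodNr x z : dotprod z (- x) = - dotprod z x.
Proof. by rewrite dotprodC dotprodNl (dotprodC z). Qed.

Lemma dotprodBr x y z : dotprod z (x - y) = dotprod z x - dotprod z y.
Proof. by rewrite dotprodDr dotprodNr. Qed.

Definition dotprodE := (dotprodDl, dotprodDr, dotprodNl, dotprodNr, dotprodZl, dotprodZr).

Lemma dotprod_ge0 x : 0 <= dotprod x x.
Proof. by apply: sumr_ge0 => i _; rewrite -expr2 sqr_ge0. Qed.

Lemma dotprod_eq0 x : (dotprod x x == 0) = (x == 0).
Proof.
apply/eqP/eqP => [xx0|->]; last by apply: big1 => i _; rewrite mxE mul0r.
apply/rowP => i; rewrite mxE; apply/eqP; rewrite -sqrf_eq0 expr2.
move: xx0 => /eqP; rewrite psumr_eq0 => [/allP/(_ i)|j _].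
  by rewrite mem_index_enum => /(_ isT).
by rewrite -expr2 sqr_ge0.
Qed.

Lemma sqr_enorm x : enorm x ^+ 2 = dotprod x x.
Proof. by rewrite /enorm sqr_sqrtr// dotprod_ge0. Qed.

Lemma enorm_ge0 x : 0 <= enorm x. Proof. exact: sqrtr_ge0. Qed.

Lemma enorm0 : enorm (0 : 'rV[R]_n) = 0.
Proof. by rewrite /enorm (_ : dotprod 0 0 = 0) ?sqrtr0//; apply/eqP; rewrite dotprod_eq0. Qed.

Lemma enormN x : enorm (- x) = enorm x.
Proof. by rewrite /enorm dotprodNl dotprodNr opprK. Qed.

Lemma enormB x y : enorm (x - y) = enorm (y - x).
Proof. by rewrite -enormN opprB. Qed.

Lemma ler_dotprod x y : dotprod x y <= enorm x * enorm y.
Proof.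
have [->|x0] := eqVneq x 0.
  by rewrite /dotprod big1 ?mulr_ge0 ?enorm_ge0// => i _; rewrite mxE mul0r.
have xx0 : 0 < dotprod x x by rewrite lt_def dotprod_eq0 x0 dotprod_ge0.
have nx0 : 0 < enorm x by rewrite sqrtr_gt0.
(* The square of this vector is |x|^2 (|x|^2 |y|^2 - <x, y>^2), and |x|^2 is positive. *)
have := dotprod_ge0 (dotprod x y *: x - dotprod x x *: y).
rewrite !dotprodE (dotprodC y x) => H.
have H2 : dotprod x y ^+ 2 <= dotprod x x * dotprod y y by nra.
rewrite leNgt; apply/negP => H3; move: H2; apply/negP; rewrite -ltNge.
rewrite -!sqr_enorm -exprMn ltr_sqr// nnegrE ?mulr_ge0 ?enorm_ge0//.
by rewrite (le_trans _ (ltW H3))// mulr_ge0 ?enorm_ge0.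
Qed.

Lemma ler_enormD x y : enorm (x + y) <= enorm x + enorm y.
Proof.
rewrite -ler_sqr ?nnegrE ?addr_ge0 ?enorm_ge0// sqrrD !sqr_enorm !dotprodE.
by rewrite (dotprodC y x); have := ler_dotprod x y; lra.
Qed.

Lemma ler_enorm_distD z x y : enorm (x - y) <= enorm (x - z) + enorm (z - y).
Proof. by rewrite -{1}(subrK z x) -addrA; exact: ler_enormD. Qed.

End dotprod_theory.

Lemma dotprod_consRn (R : realType) n (a b : R) (x y : 'rV[R]_n) :
  dotprod (consRn (a, x)) (consRn (b, y)) = a * b + dotprod x y.
Proof.
rewrite /dotprod big_ord_recl; congr (_ + _).
  have -> : (ord0 : 'I_n.+1) = lshift n (ord0 : 'I_1) by apply: val_inj.
  by rewrite /consRn !(@row_mxEl _ 1 1 n) !mxE eqxx !mulr1n.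
apply: eq_bigr => i _.
have -> : lift ord0 i = rshift 1 i :> 'I_n.+1 by apply: val_inj.
by rewrite /consRn !(@row_mxEr _ 1 1 n).
Qed.

(** * Gaussian integrals and invariance under isometries *)

Section gaussian_integral.
Context (R : realType).
Local Open Scope ereal_scope.

Lemma measurable_gaussianRn n (c : R) (a : 'rV[R]_n) :
  measurable_fun [set: borelRn R n] (fun x => expR (- (c * dotprod (x - a) (x - a)))%R).
Proof.
apply: measurable_fun_expR; apply: measurable_funN; apply: measurable_funM => //.
by apply: measurable_fun_dotprod; apply: measurable_borelRnB.
Qed.

Lemma ge0_integral_gauss1 (c : R) : (0 < c)%R ->
  \int[lebesgue_measure]_x (expR (- (c * (x * x))))%:E = (Num.sqrt (pi / c))%:E.
Proof.
move=> c0.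
(* With variance 1 / (2 c), the centered normal density is a multiple of exp (- c x^2); its integral
   1 gives the value. *)
pose s := Num.sqrt (c *+ 2)^-1.
have s0 : (0 < s)%R by rewrite sqrtr_gt0 invr_gt0 pmulrn_lgt0.
have s2 : (s ^+ 2 = (c *+ 2)^-1)%R by rewrite sqr_sqrtr// invr_ge0 mulrn_wge0// ltW.
have spi : (s ^+ 2 * pi *+ 2 = pi / c)%R.
  by rewrite s2 -mulr_natr -(mulr_natr c); field; rewrite gt_eqF//.
have := integral_normal_pdf 0%R s.
rewrite (normal_pdfE _ (lt0r_neq0 s0)) => H.
transitivity (\int[lebesgue_measure]_x ((Num.sqrt (pi / c))%:E *
    (normal_peak s * normal_fun 0 s x)%:E)).
  apply: eq_integral => x _; rewrite -EFinM [in RHS]mulrA /normal_peak spi divff; last first.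
    by rewrite gt_eqF// sqrtr_gt0 divr_gt0// pi_gt0.
  rewrite mul1r /normal_fun subr0; congr (expR _)%:E.
  by rewrite s2 -(mulr_natr (c *+ 2)^-1) -(mulr_natr c); field; rewrite gt_eqF//.
rewrite ge0_integralZl//.
- by rewrite H mule1.
- apply/measurable_EFinP; apply: measurable_funM => //.
  exact: measurable_normal_fun.
- by move=> x _; rewrite lee_fin mulr_ge0// ?normal_peak_ge0// normal_fun_ge0.
Qed.

Lemma ge0_integral_gaussRn n (c : R) : (0 < c)%R ->
  \int[borel_lebesgue R n]_x (expR (- (c * dotprod x x)))%:E
    = (Num.sqrt (pi / c) ^+ n)%:E.
Proof.
move=> c0; elim: n => [|n IHn].
  transitivity (\int[borel_lebesgue R 0]_x (cst 1 x : \bar R)).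
    by apply: eq_integral => x _; rewrite /dotprod big_ord0 mulr0 oppr0 expR0.
  by rewrite integral_cst//= /dirac indicT mule1 expr0.
have mg k : measurable_fun [set: borelRn R k] (fun x => (expR (- (c * dotprod x x)))%:E).
  apply/measurable_EFinP; have := @measurable_gaussianRn k c 0%R.
  by under eq_fun do rewrite subr0.
rewrite ge0_integral_consRn//.
transitivity (\int[lebesgue_measure]_a ((expR (- (c * (a * a))))%:E *
   (Num.sqrt (pi / c) ^+ n)%:E)).
  apply: eq_integral => a _; rewrite -IHn -ge0_integralZl//; last exact: (mg n).
  by apply: eq_integral => x _; rewrite dotprod_consRn mulrDr opprD expRD.
rewrite ge0_integralZr//.
- by rewrite ge0_integral_gauss1// -EFinM exprS.
- apply/measurable_EFinP; apply: measurable_fun_expR; apply: measurable_funN.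
  by apply: measurable_funM => //; apply: measurable_funM.
Qed.

(* Integrating [f (s x) h y] in both orders, [h] a Gaussian, and translating only. *)
Lemma ge0_integral_isometry n (s tau : 'rV[R]_n -> 'rV[R]_n)
    (f : borelRn R n -> \bar R) :
  measurable_fun [set: borelRn R n] (s : borelRn R n -> borelRn R n) ->
  (forall x y, s (x + tau y) = s x + y)%R ->
  (forall x y, enorm (y - s x)%R = enorm (x - s y)%R) ->
  measurable_fun [set: borelRn R n] f -> (forall x, 0 <= f x) ->
  \int[borel_lebesgue R n]_x f (s x) = \int[borel_lebesgue R n]_x f x.
Proof.
move=> ms stau isos mf f0.
pose h (x : borelRn R n) : \bar R := (expR (- (1 * dotprod x x)))%:E.
have mh : measurable_fun [set: borelRn R n] h.
  apply/measurable_EFinP; have := @measurable_gaussianRn n 1 0%R.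
  by under eq_fun do rewrite subr0.
have h0 x : 0 <= h x by rewrite lee_fin expR_ge0.
pose Z := \int[borel_lebesgue R n]_x h x.
have ZE : Z = (Num.sqrt (pi / 1) ^+ n)%:E by exact: ge0_integral_gaussRn.
have Z0 : (0 < Num.sqrt (pi / 1 : R) ^+ n)%R.
  by rewrite exprn_gt0// sqrtr_gt0 divr1 pi_gt0.
have hE x y : h (y - s x)%R = h (x - s y)%R.
  by rewrite /h -!sqr_enorm isos.
suff : Z * \int[borel_lebesgue R n]_x f (s x) = Z * \int[borel_lebesgue R n]_x f x.
  move=> /(congr1 (fun t => (Num.sqrt (pi / 1) ^+ n)^-1%:E * t)).
  by rewrite ZE !muleA -!EFinM mulVf ?gt_eqF// !mul1e.
have mfs : measurable_fun [set: borelRn R n] (fun x => f (s x)).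
  exact: (measurableT_comp mf ms).
have mfst : measurable_fun [set: borelRn R n * borelRn R n] (fun z => z.1).
  exact: measurable_fst.
have msnd : measurable_fun [set: borelRn R n * borelRn R n] (fun z => z.2).
  exact: measurable_snd.
have ms1 : measurable_fun [set: borelRn R n * borelRn R n] (fun z => s z.1 : borelRn R n).
  exact: (measurableT_comp ms mfst).
transitivity (\int[borel_lebesgue R n]_x \int[borel_lebesgue R n]_y (f (s x) * h y)).
  rewrite -ge0_integralZl//; last exact: integral_ge0.
  apply: eq_integral => x _; rewrite muleC -ge0_integralZl//.
rewrite (fubini_tonelli (fun z : borelRn R n * borelRn R n => f (s z.1) * h z.2)); last 2 first.
- apply: emeasurable_funM.
    exact: (measurableT_comp mf ms1).
  exact: (measurableT_comp mh msnd).
- by move=> z; apply: mule_ge0.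
transitivity (\int[borel_lebesgue R n]_y \int[borel_lebesgue R n]_x (f (s x + y)%R * h y)).
  apply: eq_integral => y _ /=.
  rewrite -(ge0_integral_translate (tau y) (f := fun x => f (s x) * h y)); last 2 first.
  - by apply: emeasurable_funM.
  - by move=> x; apply: mule_ge0.
  by apply: eq_integral => x _; rewrite stau.
rewrite -(fubini_tonelli (fun z : borelRn R n * borelRn R n => f (s z.1 + z.2)%R * h z.2)); last 2 first.
- apply: emeasurable_funM; last exact: (measurableT_comp mh msnd).
  by apply: (measurableT_comp mf); apply: measurable_borelRnD.
- by move=> z; apply: mule_ge0.
(* Translating y by s x frees [f] from x. Since h (y - s x) = h (x - s y), the remaining integral
   over x is the Gaussian mass [Z], whatever y is. *)
transitivity (\int[borel_lebesgue R n]_x \int[borel_lebesgue R n]_y (f y * h (y - s x)%R)).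
  apply: eq_integral => x _ /=.
  rewrite -(ge0_integral_translate (s x) (f := fun y => f y * h (y - s x)%R)); last 2 first.
  - by apply: emeasurable_funM => //; apply: (measurableT_comp mh); apply: measurable_borelRnB.
  - by move=> y; apply: mule_ge0.
  by apply: eq_integral => y _; rewrite addrK addrC.
rewrite (fubini_tonelli (fun z : borelRn R n * borelRn R n => f z.2 * h (z.2 - s z.1)%R)); last 2 first.
- apply: emeasurable_funM; first exact: (measurableT_comp mf msnd).
  by apply: (measurableT_comp mh); apply: measurable_borelRnB.
- by move=> z; apply: mule_ge0.
rewrite -ge0_integralZl//; last exact: integral_ge0.
apply: eq_integral => y _ /=; rewrite ge0_integralZl//; last first.
  by apply: (measurableT_comp mh); apply: measurable_borelRnB.
rewrite muleC; congr (_ * _).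
under eq_integral do rewrite hE.
rewrite -(ge0_integral_translate (s y)); last 2 first.
- by apply: (measurableT_comp mh); apply: measurable_borelRnB.
- by move=> x; exact: h0.
by apply: eq_integral => x _; rewrite addrK.
Qed.

End gaussian_integral.

(** * Reflections across hyperplanes *)

Section reflection.
Context (R : realType) (n : nat).
Implicit Types (x y p q v m : 'rV[R]_n).

(** Its sign tells the two sides of the hyperplane through [m] with normal [v]. The normal is not
    normalized, so reflections and squared distances stay rational in the data and [field] can treat
    them. *)
Definition side v m x : R := dotprod (x - m) v.

Definition refl v m x := x - (2 * side v m x / dotprod v v) *: v.

Definition dist2 x y : R := dotprod (x - y) (x - y).

Lemma dist2C x y : dist2 x y = dist2 y x.
Proof. by rewrite /dist2 -opprB dotprodNl dotprodNr opprK. Qed.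

Lemma dist2_ge0 x y : 0 <= dist2 x y. Proof. exact: dotprod_ge0. Qed.

Lemma enorm_dist2 x y : enorm (x - y) = Num.sqrt (dist2 x y). Proof. by []. Qed.

Section nonzero.
Variables v m : 'rV[R]_n.
Hypothesis v0 : v != 0.

Let vv : dotprod v v != 0. Proof. by rewrite dotprod_eq0. Qed.

Lemma side_refl x : side v m (refl v m x) = - side v m x.
Proof.
rewrite /side /refl addrAC [LHS]dotprodBl dotprodZl -/(side v m x).
by field.
Qed.

Lemma reflK : involutive (refl v m).
Proof.
move=> x; rewrite {1}/refl side_refl mulrN mulNr scaleNr opprK.
by rewrite /refl subrK.
Qed.

(** The exact formula behind every comparison in polarization: reflecting one of two points changes
    the squared distance by a quantity with the sign of the product of their sides. *)
Lemma dist2_refl p q :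
  dist2 (refl v m p) q = dist2 p q + 4 * (side v m p * side v m q) / dotprod v v.
Proof.
rewrite /dist2 /refl addrAC.
have -> : side v m q = side v m p - dotprod (p - q) v.
  by rewrite /side !dotprodBl; ring.
move: (p - q) => u; move: (side v m p) => a.
rewrite !(dotprodE, dotprodBl, dotprodBr) (dotprodC v u).
by field.
Qed.

Lemma dist2_refl2 p q : dist2 (refl v m p) (refl v m q) = dist2 p q.
Proof. by rewrite dist2_refl dist2C dist2_refl side_refl (dist2C q p); ring. Qed.

Lemma dist2_reflC p q : dist2 (refl v m p) q = dist2 p (refl v m q).
Proof. by rewrite -{1}(reflK q) dist2_refl2. Qed.

Lemma dist2_refl_lt p q : 0 < side v m p -> 0 < side v m q ->
  dist2 p q < dist2 (refl v m p) q.
Proof.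
move=> p0 q0; rewrite dist2_refl ltrDl divr_gt0 ?mulr_gt0//.
by rewrite lt_def dotprod_eq0 v0 dotprod_ge0.
Qed.

Lemma side_gt0 p q : 0 < side v m q -> dist2 p q < dist2 (refl v m p) q ->
  0 < side v m p.
Proof.
have vv0 : 0 < (dotprod v v)^-1.
  by rewrite invr_gt0 lt_def dotprod_eq0 v0 dotprod_ge0.
by move=> q0; rewrite dist2_refl ltrDl (pmulr_lgt0 _ vv0) pmulr_rgt0// pmulr_lgt0.
Qed.

Lemma measurable_side : measurable_fun [set: borelRn R n] (side v m).
Proof.
by apply: measurable_fun_dotprod => //; apply: measurable_borelRnB.
Qed.

Lemma measurable_refl :
  measurable_fun [set: borelRn R n] (refl v m : borelRn R n -> borelRn R n).
Proof.
apply: measurable_borelRnB => //; apply: measurable_borelRnZ => //.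
by apply: measurable_funM => //; apply: measurable_funM => //; exact: measurable_side.
Qed.

(** The vector added to [x] is the linear part of the reflection applied to [y]; this provides the
    map [tau] required by [ge0_integral_isometry]. *)
Lemma refl_translate x y :
  refl v m (x + (y - (2 * dotprod y v / dotprod v v) *: v)) = refl v m x + y.
Proof.
rewrite /refl.
have -> : side v m (x + (y - (2 * dotprod y v / dotprod v v) *: v)) =
    side v m x - dotprod y v.
  by rewrite /side !(dotprodE, dotprodBl); field.
rewrite (_ : 2 * (side v m x - dotprod y v) / dotprod v v =
  2 * side v m x / dotprod v v - 2 * dotprod y v / dotprod v v); last by field.
rewrite scalerBl opprB.
move: (_ *: v) => a; move: (_ *: v) => b.
by rewrite !addrA; apply/rowP => i; rewrite !mxE; ring.
Qed.

Lemma ge0_integral_refl (f : borelRn R n -> \bar R) :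
  measurable_fun [set: borelRn R n] f -> (forall x, 0 <= f x)%E ->
  (\int[borel_lebesgue R n]_x f (refl v m x) = \int[borel_lebesgue R n]_x f x)%E.
Proof.
move=> mf f0; apply: (@ge0_integral_isometry R n (refl v m) _ f _ refl_translate) => //.
- exact: measurable_refl.
- by move=> x y; rewrite !enorm_dist2 dist2C dist2_reflC.
Qed.

Lemma borel_lebesgue_refl (A : set (borelRn R n)) : measurable A ->
  borel_lebesgue R n (refl v m @^-1` A) = borel_lebesgue R n A.
Proof.
move=> mA; rewrite -{2}(setIT A) -(integral_indic _ measurableT mA).
rewrite -ge0_integral_refl//; last first.
  by apply/measurable_EFinP; exact: measurable_indic.
have mrA : measurable (refl v m @^-1` A : set (borelRn R n)).
  by rewrite -[X in measurable X]setTI; exact: measurable_refl.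
by rewrite -[X in borel_lebesgue R n X = _](setIT _) -(integral_indic _ measurableT mrA).
Qed.

End nonzero.

Lemma refl_swap x y : refl (y - x) (2^-1 *: (x + y)) x = y.
Proof.
have [->|xy] := eqVneq x y; first by rewrite /refl subrr scaler0 subr0.
rewrite /refl /side.
have -> : x - 2^-1 *: (x + y) = - 2^-1 *: (y - x).
  by apply/rowP => i; rewrite !mxE; field.
rewrite dotprodZl (_ : 2 * _ / _ = -1) ?scaleN1r ?opprK 1?addrC ?subrK//.
by field; rewrite addrC dotprod_eq0 subr_eq0 eq_sym.
Qed.

Lemma side_bisector x y p :
  2 * side (y - x) (2^-1 *: (x + y)) p = dist2 p x - dist2 p y.
Proof.
rewrite /side /dist2 !(dotprodE, dotprodBl, dotprodBr).
rewrite (dotprodC y p) (dotprodC x p) (dotprodC y x).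
by field.
Qed.

End reflection.

(** * Volumes of balls *)

Section balls.
Context (R : realType).
Local Open Scope ereal_scope.

Lemma borel_lebesgue_translate n (t : 'rV[R]_n) (A : set (borelRn R n)) :
  measurable A -> borel_lebesgue R n ((fun x => x + t)%R @^-1` A) = borel_lebesgue R n A.
Proof.
move=> mA; rewrite -{2}(setIT A) -(integral_indic _ measurableT mA).
rewrite -(ge0_integral_translate t)//; last first.
  by apply/measurable_EFinP; exact: measurable_indic.
have mrA : measurable ((fun x => x + t)%R @^-1` A : set (borelRn R n)).
  by rewrite -[X in measurable X]setTI; exact: measurable_borelRn_translate.
by rewrite -[X in borel_lebesgue R n X = _](setIT _) -(integral_indic _ measurableT mrA).
Qed.

Lemma le_borel_lebesgue n (A B : set (borelRn R n)) : measurable A -> measurable B ->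
  A `<=` B -> borel_lebesgue R n A <= borel_lebesgue R n B.
Proof. by move=> mA mB AB; apply: le_measure => //; rewrite inE. Qed.

Lemma measurable_fun_enormB n d (T : measurableType d) (f g : T -> borelRn R n) :
  measurable_fun [set: T] f -> measurable_fun [set: T] g ->
  measurable_fun [set: T] (fun t => enorm (f t - g t)%R).
Proof.
move=> mf mg; apply: (measurableT_comp (continuous_measurable_fun (@sqrt_continuous R))).
by apply: measurable_fun_dotprod; apply: measurable_borelRnB.
Qed.

Lemma measurable_eball n (c : 'rV[R]_n) r : measurable (eball c r : set (borelRn R n)).
Proof.
have := @measurable_fun_enormB n _ (borelRn R n) id (cst c) (@measurable_id _ _ _) (@measurable_cst _ _ _ _ _ _).
move=> /(_ measurableT `]-oo, r[%classic (measurable_itv _)); rewrite setTI.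
by congr measurable; apply/seteqP; split => x /=; rewrite in_itv.
Qed.

Lemma borel_lebesgue_eball n (c : 'rV[R]_n) r :
  borel_lebesgue R n (eball c r) = borel_lebesgue R n (eball 0 r).
Proof.
rewrite -(borel_lebesgue_translate c (measurable_eball c r)); congr (borel_lebesgue R n _).
by apply/seteqP; split => x /=; rewrite /eball/= addrK subr0.
Qed.

Lemma eball0 n (c : 'rV[R]_n) r : (r <= 0)%R -> eball c r = set0.
Proof.
move=> r0; apply/seteqP; split => // x; rewrite /eball/= => /lt_le_trans/(_ r0).
by rewrite ltNge enorm_ge0.
Qed.

Lemma le_eball n (c : 'rV[R]_n) r s : (r <= s)%R -> eball c r `<=` eball c s.
Proof. by move=> rs x /lt_le_trans; apply. Qed.

(** On the centered ball 1 <= exp (r^2 - |x|^2), so the volume is at most exp (r^2) times a Gaussian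
    integral. *)
Lemma borel_lebesgue_eball_lty n (c : 'rV[R]_n) r :
  borel_lebesgue R n (eball c r) < +oo.
Proof.
rewrite borel_lebesgue_eball.
have [r0|r0] := leP r 0%R; first by rewrite eball0// measure0.
have mB := measurable_eball (0%R : 'rV[R]_n) r.
apply: (@le_lt_trans _ _ (\int[borel_lebesgue R n]_x ((expR (r ^+ 2))%:E *
   (expR (- (1 * dotprod x x)))%:E))).
  rewrite -[X in borel_lebesgue R n X](setIT _) -(integral_indic _ measurableT mB).
  apply: ge0_le_integral => //.
  - by apply/measurable_EFinP; exact: measurable_indic.
  - apply/measurable_EFinP; apply: measurable_funM => //.
    have := @measurable_gaussianRn R n 1 0%R.
    by under eq_fun do rewrite subr0.
  - move=> x _; rewrite lee_fin indicE; case: (boolP (x \in _)) => [|_]; last first.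
      by rewrite mulr_ge0// expR_ge0.
    rewrite inE /eball/= subr0 => xr; rewrite -expRD mul1r -sqr_enorm.
    rewrite -expR0 ler_expR subr_ge0 ler_sqr ?nnegrE ?enorm_ge0 ?ltW//.
rewrite ge0_integralZl//.
- by rewrite ge0_integral_gaussRn// -EFinM ltry.
- apply/measurable_EFinP; have := @measurable_gaussianRn R n 1 0%R.
  by under eq_fun do rewrite subr0.
Qed.

Lemma consRn_measureX n (A : set R) (B : set (borelRn R n)) :
  measurable A -> measurable B ->
  borel_lebesgue R n.+1 (@unconsRn R n @^-1` (A `*` B)) =
    lebesgue_measure A * borel_lebesgue R n B.
Proof.
move=> mA mB; rewrite -product_measure1E//=.
rewrite /consRn_measure /pushforward -comp_preimage.
by rewrite (_ : @unconsRn R n \o @consRn R n = id) ?preimage_id//; exact/funext/consRnK.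
Qed.

Lemma measurable_unconsX n (A : set R) (B : set (borelRn R n)) :
  measurable A -> measurable B -> measurable (@unconsRn R n @^-1` (A `*` B)).
Proof.
move=> mA mB; rewrite -[X in measurable X]setTI.
by apply: measurable_unconsRn => //; exact: measurableX.
Qed.

(** By induction: the ball contains the product of the interval ]- r / 2, r / 2[ with the ball of
    radius r / 2 in one dimension less. *)
Lemma borel_lebesgue_eball_gt0 n (c : 'rV[R]_n) r : (0 < r)%R ->
  0 < borel_lebesgue R n (eball c r).
Proof.
rewrite borel_lebesgue_eball; elim: n {c} r => [|n IHn] r r0.
  rewrite /= /dirac indicE mem_set ?lte_fin//.
  by rewrite /eball/= subrr enorm0.
pose A := `](- (r / 2))%R, (r / 2)%R[%classic : set R.
pose B := eball (0%R : 'rV[R]_n) (r / 2)%R.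
have r20 : (0 < r / 2)%R by rewrite divr_gt0.
apply: (@lt_le_trans _ _ (borel_lebesgue R n.+1 (@unconsRn R n @^-1` (A `*` B)))).
  rewrite consRn_measureX; [|exact: measurable_itv|exact: measurable_eball].
  rewrite mule_gt0//; last exact: IHn.
  rewrite lebesgue_measure_itv/= lte_fin ifT; last by rewrite gtrN.
  by rewrite -EFinB lte_fin opprK addr_gt0.
apply: le_borel_lebesgue; first 2 last.
- move=> x; rewrite [x in eball _ _ x](consRnE x).
  rewrite [X in X -> _](_ : _ = (A `*` B) (unconsRn x))//.
  move: (unconsRn x) => [a y] [] /=.
  rewrite /A/= in_itv/= /B /eball/= !subr0 => ar yr.
  rewrite -(@ltr_sqr _ (enorm _)) ?nnegrE ?enorm_ge0 ?ltW// sqr_enorm dotprod_consRn.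
  have : (dotprod y y < (r / 2) ^+ 2)%R.
    by rewrite -sqr_enorm ltr_sqr// nnegrE ?enorm_ge0// ltW.
  move: ar => /andP[a1 a2]; nra.
- exact: (measurable_unconsX (measurable_itv _) (measurable_eball _ _)).
- exact: measurable_eball.
Qed.

(** The infinite first factor multiplies a positive one. Dimension 0 is excluded, as the measure is
    there a Dirac mass; later this makes every volume the volume of some ball. *)
Lemma borel_lebesgueT n : borel_lebesgue R n.+1 setT = +oo.
Proof.
have -> : [set: borelRn R n.+1] = @unconsRn R n @^-1` (setT `*` setT).
  by rewrite setXTT preimage_setT.
rewrite consRn_measureX//.
have -> : lebesgue_measure [set: R] = +oo.
  by have := @lebesgue_measure_itv R `]-oo, +oo[; rewrite set_itvNyy.
rewrite gt0_mulye//; apply: (@lt_le_trans _ _ (borel_lebesgue R n (eball 0%R 1%R))).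
  exact: borel_lebesgue_eball_gt0.
by apply: le_borel_lebesgue => //; exact: measurable_eball.
Qed.

End balls.

(** Continuity from above, in the form used to cut off tails: some member of a sequence decreasing
    to the empty set is already small. *)
Lemma measure_small d (T : measurableType d) (R : realType)
    (mu : {measure set T -> \bar R}) (F : (set T)^nat) (e : R) :
  (forall k, measurable (F k)) -> (mu (F 0%N) < +oo)%E ->
  nonincreasing_seq F -> \bigcap_k F k = set0 -> 0 < e ->
  exists N, (mu (F N) <= e%:E)%E.
Proof.
move=> mF F0 ndF F_0 e0.
have := @nonincreasing_cvg_mu _ _ _ mu F F0 mF _ ndF.
rewrite F_0 measure0 => /(_ measurable0) /fine_cvgP[[N1 _ HN1]].
move=> /cvgr_lt /(_ _ e0) [N2 _ HN2].
exists (maxn N1 N2); have /= f := HN1 _ (leq_maxl N1 N2).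
by rewrite -(fineK f) lee_fin ltW//; exact: (HN2 _ (leq_maxr N1 N2)).
Qed.

Lemma ler_coord_enorm (R : realType) n (x : 'rV[R]_n) i : x ord0 i <= enorm x.
Proof.
rewrite (le_trans (ler_norm _))// -sqrtr_sqr ler_sqrt ?dotprod_ge0//.
rewrite /dotprod (bigD1 i)//= expr2 lerDl.
by apply: sumr_ge0 => j _; rewrite -expr2 sqr_ge0.
Qed.

(** * Close pairs across the boundary of a set *)

Section near_pairs.
Context (R : realType) (n : nat).
Local Open Scope ereal_scope.
Local Notation L := (borel_lebesgue R n).
Local Notation Rn := (borelRn R n).
Implicit Types A C : set Rn.

Definition near_pairs (r : R) A C : set (Rn * Rn) :=
  [set z | [/\ A z.1, C z.2 & (enorm (z.1 - z.2) < r)%R]].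

Lemma measurable_near_pairs r A C : measurable A -> measurable C ->
  measurable (near_pairs r A C).
Proof.
move=> mA mC.
have -> : near_pairs r A C = (A `*` C) `&`
    (fun z : Rn * Rn => enorm (z.1 - z.2)) @^-1` `]-oo, r[.
  apply/seteqP; split => z /=; rewrite in_itv/=; first by case.
  by move=> [[? ?] ?]; split.
apply: measurableI; first exact: measurableX.
rewrite -[X in measurable X]setTI.
have := @measurable_fun_enormB R n _ (Rn * Rn)%type fst snd measurable_fst measurable_snd.
by move=> /(_ measurableT `]-oo, r[%classic); apply.
Qed.

(** With [C] the complement of [A], this plays the role of a perimeter at scale r. If it is small
    relative to |A| times the volume of an r-ball, then most points of [A] have an r-ball that lies
    mostly in [A]. *)
Definition Wnear r A C : \bar R := (L \x L) (near_pairs r A C).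

Lemma Wnear_sub r A C A1 C1 A2 C2 : measurable A -> measurable C ->
  measurable A1 -> measurable C1 -> measurable A2 -> measurable C2 ->
  (forall x y, A x -> C y -> (enorm (x - y) < r)%R -> (A1 x /\ C1 y) \/ (A2 x /\ C2 y)) ->
  Wnear r A C <= Wnear r A1 C1 + Wnear r A2 C2.
Proof.
move=> mA mC mA1 mC1 mA2 mC2 H.
apply: (@le_trans _ _ ((L \x L) (near_pairs r A1 C1 `|` near_pairs r A2 C2))).
  apply: le_measure; rewrite ?inE.
  - exact: measurable_near_pairs.
  - by apply: measurableU; exact: measurable_near_pairs.
  - move=> z [Az Cz zr]; have [[? ?]|[? ?]] := H _ _ Az Cz zr.
      by left; split.
    by right; split.
by apply: measureU2; exact: measurable_near_pairs.
Qed.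

Lemma le_Wnear r A C A1 C1 : measurable A -> measurable C ->
  measurable A1 -> measurable C1 ->
  (forall x y, A x -> C y -> (enorm (x - y) < r)%R -> (A1 x /\ C1 y)) ->
  Wnear r A C <= Wnear r A1 C1.
Proof.
move=> mA mC mA1 mC1 H.
apply: le_measure; rewrite ?inE; try exact: measurable_near_pairs.
by move=> z [Az Cz zr]; have [? ?] := H _ _ Az Cz zr; split.
Qed.

Lemma WnearE r A C : measurable A -> measurable C ->
  Wnear r A C = \int[L]_(x in A) L (eball x r `&` C).
Proof.
move=> mA mC; rewrite /Wnear /= /product_measure1/=.
rewrite [RHS]integral_mkcond; apply: eq_integral => x _.
rewrite /= patchE; case: ifPn => xA.
  congr (L _); apply/seteqP; split => y.
    rewrite /xsection/= inE => -[/= _ Cy xy]; split => //.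
    by rewrite /eball/= enormB.
  move=> [yx Cy]; rewrite /xsection/= inE; split => //=; first exact/set_mem.
  by rewrite enormB.
rewrite (_ : xsection _ _ = set0) ?measure0//.
apply/seteqP; split => // y; rewrite /xsection/= inE => -[/= Ax _ _].
by move: xA; rewrite notin_setE; apply.
Qed.

Lemma WnearC r A C : measurable A -> measurable C -> Wnear r A C = Wnear r C A.
Proof.
move=> mA mC; have mW := measurable_near_pairs r mA mC.
have mW' := measurable_near_pairs r mC mA.
rewrite /Wnear -(setIT (near_pairs r A C)) -(setIT (near_pairs r C A)).
rewrite -(integral_indic _ measurableT mW) -(integral_indic _ measurableT mW').
have m1 : measurable_fun [set: Rn * Rn] (fun z => (\1_(near_pairs r A C) z : R)%:E).
  by apply/measurable_EFinP; exact: measurable_indic.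
have m2 : measurable_fun [set: Rn * Rn] (fun z => (\1_(near_pairs r C A) z : R)%:E).
  by apply/measurable_EFinP; exact: measurable_indic.
rewrite (fubini_tonelli1 _ m1); last by move=> z; rewrite lee_fin.
rewrite (fubini_tonelli2 _ m2); last by move=> z; rewrite lee_fin.
apply: eq_integral => x _; apply: eq_integral => y _.
rewrite !indicE; congr (_%:R%:E); congr (nat_of_bool _).
by apply/idP/idP; rewrite !inE => -[/= ? ? ?]; split => //=; rewrite enormB.
Qed.

Lemma Wnear_le r A C : measurable A -> measurable C ->
  Wnear r A C <= L A * L (eball 0%R r).
Proof.
move=> mA mC; rewrite WnearE//.
apply: (@le_trans _ _ (\int[L]_(x in A) (cst (L (eball 0%R r)) x))); last first.
  by rewrite integral_cst// muleC.
apply: ge0_le_integral => //.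
- have := measurable_near_pairs r measurableT mC => mN.
  have -> : (fun x => L (eball x r `&` C)) = (fun x => L (xsection (near_pairs r setT C) x)).
    apply/funext => x; congr (L _); apply/seteqP; split => y.
      by move=> [yx Cy]; rewrite /xsection/= inE; split => //=; rewrite enormB.
    by rewrite /xsection/= inE => -[/= _ Cy xy]; split => //; rewrite /eball/= enormB.
  by apply: measurable_funTS; exact: (measurable_fun_xsection L mN).
- move=> x _ /=; rewrite -(borel_lebesgue_eball x); apply: le_borel_lebesgue.
  + by apply: measurableI => //; exact: measurable_eball.
  + exact: measurable_eball.
  + by apply: subIset; left.
Qed.

(** The straddling pairs inside the window [D] are o(|r-ball|) as r tends to 0. For a window of
    finite measure the property passes to complements and countable unions, so it can be proved on
    the generators of the sigma-algebra. *)
Definition Wsmall (D A : set Rn) := forall e : R, (0 < e)%R ->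
  exists2 r0 : R, (0 < r0)%R & forall r : R, (0 < r <= r0)%R ->
    Wnear r (A `&` D) (~` A `&` D) <= e%:E * L (eball 0%R r).

Lemma eball_fin r : L (eball 0%R r) \is a fin_num.
Proof. by rewrite ge0_fin_numE ?borel_lebesgue_eball_lty. Qed.

Section Dfin.
Variable D : set Rn.
Hypotheses (mD : measurable D) (Doo : L D < +oo).

Lemma WsmallC A : measurable A -> Wsmall D A -> Wsmall D (~` A).
Proof.
move=> mA WA e e0; have [r0 r00 H] := WA e e0; exists r0 => // r /H.
by rewrite setCK WnearC//; apply: measurableI => //; exact: measurableC.
Qed.

Lemma Wsmall0 : Wsmall D set0.
Proof.
move=> e e0; exists 1%R => // r _; rewrite set0I WnearE//; last first.
  by apply: measurableI => //; exact: measurableC.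
by rewrite integral_set0 mule_ge0// lee_fin ltW.
Qed.

(** A pair that straddles the boundary of the union straddles that of [A] or that of [B]. *)
Lemma WsmallU A B : measurable A -> measurable B ->
  Wsmall D A -> Wsmall D B -> Wsmall D (A `|` B).
Proof.
move=> mA mB WA WB e e0; have e20 : (0 < e / 2)%R by rewrite divr_gt0.
have [r1 r10 H1] := WA _ e20; have [r2 r20 H2] := WB _ e20.
exists (Num.min r1 r2); first by rewrite lt_min r10.
move=> r /andP[r0]; rewrite le_min => /andP[rr1 rr2].
apply: (@le_trans _ _ (Wnear r (A `&` D) (~` A `&` D) + Wnear r (B `&` D) (~` B `&` D))).
  apply: Wnear_sub; try by apply: measurableI => //; try exact: measurableC.
  - by apply: measurableI => //; exact: measurableU.
  - by apply: measurableI => //; apply: measurableC; exact: measurableU.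
  - by move=> x y [[Ax|Bx] Dx] []; rewrite setCU => -[nAy nBy] Dy _; [left|right]; split; split.
rewrite [e](splitr e) EFinD ge0_muleDl ?lee_fin ?(ltW e20)//.
by apply: leeD; [apply: H1|apply: H2]; rewrite r0.
Qed.

(** A finite union exhausts the window part of the countable one up to a set [T N] of measure at
    most e / 2. Pairs starting in [T N] cost at most |T N| times the volume of an r-ball. *)
Lemma Wsmall_bigcup (F : (set Rn)^nat) : (forall k, measurable (F k)) ->
  (forall k, Wsmall D (F k)) -> Wsmall D (\bigcup_k F k).
Proof.
move=> mF WF e e0; have e20 : (0 < e / 2)%R by rewrite divr_gt0.
pose G N := \big[setU/set0]_(i < N) F i.
have mG N : measurable (G N) by apply: bigsetU_measurable.
have WG N : Wsmall D (G N).
  elim: N => [|N IH]; first by rewrite /G big_ord0; exact: Wsmall0.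
  by rewrite /G big_ord_recr/=; apply: WsmallU; [exact: mG|exact: mF|exact: IH|exact: WF].
have mU : measurable (\bigcup_k F k) by exact: bigcup_measurable.
pose T N := (\bigcup_k F k) `&` D `\` G N.
have mT N : measurable (T N) by apply: measurableD => //; exact: measurableI.
have T0 : \bigcap_N T N = set0.
  apply/seteqP; split => // x H; have [[[k _ Fkx] _] _] := H 0%N I.
  have [_] := H k.+1 I; apply; rewrite /G big_ord_recr/=; by right.
have T0oo : L (T 0%N) < +oo.
  apply: le_lt_trans Doo; apply: le_borel_lebesgue => //.
  by move=> x [[]].
have ndG : nonincreasing_seq T.
  move=> a b ab; apply/subsetPset => x [[Fx Dx] nGx]; split => //.
  apply: contra_not nGx; rewrite /G -!bigcup_mkord => -[k /= ka Fkx].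
  by exists k => //=; exact: leq_trans ka ab.
have [N TN] := measure_small mT T0oo ndG T0 e20.
have [r0 r00 H] := WG N _ e20; exists r0 => // r rr0.
apply: (@le_trans _ _ (Wnear r (G N `&` D) (~` G N `&` D) + Wnear r (T N) setT)).
  have GF x : G N x -> (\bigcup_k F k) x.
    by rewrite /G -bigcup_mkord => -[k _ Fkx]; exists k.
  apply: Wnear_sub => //; try by apply: measurableI => //; try exact: measurableC.
  move=> x y [Fx Dx] [Fy Dy] _.
  have [Gx|nGx] := pselect (G N x); [left|right]; split => //; split => //.
  by move=> /GF.
rewrite [e](splitr e) EFinD ge0_muleDl ?lee_fin ?(ltW e20)//.
apply: leeD; first exact: H.
apply: (le_trans (Wnear_le _ _ _)) => //.
by apply: lee_wpmul2r => //.
Qed.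

(** A point above the hyperplane with a partner below it at distance less than r lies in a slab of
    width r, and the slabs inside [D] shrink to the empty set. *)
Lemma Wsmall_gt (i : 'I_n) (a : R) :
  Wsmall D [set x | (a < (x : 'rV[R]_n) ord0 i)%R].
Proof.
move=> e e0.
pose T k : set Rn := D `&`
  [set x | (a < (x : 'rV[R]_n) ord0 i < a + k.+1%:R^-1)%R].
have mT k : measurable (T k).
  apply: measurableI => //.
  have := measurable_borelRn_coord i measurableT (measurable_itv `]a, (a + k.+1%:R^-1)%R[).
  by rewrite setTI; congr measurable; apply/seteqP; split => x /=; rewrite in_itv.
have T0 : \bigcap_N T N = set0.
  apply/seteqP; split => // x H; have [_ /andP[ax _]] := H 0%N I.
  have d0 : (0 < (x : 'rV[R]_n) ord0 i - a)%R by rewrite subr_gt0.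
  have [N _ /(_ N (leqnn N))] := near_infty_natSinv_lt (PosNum d0).
  move=> /= HN; have [_ /andP[_]] := H N I.
  by rewrite -ltrBlDl ltNge (ltW HN).
have T0oo : L (T 0%N) < +oo.
  by apply: le_lt_trans Doo; apply: le_borel_lebesgue => // x [].
have ndT : nonincreasing_seq T.
  move=> p q pq; apply/subsetPset => x [Dx /andP[ax xa]]; split => //=.
  by rewrite ax (lt_le_trans xa)// lerD2l lef_pV2 ?posrE// ler_nat.
have [N TN] := measure_small mT T0oo ndT T0 e0.
exists (N.+1%:R^-1)%R => [|r /andP[r0 rN]]; first by rewrite invr_gt0.
have mH : measurable ([set x | (a < (x : 'rV[R]_n) ord0 i)%R] : set Rn).
  have := measurable_borelRn_coord i measurableT (measurable_itv `]a, +oo[).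
  by rewrite setTI; congr measurable; apply/seteqP; split => x /=; rewrite in_itv/= andbT.
apply: (@le_trans _ _ (Wnear r (T N) setT)).
  apply: le_Wnear => //.
  - exact: measurableI.
  - by apply: measurableI => //; exact: measurableC.
  - move=> x y [/= ax Dx] [/= /negP yx Dy] xy; split => //; split => //=.
    rewrite ax/=; move: yx; rewrite -leNgt => yx.
    have := ler_coord_enorm (x - y) i; rewrite !mxE.
    by move: rN; move: (_^-1)%R => q; lra.
apply: (le_trans (Wnear_le _ _ _)) => //.
by apply: lee_wpmul2r => //.
Qed.

(** Two inductions on generators: the sigma-algebra of R^n comes from preimages under the
    coordinates, and that of R from open half lines, whose preimages are half-spaces. *)
Lemma Wsmall_measurable A : measurable A -> Wsmall D A.
Proof.
suff : measurable `<=` [set A | measurable A /\ Wsmall D A].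
  by move=> H mA; have [] := H A mA.
apply: smallest_sub.
  split; first by split => //; exact: Wsmall0.
  - move=> B [mB WB]; rewrite setTD; split; first exact: measurableC.
    exact: WsmallC.
  - move=> F HF; split; first by apply: bigcup_measurable => k _; have [] := HF k.
    by apply: Wsmall_bigcup => k; have [] := HF k.
move=> B; rewrite -bigcup_seq/= => -[i _] [Y mY <-]; rewrite setTI.
pose coord (x : Rn) : R := (x : 'rV[R]_n) ord0 i.
have mc Y' : measurable Y' -> measurable (coord @^-1` Y').
  move=> mY'; rewrite -[X in measurable X]setTI.
  exact: (measurable_borelRn_coord i measurableT mY').
suff : measurable `<=` [set Y | measurable Y /\ Wsmall D (coord @^-1` Y)].
  by move=> /(_ Y mY)[_ WY]; split => //; exact: mc.
rewrite [X in X `<=` _]RGenOInfty.measurableE; apply: smallest_sub.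
  split; first by split => //; rewrite preimage_set0; exact: Wsmall0.
  - move=> Z [mZ WZ]; rewrite setTD; split; first exact: measurableC.
    by rewrite preimage_setC; apply: WsmallC => //; exact: mc.
  - move=> F HF; split; first by apply: bigcup_measurable => k _; have [] := HF k.
    rewrite preimage_bigcup; apply: Wsmall_bigcup => k; have [mF WF] := HF k => //.
    exact: mc.
move=> _ [a ->]; split; first exact: measurable_itv.
have -> : coord @^-1` `]a, +oo[ = [set x | (a < (x : 'rV[R]_n) ord0 i)%R].
  by apply/seteqP; split => x /=; rewrite in_itv/= andbT.
exact: Wsmall_gt.
Qed.

End Dfin.

(* The L^1-continuity of translations, averaged over a small ball. *)
Lemma Wnear_compl_small A : measurable A -> L A < +oo -> forall e : R, (0 < e)%R ->
  exists2 r0 : R, (0 < r0)%R & forall r : R, (0 < r <= r0)%R ->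
    Wnear r A (~` A) <= e%:E * L (eball 0%R r).
Proof.
move=> mA Aoo e e0; have e20 : (0 < e / 2)%R by rewrite divr_gt0.
pose B k : set Rn := eball 0%R k%:R.
have mB k : measurable (B k) by exact: measurable_eball.
pose T k := A `\` B k.
have mT k : measurable (T k) by apply: measurableD.
have T0 : \bigcap_N T N = set0.
  apply/seteqP; split => // x H.
  have [_] := H (Num.truncn (enorm x)).+1 I; apply.
  by rewrite /B /eball/= subr0 truncnS_gt.
have T0oo : L (T 0%N) < +oo.
  by apply: le_lt_trans Aoo; apply: le_borel_lebesgue => // x [].
have ndT : nonincreasing_seq T.
  move=> p q pq; apply/subsetPset => x [Ax nBx]; split => //.
  by apply: contra_not nBx; apply: le_eball; rewrite ler_nat.
have [N TN] := measure_small mT T0oo ndT T0 e20.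
(* The window has radius N + 1 because, for r <= 1, the partner of a point of the ball of radius N
   lies in it. Points of [A] outside that ball are charged to the small tail [T N]. *)
have [r0 r00 H] := @Wsmall_measurable (B N.+1) (mB _) (borel_lebesgue_eball_lty _ _) A mA _ e20.
exists (Num.min r0 1%R); first by rewrite lt_min r00 ltr01.
move=> r /andP[rgt0]; rewrite le_min => /andP[rr0 r1].
apply: (@le_trans _ _ (Wnear r (A `&` B N.+1) (~` A `&` B N.+1) + Wnear r (T N) setT)).
  apply: Wnear_sub => //; try by apply: measurableI => //; try exact: measurableC.
  - exact: measurableC.
  - move=> x y Ax Ay xy; have [Bx|nBx] := pselect (B N x); last by right; split.
    move: Bx; rewrite /B /eball/= subr0 => Bx.
    left; split; split => //.
      by rewrite (lt_le_trans Bx)// ler_nat.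
    rewrite subr0; have := ler_enorm_distD x y 0; rewrite !subr0 => /le_lt_trans; apply.
    rewrite enormB -natr1 addrC; apply: ltr_leD => //; exact: le_trans (ltW xy) r1.
rewrite [e](splitr e) EFinD ge0_muleDl ?lee_fin ?(ltW e20)//.
apply: leeD; first by apply: H; rewrite rgt0.
apply: (le_trans (Wnear_le _ _ _)) => //.
by apply: lee_wpmul2r => //.
Qed.

End near_pairs.

(** * Balls of prescribed volume *)

Section ball_volume.
Context (R : realType) (n : nat).
Local Open Scope ereal_scope.
Local Notation L := (borel_lebesgue R n.+1).

Lemma measurable_sphere (r : R) :
  measurable ([set x | enorm x = r] : set (borelRn R n.+1)).
Proof.
have := @measurable_fun_enormB R n.+1 _ (borelRn R n.+1) id (cst 0%R)
  (@measurable_id _ _ _) (@measurable_cst _ _ _ _ _ _).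
move=> /(_ measurableT [set r] (measurable_set1 _)); rewrite setTI.
by congr measurable; apply/seteqP; split => x /=; rewrite subr0.
Qed.

(** Every line parallel to the first axis meets the sphere in at most two points; Tonelli with the
    first coordinate integrated innermost concludes. *)
Lemma borel_lebesgue_sphere (r : R) : L [set x | enorm x = r] = 0.
Proof.
have mS := measurable_sphere r.
rewrite -(setIT [set x | _]) -(integral_indic _ measurableT mS).
have mI : measurable_fun [set: borelRn R n.+1]
    (fun x => (\1_[set x : 'rV[R]_n.+1 | enorm x = r] x : R)%:E).
  by apply/measurable_EFinP; exact: measurable_indic.
rewrite ge0_integral_consRn//.
rewrite (fubini_tonelli (fun z : measurableTypeR R * borelRn R n =>
  (\1_[set x : 'rV[R]_n.+1 | enorm x = r] (consRn z))%:E)); last 2 first.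
- by apply: (measurableT_comp mI); exact: measurable_consRn.
- by move=> z; rewrite lee_fin.
apply: integral0_eq => x _ /=.
pose k : R := (r ^+ 2 - dotprod x x)%R.
pose S : set R := [set a | enorm (consRn (a, x)) = r].
have mS1 : measurable S.
  rewrite -[X in measurable X]setTI.
  apply: (@measurableT_comp _ _ _ _ _ _ (fun x : borelRn R n.+1 => x) _
    (fun a : measurableTypeR R => consRn (a, x))) mS => //.
  apply: (@measurableT_comp _ _ _ _ _ _ (@consRn R n) _
    (fun a : measurableTypeR R => (a, x))); first exact: measurable_consRn.
  exact: pair2_measurable.
transitivity (\int[lebesgue_measure]_a (\1_S a : R)%:E).
  by apply: eq_integral => a _; rewrite !indicE.
rewrite integral_indic//= setIT.
apply: countable_lebesgue_measure0; apply: finite_set_countable.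
apply: (@sub_finite_set _ _ [set Num.sqrt k; (- Num.sqrt k)%R]); last first.
  exact: finite_set2.
move=> a /= /(congr1 (fun t => t ^+ 2)%R).
rewrite sqr_enorm dotprod_consRn -expr2 => ar.
have -> : k = (a ^+ 2)%R by rewrite /k -ar; ring.
rewrite sqrtr_sqr; have [a0|a0] := ger0P a; first by left.
by right; rewrite opprK.
Qed.

(** The radius is the supremum of those whose ball has volume at most [m]. Open balls are continuous
    from below, which gives one inequality; the other is continuity from above, up to a sphere. *)
Lemma exists_eball_volume (m : R) : (0 <= m)%R ->
  exists2 r : R, (0 <= r)%R & L (eball 0%R r) = m%:E.
Proof.
move=> m0.
have mB r : measurable (eball 0%R r : set (borelRn R n.+1)) by exact: measurable_eball.
pose S := [set r : R | (0 <= r)%R /\ L (eball 0%R r) <= m%:E].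
have S0 : S 0%R by split => //; rewrite eball0// measure0.
have [N HN] : exists N : nat, m%:E < L (eball 0%R N%:R).
  pose F (k : nat) : set (borelRn R n.+1) := eball 0%R k%:R.
  have FT : \bigcup_k F k = [set: borelRn R n.+1].
    apply/seteqP; split => // x _; exists (Num.truncn (enorm x)).+1 => //.
    by rewrite /F /eball/= subr0 truncnS_gt.
  have ndF : nondecreasing_seq F.
    by move=> p q pq; apply/subsetPset; apply: le_eball; rewrite ler_nat.
  have := @nondecreasing_cvg_mu _ _ _ L F (fun _ => mB _) _ ndF.
  rewrite FT => /(_ measurableT); rewrite [X in _ --> X](_ : _ = +oo); last exact: borel_lebesgueT.
  move=> /cvgey_ge /(_ (m + 1)%R) [N _ HN].
  exists N; apply: (lt_le_trans _ (HN N (leqnn N))).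
  by rewrite lte_fin ltrDl.
have ubS : has_ubound S.
  exists N%:R => r [r0 Lr]; rewrite leNgt; apply/negP => Nr.
  have := lt_le_trans HN (le_trans (le_borel_lebesgue (mB _) (mB _) (le_eball (ltW Nr))) Lr).
  by rewrite ltxx.
pose r := sup S.
have r0 : (0 <= r)%R by exact: ub_le_sup.
exists r => //; apply/eqP; rewrite eq_le; apply/andP; split.
  pose F (k : nat) : set (borelRn R n.+1) := eball 0%R (r - k.+1%:R^-1)%R.
  have FT : \bigcup_k F k = eball 0%R r.
    apply/seteqP; split => x; rewrite /F /eball/= subr0.
      by move=> [k _] /=; rewrite subr0 => /lt_le_trans; apply; rewrite gerBl.
    rewrite -subr_gt0 => xr.
    have [k _ /(_ k (leqnn k))] := near_infty_natSinv_lt (PosNum xr).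
    by move=> /= kx; exists k => //=; rewrite subr0; move: kx; move: (_^-1)%R => q; lra.
  have ndF : nondecreasing_seq F.
    move=> p q pq; apply/subsetPset; apply: le_eball.
    by rewrite lerB// lef_pV2 ?posrE// ler_nat.
  have := @nondecreasing_cvg_mu _ _ _ L F (fun _ => mB _) _ ndF.
  rewrite FT => /(_ (mB _)) H; rewrite -(cvg_lim _ H)//.
  apply: lime_le; first by apply/cvg_ex; eexists; exact: H.
  apply: nearW => k /=; have k0 : (0 < k.+1%:R^-1 :> R)%R by rewrite invr_gt0.
  have [s [s0 Ls] rs] := sup_adherent k0 (conj (ex_intro _ 0%R S0) ubS).
  apply: le_trans Ls; apply: le_borel_lebesgue => //.
  - exact: mB.
  - by apply: le_eball; exact: ltW.
(* These balls have volume greater than [m] and decrease to the closed ball, whose boundary sphere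
   is null. *)
pose F (k : nat) : set (borelRn R n.+1) := eball 0%R (r + k.+1%:R^-1)%R.
have FT : \bigcap_k F k = eball 0%R r `|` [set x | enorm x = r].
  apply/seteqP; split => x; rewrite /eball/= subr0.
    move=> H; suff : (enorm x <= r)%R by rewrite le_eqVlt => /orP[/eqP|]; [right|left].
    rewrite leNgt; apply/negP; rewrite -subr_gt0 => xr.
    have [k _ /(_ k (leqnn k))] := near_infty_natSinv_lt (PosNum xr).
    have := H k I; rewrite /F /eball/= subr0.
    by move: (_^-1)%R => q; lra.
  move=> H k _; rewrite /F /eball/= subr0.
  have k0 : (0 < k.+1%:R^-1 :> R)%R by rewrite invr_gt0.
  by move: k0 H; move: (_^-1)%R => q q0 [|]; lra.
have ndF : nonincreasing_seq F.
  move=> p q pq; apply/subsetPset; apply: le_eball.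
  by rewrite lerD// lef_pV2 ?posrE// ler_nat.
have := @nonincreasing_cvg_mu _ _ _ L F (borel_lebesgue_eball_lty _ _) (fun _ => mB _) _ ndF.
have mU : measurable (eball 0%R r `|` [set x | enorm x = r] : set (borelRn R n.+1)).
  by apply: measurableU => //; exact: measurable_sphere.
rewrite FT => /(_ mU) H.
have mUL : m%:E <= L (eball 0%R r `|` [set x | enorm x = r]); last first.
  apply: (le_trans mUL); apply: (le_trans (measureU2 _ (mB _) (measurable_sphere r))).
  by rewrite [X in _ + X <= _]borel_lebesgue_sphere adde0.
have <- := cvg_lim _ H => //.
apply: lime_ge; first by apply/cvg_ex; eexists; exact: H.
apply: nearW => k /=; rewrite leNgt; apply/negP => Lk.
have k0 : (0 < k.+1%:R^-1 :> R)%R by rewrite invr_gt0.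
have : (r + k.+1%:R^-1 <= r)%R.
  apply: ub_le_sup => //; split; first by rewrite addr_ge0// ltW.
  exact: ltW.
by rewrite gerDl leNgt k0.
Qed.

End ball_volume.

(** * Energies and polarization *)

(** If the integral of g - f vanished, g and f would agree almost everywhere, which the positive
    measure of [D] forbids. The finite integral of [f] allows it to be cancelled. *)
Lemma ge0_integral_lt d (T : measurableType d) (R : realType)
    (mu : {measure set T -> \bar R}) (f g : T -> R) (D : set T) :
  measurable_fun setT f -> measurable_fun setT g -> measurable D ->
  (forall x, 0 <= f x) -> (forall x, f x <= g x) ->
  (forall x, D x -> f x < g x) -> (0 < mu D)%E ->
  (\int[mu]_x (f x)%:E < +oo)%E ->
  (\int[mu]_x (f x)%:E < \int[mu]_x (g x)%:E)%E.
Proof.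
move=> mf mg mD f0 fg fgD D0 foo.
have gf0 x : 0 <= g x - f x by rewrite subr_ge0.
have mgf : measurable_fun setT (fun x => (g x - f x)%:E).
  by apply/measurable_EFinP; exact: measurable_funB.
have -> : (\int[mu]_x (g x)%:E = \int[mu]_x (f x)%:E + \int[mu]_x (g x - f x)%:E)%E.
  rewrite -ge0_integralD//; last 3 first.
  - by move=> x _; rewrite lee_fin.
  - exact/measurable_EFinP.
  - by move=> x _; rewrite lee_fin.
  by apply: eq_integral => x _; rewrite -EFinD addrC subrK.
rewrite lteDl; last by rewrite ge0_fin_numE// integral_ge0// => x _; rewrite lee_fin.
rewrite lt_neqAle integral_ge0 ?andbT; last by move=> x _; rewrite lee_fin.
apply/negP => /eqP /esym H0.
have : (\int[mu]_x `|(g x - f x)%:E| = 0)%E.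
  by rewrite -H0; apply: eq_integral => x _; rewrite gee0_abs// lee_fin.
move/(ae_eq_integral_abs mu measurableT mgf).1 => -[N [mN N0 NS]].
have : (mu D <= mu N)%E.
  apply: le_measure; rewrite ?inE// => x Dx; apply: NS => /= /(_ I) /eqP.
  by rewrite eqe subr_eq0 gt_eqF// fgD.
by rewrite N0 leNgt D0.
Qed.

Section energy.
Context (R : realType) (n : nat).
Local Open Scope ereal_scope.
Local Notation L := (borel_lebesgue R n).
Local Notation Rn := (borelRn R n).
Implicit Types A C P Q : set Rn.

Variable k : R -> R.

(** The kernel is a function of the squared distance, to which [dist2_refl] applies directly. The
    section covers both the Gaussian and the cut-off kernel [near_kernel], which is only weakly
    decreasing. *)
Definition pot C (x : Rn) : \bar R := \int[L]_y (k (dist2 x y) * \1_C y)%:E.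

Definition energy A C : \bar R := \int[L]_x ((\1_A x)%:E * pot C x).

Hypothesis mk : measurable_fun setT k.
Hypothesis k0 : forall t, (0 <= k t)%R.
Hypothesis k1 : forall t, (0 <= t)%R -> (k t <= 1)%R.
Hypothesis kni : forall s t, (0 <= s)%R -> (s < t)%R -> (k t <= k s)%R.

Lemma measurable_kernel d (T : measurableType d) (f g : T -> Rn) :
  measurable_fun setT f -> measurable_fun setT g ->
  measurable_fun setT (fun t => k (dist2 (f t) (g t))).
Proof.
move=> mf mg; apply: (measurableT_comp mk).
by apply: measurable_fun_dotprod; apply: measurable_borelRnB.
Qed.

Lemma pot_ge0 C x : 0 <= pot C x.
Proof. by apply: integral_ge0 => y _; rewrite lee_fin mulr_ge0. Qed.

Lemma measurable_pot C : measurable C -> measurable_fun [set: Rn] (pot C).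
Proof.
move=> mC; apply: (@measurable_fun_fubini_tonelli_F _ _ _ _ _ _
  (fun z : Rn * Rn => (k (dist2 z.1 z.2) * \1_C z.2)%:E)).
  apply/measurable_EFinP; apply: measurable_funM.
    by apply: measurable_kernel; [exact: measurable_fst|exact: measurable_snd].
  exact: (measurableT_comp (measurable_indic _) measurable_snd).
by move=> z; rewrite lee_fin mulr_ge0.
Qed.

Lemma pot_le C x : measurable C -> pot C x <= L C.
Proof.
move=> mC; rewrite -[X in _ <= L X](setIT C) -(integral_indic _ measurableT mC).
apply: ge0_le_integral => //.
- by move=> y _; rewrite lee_fin mulr_ge0.
- apply/measurable_EFinP; apply: measurable_funM; last exact: measurable_indic.
  by apply: measurable_kernel.
- by apply/measurable_EFinP; exact: measurable_indic.
- by move=> y _; rewrite lee_fin ler_piMl// k1// dist2_ge0.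
Qed.

Lemma energy_ge0 A C : 0 <= energy A C.
Proof. by apply: integral_ge0 => y _; rewrite mule_ge0// ?lee_fin// pot_ge0. Qed.

Lemma energyC A C : measurable A -> measurable C -> energy A C = energy C A.
Proof.
move=> mA mC.
have mI : measurable_fun [set: Rn * Rn]
    (fun z => ((\1_A z.1)%:E * (k (dist2 z.1 z.2) * \1_C z.2)%:E)).
  apply: emeasurable_funM; apply/measurable_EFinP.
    exact: (measurableT_comp (measurable_indic _) measurable_fst).
  apply: measurable_funM.
    by apply: measurable_kernel; [exact: measurable_fst|exact: measurable_snd].
  exact: (measurableT_comp (measurable_indic _) measurable_snd).
transitivity (\int[L]_x \int[L]_y ((\1_A x)%:E * (k (dist2 x y) * \1_C y)%:E)).
  apply: eq_integral => x _; rewrite -ge0_integralZl ?lee_fin//.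
    apply/measurable_EFinP; apply: measurable_funM; last exact: measurable_indic.
    by apply: measurable_kernel.
  by move=> y _; rewrite lee_fin mulr_ge0.
rewrite (fubini_tonelli _ mI); last by move=> z; rewrite mule_ge0// lee_fin// mulr_ge0.
apply: eq_integral => y _ /=; rewrite -ge0_integralZl ?lee_fin//.
- by apply: eq_integral => x _; rewrite -!EFinM; congr EFin; rewrite dist2C; ring.
- apply/measurable_EFinP; apply: measurable_funM; last exact: measurable_indic.
  by apply: measurable_kernel.
- by move=> x _; rewrite lee_fin mulr_ge0.
Qed.

Lemma energyUl A B C : measurable A -> measurable B -> measurable C ->
  A `&` B = set0 -> energy (A `|` B) C = energy A C + energy B C.
Proof.
move=> mA mB mC AB0.
rewrite -ge0_integralD//; last 4 first.
- by move=> x _; rewrite mule_ge0// ?lee_fin// pot_ge0.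
- apply: emeasurable_funM; last exact: measurable_pot.
  by apply/measurable_EFinP; exact: measurable_indic.
- by move=> x _; rewrite mule_ge0// ?lee_fin// pot_ge0.
- apply: emeasurable_funM; last exact: measurable_pot.
  by apply/measurable_EFinP; exact: measurable_indic.
apply: eq_integral => x _; rewrite -ge0_muleDl ?lee_fin// -EFinD; congr (_%:E * _).
rewrite !indicE in_setU; have [xA|xA] := boolP (x \in A); last by rewrite add0r.
suff -> : (x \in B) = false by rewrite addr0.
apply/negP => xB; have : (A `&` B) x by split; exact/set_mem.
by rewrite AB0.
Qed.

Lemma energyUr A B C : measurable A -> measurable B -> measurable C ->
  A `&` B = set0 -> energy C (A `|` B) = energy C A + energy C B.
Proof.
move=> mA mB mC AB0; have mAB := measurableU _ _ mA mB.
by rewrite (energyC mC mAB) (energyUl mA mB mC AB0) (energyC mA mC) (energyC mB mC).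
Qed.

Lemma energy_le A C : measurable A -> measurable C -> energy A C <= L A * L C.
Proof.
move=> mA mC; apply: (@le_trans _ _ (\int[L]_x ((\1_A x)%:E * L C))).
  apply: ge0_le_integral => //.
  - by move=> x _; rewrite mule_ge0// ?lee_fin// pot_ge0.
  - apply: emeasurable_funM; last exact: measurable_pot.
    by apply/measurable_EFinP; exact: measurable_indic.
  - by apply: emeasurable_funM => //; apply/measurable_EFinP; exact: measurable_indic.
  - by move=> x _; rewrite lee_wpmul2l ?lee_fin// pot_le.
rewrite ge0_integralZr//; last by apply/measurable_EFinP; exact: measurable_indic.
by rewrite integral_indic// setIT.
Qed.

Lemma energy_fin A C : measurable A -> measurable C -> L A < +oo -> L C < +oo ->
  exists e : R, energy A C = e%:E.
Proof.
move=> mA mC Aoo Coo; exists (fine (energy A C)); rewrite fineK//.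
rewrite ge0_fin_numE ?energy_ge0//; apply: (le_lt_trans (energy_le mA mC)).
by rewrite -ge0_fin_numE ?mule_ge0// fin_numM// ge0_fin_numE.
Qed.

Section polarization.
Variables v m : 'rV[R]_n.
Hypothesis v0 : v != 0%R.
Local Notation s := (refl v m).

Lemma measurable_preimage_refl A : measurable A -> measurable (s @^-1` A : set Rn).
Proof. by move=> mA; rewrite -[X in measurable X]setTI; exact: measurable_refl. Qed.

Lemma pot_refl C x : measurable C -> pot (s @^-1` C) x = pot C (s x).
Proof.
move=> mC; rewrite /pot -(ge0_integral_refl m v0 (f := fun y => (k (dist2 (s x) y) * \1_C y)%:E)).
- by apply: eq_integral => y _; rewrite dist2_refl2.
- apply/measurable_EFinP; apply: measurable_funM; last exact: measurable_indic.
  exact: measurable_kernel.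
- by move=> y; rewrite lee_fin mulr_ge0.
Qed.

Lemma energy_refl A C : measurable A -> measurable C ->
  energy (s @^-1` A) (s @^-1` C) = energy A C.
Proof.
move=> mA mC; rewrite /energy -[RHS](ge0_integral_refl m v0).
- by apply: eq_integral => x _; rewrite pot_refl.
- apply: emeasurable_funM; last exact: measurable_pot.
  by apply/measurable_EFinP; exact: measurable_indic.
- by move=> x; rewrite mule_ge0// ?lee_fin// pot_ge0.
Qed.

Lemma pot_refl_le C x : measurable C -> (forall y, C y -> (0 < side v m y)%R) ->
  (0 < side v m x)%R -> pot C (s x) <= pot C x.
Proof.
move=> mC Cs sx; apply: ge0_le_integral => //.
- by move=> y _; rewrite lee_fin mulr_ge0.
- apply/measurable_EFinP; apply: measurable_funM; last exact: measurable_indic.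
  exact: measurable_kernel.
- apply/measurable_EFinP; apply: measurable_funM; last exact: measurable_indic.
  exact: measurable_kernel.
- move=> y _; rewrite lee_fin indicE; have [Cy|_] := boolP (y \in C); last by rewrite !mulr0.
  by rewrite !mulr1 kni// ?dist2_ge0// dist2_refl_lt//; exact/Cs/set_mem.
Qed.

Lemma pot_refl_lt C x : (forall a b, (0 <= a)%R -> (a < b)%R -> (k b < k a)%R) ->
  measurable C -> L C < +oo -> 0 < L C -> (forall y, C y -> (0 < side v m y)%R) ->
  (0 < side v m x)%R -> pot C (s x) < pot C x.
Proof.
move=> kd mC Coo C0 Cs sx; apply: (@ge0_integral_lt _ _ _ _ _ _ C) => //.
- apply: measurable_funM; last exact: measurable_indic.
  exact: measurable_kernel.
- apply: measurable_funM; last exact: measurable_indic.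
  exact: measurable_kernel.
- by move=> y; rewrite mulr_ge0.
- move=> y; rewrite indicE; have [Cy|_] := boolP (y \in C); last by rewrite !mulr0.
  by rewrite !mulr1 kni// ?dist2_ge0// dist2_refl_lt//; exact/Cs/set_mem.
- move=> y Cy; rewrite indicE mem_set// !mulr1.
  by rewrite kd// ?dist2_ge0// dist2_refl_lt//; exact/Cs.
- exact: (le_lt_trans (pot_le _ mC)).
Qed.

Section set_polarization.
Variable A : set Rn.
Hypotheses (mA : measurable A) (Aoo : L A < +oo).

(** Of each mirror pair, [A] contains both points ([symset], with the points of [A] on the
    hyperplane), only the positive one ([keepset]) or only the negative one. In the last case
    polarization exchanges it for the positive one, which lies in [gainset]. *)
Definition gainset : set Rn := [set x | [/\ (0 < side v m x)%R, ~ A x & A (s x)]].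
Definition keepset : set Rn := [set x | [/\ (0 < side v m x)%R, A x & ~ A (s x)]].
Definition symset : set Rn := A `&` s @^-1` A.
Definition polar : set Rn := (symset `|` keepset) `|` gainset.

Local Notation P := gainset.
Local Notation Q := keepset.
Local Notation S := symset.

Lemma measurable_side_gt0 : measurable ([set x | (0 < side v m x)%R] : set Rn).
Proof.
have := @measurable_side R n v m measurableT `]0%R, +oo[%classic (measurable_itv _).
by rewrite setTI; congr measurable; apply/seteqP; split => x /=; rewrite in_itv/= andbT.
Qed.

Lemma measurable_gainset : measurable P.
Proof.
have -> : P = [set x | (0 < side v m x)%R] `&` (~` A `&` s @^-1` A).
  by apply/seteqP; split => x /=; [case|move=> [? [? ?]]; split].
apply: measurableI; first exact: measurable_side_gt0.
by apply: measurableI; [exact: measurableC|exact: measurable_preimage_refl].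
Qed.

Lemma measurable_keepset : measurable Q.
Proof.
have -> : Q = [set x | (0 < side v m x)%R] `&` (A `&` ~` (s @^-1` A)).
  by apply/seteqP; split => x /=; [case|move=> [? [? ?]]; split].
apply: measurableI; first exact: measurable_side_gt0.
by apply: measurableI => //; apply: measurableC; exact: measurable_preimage_refl.
Qed.

Lemma measurable_symset : measurable S.
Proof. by apply: measurableI => //; exact: measurable_preimage_refl. Qed.

Lemma symset_refl : s @^-1` S = S.
Proof.
rewrite /symset preimage_setI setIC; congr (_ `&` _).
by apply/seteqP; split => x /=; rewrite reflK.
Qed.

(** Together with the definition of [polar], this exhibits [A] and its polarization as the same set
    up to replacing the reflected [P] by [P]. *)
Lemma set_polarE : A = (S `|` Q) `|` s @^-1` P.
Proof.
apply/seteqP; split => x.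
  move=> Ax; have [Asx|nAsx] := pselect (A (s x)); first by left; left.
  have [sx|sx|sx] := ltgtP 0%R (side v m x).
  - by left; right.
  - by right; split; rewrite ?reflK// side_refl// oppr_gt0.
  (* A point on the hyperplane is its own mirror image. *)
  - by case: nAsx; rewrite /refl -sx mulr0 mul0r scale0r subr0.
by move=> [[[]|[]]|[_ _]]//=; rewrite reflK.
Qed.

Lemma SQ0 : S `&` Q = set0.
Proof. by apply/seteqP; split => // x [[_ ?] []]. Qed.

Lemma SQP0 : (S `|` Q) `&` P = set0.
Proof. by apply/seteqP; split => // x [[[? ?]|[? ? ?]] []]. Qed.

Lemma SQsP0 : (S `|` Q) `&` (s @^-1` P) = set0.
Proof.
apply/seteqP; split => // x [[[? ?]|[sx ? ?]] []]//=.
by rewrite side_refl// oppr_gt0 ltNge ltW.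
Qed.

Let mS := measurable_symset.
Let mQ := measurable_keepset.
Let mP := measurable_gainset.
Let msP := measurable_preimage_refl mP.
Let mSQ : measurable (S `|` Q). Proof. exact: measurableU. Qed.

Lemma measurable_polar : measurable polar. Proof. exact: measurableU. Qed.

Lemma borel_lebesgue_polar : L polar = L A.
Proof.
have H1 := @measureU _ _ _ L _ _ mSQ mP SQP0.
have H2 := @measureU _ _ _ L _ _ mSQ msP SQsP0.
transitivity (L ((S `|` Q) `|` s @^-1` P)); last by rewrite -set_polarE.
apply: (etrans H1); apply/esym; apply: (etrans H2); congr (_ + _).
exact: borel_lebesgue_refl.
Qed.

Let Soo : L S < +oo.
Proof. by apply: le_lt_trans Aoo; apply: le_borel_lebesgue => // x []. Qed.

Let Qoo : L Q < +oo.
Proof. by apply: le_lt_trans Aoo; apply: le_borel_lebesgue => // x []. Qed.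

Let sPoo : L (s @^-1` P) < +oo.
Proof.
by apply: le_lt_trans Aoo; apply: le_borel_lebesgue => // x [_ _]; rewrite reflK.
Qed.

Let Poo : L P < +oo. Proof. by rewrite -(borel_lebesgue_refl m v0 mP). Qed.

(** Expand both energies bilinearly. The reflection fixes [S] and preserves energies, so the terms
    with S, P and P, P agree on the two sides, and only the interaction of [Q] with [P] changes. It
    is counted twice by symmetry, and is placed so that no subtraction occurs in the extended
    reals. *)
Lemma energy_polar :
  energy A A + (energy Q P + energy Q P) =
  energy polar polar + (energy Q (s @^-1` P) + energy Q (s @^-1` P)).
Proof.
have UE B : measurable B -> (S `|` Q) `&` B = set0 ->
    energy ((S `|` Q) `|` B) ((S `|` Q) `|` B) =
    energy (S `|` Q) (S `|` Q) + (energy S B + energy Q B) + ((energy S B + energy Q B) + energy B B).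
  move=> mB SQB0; have mU : measurable ((S `|` Q) `|` B) by exact: measurableU.
  rewrite (energyUl mSQ mB mU SQB0) (energyUr mSQ mB mSQ SQB0) (energyUr mSQ mB mB SQB0) (energyC mB mSQ).
  by rewrite (energyUl mS mQ mB SQ0).
have -> : energy A A = energy ((S `|` Q) `|` s @^-1` P) ((S `|` Q) `|` s @^-1` P).
  by rewrite -set_polarE.
rewrite (UE _ msP SQsP0) /polar (UE _ mP SQP0).
have -> : energy S (s @^-1` P) = energy S P.
  by rewrite -{1}symset_refl (energy_refl mS mP).
rewrite (energy_refl mP mP).
have [a ->] := energy_fin mQ mP Qoo Poo.
have [b ->] := energy_fin mQ msP Qoo sPoo.
have [c ->] := energy_fin mS mP Soo Poo.
have [e ->] := energy_fin mP mP Poo Poo.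
have SQoo : L (S `|` Q) < +oo.
  by apply: le_lt_trans (measureU2 _ mS mQ) _; rewrite lte_add_pinfty.
have [f ->] := energy_fin mSQ mSQ SQoo SQoo.
by rewrite -!EFinD; congr EFin; ring.
Qed.

Lemma energy_keep_refl : energy Q (s @^-1` P) = \int[L]_x ((\1_Q x)%:E * pot P (s x)).
Proof. by apply: eq_integral => x _; rewrite pot_refl. Qed.

(** What remains to compare is the interaction of [Q] with [P] and with the reflection of [P]. Both
    [Q] and [P] lie on the positive side, so the reflection increases distances and decreases the
    kernel. *)
Lemma le_energy_polar : energy A A <= energy polar polar.
Proof.
have mpolar := measurable_polar.
have poo : L polar < +oo by rewrite borel_lebesgue_polar.
have : energy Q (s @^-1` P) <= energy Q P.
  rewrite energy_keep_refl; apply: ge0_le_integral => //.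
  - by move=> x _; rewrite mule_ge0// ?lee_fin// pot_ge0.
  - apply: emeasurable_funM; first by apply/measurable_EFinP; exact: measurable_indic.
    by apply: (measurableT_comp (measurable_pot mP)); exact: measurable_refl.
  - apply: emeasurable_funM; last exact: measurable_pot.
    by apply/measurable_EFinP; exact: measurable_indic.
  - move=> x _; rewrite indicE; have [Qx|_] := boolP (x \in Q); last by rewrite !mul0e.
    rewrite !mul1e; apply: pot_refl_le => //; first by move=> y [].
    by have [] := set_mem Qx.
have := energy_polar.
have [a ->] := energy_fin mQ mP Qoo Poo.
have [b ->] := energy_fin mQ msP Qoo sPoo.
have [c ->] := energy_fin mA mA Aoo Aoo.
have [e ->] := energy_fin mpolar mpolar poo poo.
by rewrite -!EFinD => -[]; rewrite !lee_fin; lra.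
Qed.

Lemma lt_energy_polar : (forall a b, (0 <= a)%R -> (a < b)%R -> (k b < k a)%R) ->
  0 < L P -> 0 < L Q -> energy A A < energy polar polar.
Proof.
move=> kd P0 Q0; have mpolar := measurable_polar.
have poo : L polar < +oo by rewrite borel_lebesgue_polar.
have pfin x : pot P x \is a fin_num.
  by rewrite ge0_fin_numE ?pot_ge0//; exact: le_lt_trans (pot_le _ mP) Poo.
have : energy Q (s @^-1` P) < energy Q P.
  have -> : energy Q P = \int[L]_x (\1_Q x * fine (pot P x))%:E.
    by apply: eq_integral => x _; rewrite EFinM fineK.
  have H : energy Q (s @^-1` P) = \int[L]_x (\1_Q x * fine (pot P (s x)))%:E.
    by rewrite energy_keep_refl; apply: eq_integral => x _; rewrite EFinM fineK.
  have mfp : measurable_fun [set: Rn] (fine \o pot P).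
    by apply: measurableT_comp => //; exact: measurable_pot.
  rewrite H; apply: (@ge0_integral_lt _ _ _ _ _ _ Q) => //.
  - apply: measurable_funM; first exact: measurable_indic.
    by apply: (measurableT_comp mfp); exact: measurable_refl.
  - by apply: measurable_funM => //; exact: measurable_indic.
  - by move=> x; rewrite mulr_ge0// fine_ge0// pot_ge0.
  - move=> x; rewrite indicE; have [Qx|_] := boolP (x \in Q); last by rewrite !mul0r.
    rewrite !mul1r fine_le//; apply: pot_refl_le => //; first by move=> y [].
    by have [] := set_mem Qx.
  - move=> x Qx; rewrite indicE mem_set// !mul1r -lte_fin !fineK//.
    by apply: pot_refl_lt => //; [move=> y []|have [] := Qx].
  - by rewrite -H; have [b ->] := energy_fin mQ msP Qoo sPoo; rewrite ltry.
have := energy_polar.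
have [a ->] := energy_fin mQ mP Qoo Poo.
have [b ->] := energy_fin mQ msP Qoo sPoo.
have [c ->] := energy_fin mA mA Aoo Aoo.
have [e ->] := energy_fin mpolar mpolar poo poo.
by rewrite -!EFinD => -[]; rewrite !lte_fin; lra.
Qed.

End set_polarization.
End polarization.
End energy.

(** * Riesz' inequality for one set and a radial kernel *)

Section riesz.
Context (R : realType) (n : nat).
Local Open Scope ereal_scope.
Local Notation L := (borel_lebesgue R n).
Local Notation Rn := (borelRn R n).
Implicit Types A B C D : set Rn.

(** It turns [Wnear] into an energy, so that the polarization inequality applies to close pairs. *)
Definition near_kernel (r t : R) : R := (t < r ^+ 2)%R%:R.

Lemma ltr_enorm_dist2 (r : R) (x y : 'rV[R]_n) : (0 < r)%R ->
  (enorm (x - y) < r)%R = (dist2 x y < r ^+ 2)%R.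
Proof.
move=> r0; rewrite /dist2 -sqr_enorm ltr_sqr// nnegrE ?enorm_ge0//.
exact: ltW.
Qed.

Lemma measurable_near_kernel r : measurable_fun setT (near_kernel r).
Proof.
rewrite (_ : near_kernel r = \1_(`]-oo, (r ^+ 2)%R[)).
  by apply: measurable_indic.
apply/funext => t; rewrite indicE /near_kernel; congr (_%:R)%R.
by congr nat_of_bool; apply/idP/idP; rewrite inE/= in_itv.
Qed.

Lemma near_kernel_ge0 r t : (0 <= near_kernel r t)%R. Proof. exact: ler0n. Qed.

Lemma near_kernel_le1 r t : (0 <= t)%R -> (near_kernel r t <= 1)%R.
Proof. by move=> _; rewrite /near_kernel lern1 leq_b1. Qed.

Lemma near_kernel_ni r s t : (0 <= s)%R -> (s < t)%R ->
  (near_kernel r t <= near_kernel r s)%R.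
Proof.
move=> _ st; rewrite /near_kernel ler_nat.
by case: ltP => // tr; rewrite (lt_trans st tr).
Qed.

Lemma Wnear_energy r A C : (0 < r)%R -> measurable A -> measurable C ->
  Wnear r A C = energy (near_kernel r) A C.
Proof.
move=> r0 mA mC; rewrite WnearE// integral_mkcond; apply: eq_integral => x _.
rewrite patchE indicE; case: ifPn => xA; last by rewrite mul0e.
have mBC : measurable (eball x r `&` C : set Rn).
  by apply: measurableI => //; exact: measurable_eball.
rewrite mul1e -[X in L X](setIT (eball x r `&` C)) -(integral_indic _ measurableT mBC).
apply: eq_integral => y _; congr EFin.
rewrite indicI /=; congr (_ * _)%R; rewrite indicE /near_kernel; congr (_%:R)%R.
congr nat_of_bool; apply/idP/idP; rewrite inE /eball/= -ltr_enorm_dist2// enormB//.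
Qed.

Lemma WnearT r A : measurable A ->
  Wnear r A A + Wnear r A (~` A) = L A * L (eball 0%R r).
Proof.
move=> mA; have mAC := measurableC mA.
have -> : L A * L (eball 0%R r) = Wnear r A setT.
  rewrite WnearE// (eq_integral (cst (L (eball 0%R r)))) ?integral_cst 1?muleC//.
  by move=> x _; rewrite setIT borel_lebesgue_eball.
have mN C : measurable C -> measurable (near_pairs r A C).
  by move=> mC; exact: measurable_near_pairs.
apply/esym; rewrite /Wnear [X in _ X = _](_ : _ = near_pairs r A A `|` near_pairs r A (~` A)).
  rewrite measureU//; try exact: mN.
  by apply/seteqP; split => // z [[_ ? _] [_ ? _]].
apply/seteqP; split => z /=.
  by move=> [Az _ zr]; have [Az2|Az2] := pselect (A z.2); [left|right]; split.
by move=> [[]|[]].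
Qed.

(** Close pairs starting in [A] have total measure |A| times the volume of an r-ball, which
    polarization preserves. Those inside [A] can only increase, hence those across the boundary can
    only decrease. This keeps r fixed along a sequence of polarizations. *)
Lemma Wnear_compl_polar r A v m : (0 < r)%R -> v != 0%R -> measurable A ->
  L A < +oo -> Wnear r (polar v m A) (~` polar v m A) <= Wnear r A (~` A).
Proof.
move=> r0 v0 mA Aoo.
have mP := @measurable_polar _ _ v m A mA.
have LP := @borel_lebesgue_polar _ _ v m v0 A mA.
have := le_energy_polar (measurable_near_kernel r) (near_kernel_ge0 r)
  (@near_kernel_le1 r) (@near_kernel_ni r) m v0 mA Aoo.
rewrite -!Wnear_energy//.
have := WnearT r mA; have := WnearT r mP; rewrite LP => <-.
have fin B C : measurable B -> measurable C -> L B < +oo -> exists w : R, Wnear r B C = w%:E.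
  move=> mB mC Boo; exists (fine (Wnear r B C)); rewrite fineK//.
  rewrite ge0_fin_numE ?measure_ge0//; apply: (le_lt_trans (Wnear_le r mB mC)).
  by rewrite -ge0_fin_numE ?mule_ge0// fin_numM ?eball_fin// ge0_fin_numE.
have Poo : L (polar v m A) < +oo by rewrite LP.
have [a ->] := fin _ _ mA mA Aoo.
have [b ->] := fin _ _ mA (measurableC mA) Aoo.
have [c ->] := fin _ _ mP mP Poo.
have [e ->] := fin _ _ mP (measurableC mP) Poo.
by rewrite -!EFinD => -[]; rewrite !lee_fin; lra.
Qed.

Lemma eball_fineE r : exists2 b : R, (0 <= b)%R & L (eball 0%R r) = b%:E.
Proof.
exists (fine (L (eball 0%R r))); first by rewrite fine_ge0.
by rewrite fineK// eball_fin.
Qed.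

(** Averaging: if each point of [D] had at least b / 4 of its r-ball outside [D], integration over
    [D] would give straddling pairs of measure at least d b / 4, more than e b. *)
Lemma exists_dense_point r D (d e b : R) : measurable D -> L D = d%:E ->
  L (eball 0%R r) = b%:E -> (0 < b)%R -> (e < d / 4)%R ->
  Wnear r D (~` D) <= (e * b)%:E ->
  exists2 x, D x & L (eball x r `\` D) < (b / 4)%:E.
Proof.
move=> mD Dd Bb b0 ed W; apply: contrapT => H.
have H1 x : D x -> (b / 4)%:E <= L (eball x r `&` ~` D).
  by move=> Dx; rewrite leNgt; apply/negP => K; apply: H; exists x.
have : (b / 4 * d)%:E <= Wnear r D (~` D).
  rewrite WnearE//; last exact: measurableC.
  rewrite EFinM -Dd -integral_cst//; apply: ge0_le_integral => //.
  - by move=> x _; rewrite lee_fin divr_ge0// ltW.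
  - have mN := measurable_near_pairs r measurableT (measurableC mD).
    have -> : (fun x => L (eball x r `&` ~` D)) = (fun x => L (xsection (near_pairs r setT (~` D)) x)).
      apply/funext => x; congr (L _); apply/seteqP; split => y.
        by move=> [yx Cy]; rewrite /xsection/= inE; split => //=; rewrite enormB.
      by rewrite /xsection/= inE => -[/= _ Cy xy]; split => //; rewrite /eball/= enormB.
    by apply: measurable_funTS; exact: (measurable_fun_xsection L mN).
move=> /le_trans /(_ W); rewrite lee_fin; apply/negP; rewrite -ltNge; nra.
Qed.

Section ball.
Variables (c : 'rV[R]_n) (rho : R).
Local Notation B := (eball c rho : set Rn).
Let mB : measurable B. Proof. exact: measurable_eball. Qed.

(** Reflect a dense point x of A outside B onto a dense point y of B outside A. In the r-ball around
    y, less than b / 4 is lost to each of the two sets, so they overlap in at least b / 2. The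
    center [c] is on the side of y since y is in the ball and x is not. *)
Lemma exists_swap r A (d e b : R) : (0 < r)%R -> measurable A ->
  L (A `\` B) = d%:E -> L (B `\` A) = d%:E ->
  L (eball 0%R r) = b%:E -> (0 < b)%R -> (0 < d)%R -> (2 * e < d / 4)%R ->
  Wnear r A (~` A) <= (e * b)%:E -> Wnear r B (~` B) <= (e * b)%:E ->
  exists v m, [/\ v != 0%R, (0 < side v m c)%R &
    (b / 2)%:E <= L ((B `\` A) `&` refl v m @^-1` (A `\` B))].
Proof.
move=> r0 mA Dd Ed Bb b0 d0 ed WA WB.
have mD : measurable (A `\` B) by exact: measurableD.
have mE : measurable (B `\` A) by exact: measurableD.
have mAC := measurableC mA; have mBC := measurableC mB.
have mDC := measurableC mD; have mEC := measurableC mE.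
have W2 : (e * b)%:E + (e * b)%:E = (2 * e * b)%:E by rewrite -EFinD; congr EFin; ring.
(* A pair straddling the boundary of the difference straddles that of [A] or that of [B]; hence the
   factor 2. *)
have WD : Wnear r (A `\` B) (~` (A `\` B)) <= (2 * e * b)%:E.
  rewrite -W2; apply: (le_trans _ (leeD WA WB)); rewrite (WnearC r mB mBC).
  apply: Wnear_sub => // x y [Ax nBx] nDy _.
  have [Ay|nAy] := pselect (A y); last by left.
  right; split => //; apply: contrapT => nBy; exact: nDy.
have WE : Wnear r (B `\` A) (~` (B `\` A)) <= (2 * e * b)%:E.
  rewrite -W2 addeC; apply: (le_trans _ (leeD WB WA)); rewrite (WnearC r mA mAC).
  apply: Wnear_sub => // x y [Bx nAx] nEy _.
  have [By|nBy] := pselect (B y); last by left.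
  right; split => //; apply: contrapT => nAy; exact: nEy.
have [x [Ax nBx] xD] := exists_dense_point mD Dd Bb b0 ed WD.
have [y [By nAy] yE] := exists_dense_point mE Ed Bb b0 ed WE.
have xy : (dist2 c y < dist2 c x)%R.
  rewrite -[X in (X < _)%R]sqr_enorm -[X in (_ < X)%R]sqr_enorm.
  rewrite ltr_sqr ?nnegrE ?enorm_ge0// enormB (enormB c).
  by rewrite (lt_le_trans By)// leNgt; apply/negP.
pose v := (y - x)%R; pose m := (2^-1 *: (x + y))%R.
have v0 : v != 0%R.
  by rewrite subr_eq0; apply/eqP => yx; move: xy; rewrite yx ltxx.
exists v, m; split => //.
  by have := side_bisector x y c; rewrite -/v -/m; lra.
(* The reflection carries the r-ball around x to the one around y, and the density at x with it. *)
have sD : L (eball y r `\` refl v m @^-1` (A `\` B)) < (b / 4)%:E.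
  have mXD : measurable (eball x r `\` (A `\` B) : set Rn).
    by apply: measurableD => //; exact: measurable_eball.
  rewrite (_ : _ `\` _ = refl v m @^-1` (eball x r `\` (A `\` B))).
    by rewrite (borel_lebesgue_refl m v0 mXD).
  transitivity (refl v m @^-1` (eball x r) `\` refl v m @^-1` (A `\` B)) => //.
  congr (_ `\` _); apply/seteqP; split => z;
    rewrite /eball/= !ltr_enorm_dist2// dist2_reflC// refl_swap//.
have msD := measurable_preimage_refl v m mD.
pose Y : set Rn := eball y r.
have my : measurable Y by exact: measurable_eball.
have : b%:E <= L (Y `\` (B `\` A)) + L (Y `\` refl v m @^-1` (A `\` B))
   + L ((B `\` A) `&` refl v m @^-1` (A `\` B)).
  rewrite -Bb -(borel_lebesgue_eball y).
  have m1 : measurable (Y `\` (B `\` A)) by exact: measurableD.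
  have m2 : measurable (Y `\` refl v m @^-1` (A `\` B)) by exact: measurableD.
  have m3 : measurable ((B `\` A) `&` refl v m @^-1` (A `\` B)) by exact: measurableI.
  apply: (@le_trans _ _ (L ((Y `\` (B `\` A)) `|` (Y `\` refl v m @^-1` (A `\` B))
    `|` ((B `\` A) `&` refl v m @^-1` (A `\` B))))).
    apply: le_borel_lebesgue => //; first by apply: measurableU => //; exact: measurableU.
    move=> z yz; have [Ez|nEz] := pselect ((B `\` A) z); last by left; left.
    have [Dz|nDz] := pselect ((refl v m @^-1` (A `\` B)) z); last by left; right.
    by right.
  apply: (le_trans (measureU2 _ (measurableU _ _ m1 m2) m3)).
  by apply: leeD => //; exact: measureU2.
rewrite -/Y in sD yE *.
move: sD yE; set w1 := L _; set w2 := L _; set w3 := L _ => H1 H2.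
have : 0 <= w1 by exact: measure_ge0.
have : 0 <= w2 by exact: measure_ge0.
have : 0 <= w3 by exact: measure_ge0.
case: w1 H1 => [w1| |]//; case: w2 H2 => [w2| |]//; case: w3 => [w3| |]//; last by move=> *; rewrite leey.
rewrite -?EFinD !lee_fin !lte_fin; lra.
Qed.

Lemma swap_sub_gain A v m : v != 0%R -> (0 < side v m c)%R ->
  (B `\` A) `&` refl v m @^-1` (A `\` B) `<=` gainset v m A.
Proof.
move=> v0 sc p [[Bp nAp] [Asp nBsp]]; split => //.
apply: (side_gt0 v0 sc).
rewrite -[X in (X < _)%R]sqr_enorm -[X in (_ < X)%R]sqr_enorm.
rewrite ltr_sqr ?nnegrE ?enorm_ge0// (lt_le_trans Bp)// leNgt; exact/negP.
Qed.

(** With [c] on the positive side, a point that polarization moves can only get closer to [c], so no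
    mass leaves the ball; the swapped part enters it. *)
Lemma polar_diff_ball A v m : v != 0%R -> (0 < side v m c)%R -> measurable A ->
  L (polar v m A `\` B) + L ((B `\` A) `&` refl v m @^-1` (A `\` B)) <= L (A `\` B).
Proof.
move=> v0 sc mA; set F := _ `&` _.
have mP := measurable_gainset v m mA.
have mSQ : measurable (symset v m A `|` keepset v m A).
  by apply: measurableU; [exact: measurable_symset|exact: measurable_keepset].
have msP := measurable_preimage_refl v m mP.
have msB := measurable_preimage_refl v m mB.
have mF : measurable F.
  apply: measurableI; first exact: measurableD.
  by apply: measurable_preimage_refl; exact: measurableD.
have -> : L (A `\` B) = L ((symset v m A `|` keepset v m A) `\` B) +
    L (refl v m @^-1` gainset v m A `\` B).
  rewrite {1}(set_polarE m v0 A) setDUl; apply: (@measureU _ _ _ L).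
  - exact: measurableD.
  - exact: measurableD.
  - by apply/seteqP; split => // x [[H1 _] [H2 _]]; rewrite -(SQsP0 m v0 A); split.
have -> : L (polar v m A `\` B) = L ((symset v m A `|` keepset v m A) `\` B) +
    L (gainset v m A `\` B).
  rewrite /polar setDUl; apply: (@measureU _ _ _ L).
  - exact: measurableD.
  - exact: measurableD.
  - by apply/seteqP; split => // x [[H1 _] [H2 _]]; rewrite -(SQP0 v m A); split.
rewrite -addeA; apply: leeD => //.
have -> : L (refl v m @^-1` gainset v m A `\` B) = L (gainset v m A `\` refl v m @^-1` B).
  have mG : measurable (gainset v m A `\` refl v m @^-1` B) by exact: measurableD.
  rewrite -(borel_lebesgue_refl m v0 mG); congr (L _).
  transitivity (refl v m @^-1` gainset v m A `\` refl v m @^-1` (refl v m @^-1` B)) => //.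
  congr (_ `\` _).
  by apply/seteqP; split => x; rewrite /= reflK.
rewrite -measureU//; last 2 first.
- exact: measurableD.
- by apply/seteqP; split => // x [[_ nBx] [[]]].
apply: le_borel_lebesgue => //.
- by apply: measurableU => //; exact: measurableD.
- exact: measurableD.
move=> p [[Pp nBp]|Fp]; last first.
  by split; [exact: swap_sub_gain Fp|case: Fp => _ []].
split => // Bsp; apply: nBp; move: Bsp; rewrite /= /eball/=.
apply: lt_trans; rewrite -ltr_sqr ?nnegrE ?enorm_ge0// !sqr_enorm.
by apply: dist2_refl_lt => //; case: Pp.
Qed.

Section kernel.
Variable k : R -> R.
Hypothesis mk : measurable_fun setT k.
Hypothesis k0 : forall t, (0 <= k t)%R.
Hypothesis k1 : forall t, (0 <= t)%R -> (k t <= 1)%R.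
Hypothesis kni : forall s t, (0 <= s)%R -> (s < t)%R -> (k t <= k s)%R.

Lemma setD_measure_eq A : measurable A -> L A = L B -> L (B `\` A) = L (A `\` B).
Proof.
move=> mA AB; have Boo : L B < +oo by exact: borel_lebesgue_eball_lty.
have Aoo : L A < +oo by rewrite AB.
apply: (etrans (@measureD _ _ _ L _ _ mB mA Boo)); apply/esym.
apply: (etrans (@measureD _ _ _ L _ _ mA mB Aoo)).
congr (_ - _); first exact: AB.
by congr (L _); rewrite setIC.
Qed.

(** As long as the part outside the ball exceeds [d], a polarization reduces it by b / 2, where b is
    the volume of an r-ball. Here r depends only on [A], [B] and [d], so the number of steps is
    bounded beforehand. *)
Lemma exists_polarized_near_ball A (d : R) : (0 < d)%R -> measurable A -> L A = L B ->
  exists A', [/\ measurable A', L A' = L B, energy k A A <= energy k A' A' &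
    L (A' `\` B) <= d%:E].
Proof.
move=> d0 mA AB; have Boo : L B < +oo by exact: borel_lebesgue_eball_lty.
have Aoo : L A < +oo by rewrite AB.
(* [exists_swap] asks for 2 e to be less than a quarter of the current difference, which exceeds [d]
   until the procedure stops. *)
pose e := (d / 16)%R; have e0 : (0 < e)%R by rewrite divr_gt0.
have [r1 r10 H1] := Wnear_compl_small mA Aoo e0.
have [r2 r20 H2] := Wnear_compl_small mB Boo e0.
pose r := Num.min r1 r2; have r0 : (0 < r)%R by rewrite lt_min r10.
have {}H1 : Wnear r A (~` A) <= e%:E * L (eball 0%R r).
  by apply: H1; rewrite r0 ge_min lexx.
have {}H2 : Wnear r B (~` B) <= e%:E * L (eball 0%R r).
  by apply: H2; rewrite r0 ge_min lexx orbT.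
have [b _ Bb] := eball_fineE r.
have b0 : (0 < b)%R by rewrite -lte_fin -Bb borel_lebesgue_eball_gt0.
rewrite Bb -EFinM in H1 H2.
have [N HN] : exists N, L (A `\` B) <= (d + N%:R * (b / 2))%:E.
  have : L (A `\` B) <= L A by apply: le_borel_lebesgue; [exact: measurableD|exact: mA|move=> x []].
  have : L A \is a fin_num by rewrite ge0_fin_numE.
  move=> /fineK <- /le_trans H; exists (Num.truncn (fine (L A) / (b / 2))).+1; apply: H.
  rewrite lee_fin; apply: (@le_trans _ _ ((fine (L A) / (b / 2)) * (b / 2))%R).
    by rewrite divfK// gt_eqF// divr_gt0.
  rewrite -[leLHS]add0r; apply: lerD; first exact: ltW.
  by rewrite ler_pM2r ?divr_gt0// ltW// truncnS_gt.
(* The bound on straddling pairs belongs to the invariant: [Wnear_compl_polar] passes it to the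
   polarized set, and r and b need not be chosen again. *)
suff step : forall A1, measurable A1 -> L A1 = L B -> energy k A A <= energy k A1 A1 ->
    Wnear r A1 (~` A1) <= (e * b)%:E -> L (A1 `\` B) <= (d + N%:R * (b / 2))%:E ->
    exists A', [/\ measurable A', L A' = L B, energy k A A <= energy k A' A' &
      L (A' `\` B) <= d%:E] by exact: (step A).
elim: N {HN} => [|N IHN] A1 mA1 A1B A1k H1' HN.
  by exists A1; split => //; move: HN; rewrite mul0r addr0.
have [?|dA] := leP (L (A1 `\` B)) d%:E; first by exists A1.
have mD : measurable (A1 `\` B) by exact: measurableD.
have A1oo : L A1 < +oo by rewrite A1B.
have Dfin : L (A1 `\` B) \is a fin_num.
  rewrite ge0_fin_numE//; apply: le_lt_trans A1oo.
  by apply: le_borel_lebesgue => // x [].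
have DE := fineK Dfin; rewrite -DE lte_fin in dA.
have [||v [m [v0 sc Hs]]] := @exists_swap r A1 (fine (L (A1 `\` B))) e b r0 mA1 (esym DE)
  _ Bb b0 (lt_trans d0 dA) _ H1' H2.
- by rewrite setD_measure_eq.
- by rewrite /e; lra.
have := polar_diff_ball v0 sc mA1 => Hp.
apply: (IHN (polar v m A1)).
- exact: measurable_polar.
- by rewrite borel_lebesgue_polar.
- by apply: (le_trans A1k); exact: le_energy_polar.
- by apply: le_trans H1'; exact: Wnear_compl_polar.
- move: (le_trans Hp HN) Hs.
  have : 0 <= L (polar v m A1 `\` B) by [].
  have : 0 <= L ((B `\` A1) `&` refl v m @^-1` (A1 `\` B)) by [].
  case: (L (polar v m A1 `\` B)) => [w1| |]//; case: (L _) => [w2| |]//.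
  by rewrite -?EFinD !lee_fin -natr1; lra.
Qed.

(** Cut the part outside the ball off each argument in turn. As the kernel is at most 1, each cut
    costs at most the product of the measures, and what remains is contained in [B]. *)
Lemma energy_near_ball A : measurable A -> L A = L B ->
  energy k A A <= energy k B B + (L (A `\` B) * L B + L (A `\` B) * L B).
Proof.
move=> mA AB.
have mAB : measurable (A `&` B) by exact: measurableI.
have mBA : measurable (B `\` A) by exact: measurableD.
have mD : measurable (A `\` B) by exact: measurableD.
have AE : A = (A `&` B) `|` (A `\` B) by rewrite setUIDK.
have A0 : (A `&` B) `&` (A `\` B) = set0.
  by apply/seteqP; split => // x [[_ ?] [_ ?]].
have BE : B = (A `&` B) `|` (B `\` A) by rewrite setIC setUIDK.
have B0 : (A `&` B) `&` (B `\` A) = set0.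
  by apply/seteqP; split => // x [[? _] [_ ?]].
have H1 : energy k A A = energy k (A `&` B) A + energy k (A `\` B) A.
  by rewrite {1}AE (energyUl mk k0 mAB mD mA A0).
have H2 : energy k (A `&` B) A = energy k (A `&` B) (A `&` B) + energy k (A `&` B) (A `\` B).
  by rewrite {2}AE (energyUr mk k0 mAB mD mAB A0).
have H3 : energy k (A `&` B) (A `&` B) <= energy k B B.
  rewrite [in leRHS]BE (energyUl mk k0 mAB mBA (measurableU _ _ mAB mBA) B0).
  rewrite (energyUr mk k0 mAB mBA mAB B0) -addeA leeDl//.
  by rewrite adde_ge0// energy_ge0.
rewrite H1 H2 -addeA; apply: leeD => //; apply: leeD.
  apply: (le_trans (energy_le mk k0 k1 mAB mD)); rewrite muleC lee_wpmul2l//.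
  by apply: le_borel_lebesgue => // x [].
by rewrite -AB; exact: energy_le.
Qed.

Lemma riesz_ball A : measurable A -> L A = L B -> energy k A A <= energy k B B.
Proof.
move=> mA AB; have Boo : L B < +oo by exact: borel_lebesgue_eball_lty.
have [b Bb] : exists b, L B = b%:E.
  by exists (fine (L B)); rewrite fineK// ge0_fin_numE.
have b0 : (0 <= b)%R by rewrite -lee_fin -Bb.
have Aoo : L A < +oo by rewrite AB.
have [a aE] := energy_fin mk k0 k1 mA mA Aoo Aoo.
have [e eE] := energy_fin mk k0 k1 mB mB Boo Boo.
rewrite aE eE lee_fin; apply/ler_addgt0Pr => d d0.
(* The error in [energy_near_ball] is then at most [d]; b + 1 replaces b to cover a ball of volume
   0. *)
have d10 : (0 < d / (2 * (b + 1)))%R by rewrite divr_gt0// mulr_gt0// ltr_wpDl.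
have [A' [mA' A'B AA' A'd]] := exists_polarized_near_ball d10 mA AB.
have := le_trans AA' (energy_near_ball mA' A'B); rewrite aE eE Bb.
have : 0 <= L (A' `\` B) by [].
case: (L (A' `\` B)) A'd => [w| |]//; rewrite -!EFinM -!EFinD !lee_fin => wd w0.
have wb : (w * (2 * (b + 1)) <= d)%R.
  by rewrite -ler_pdivlMr// mulr_gt0// ltr_wpDl.
nra.
Qed.

End kernel.
End ball.
End riesz.

(** * The Euclidean norm and the topology of row vectors *)

Section enorm_topology.
Context (R : realType) (n : nat).
Implicit Types x : 'rV[R]_n.

Lemma ler_norm_enorm x : `|x| <= enorm x.
Proof.
rewrite [leLHS]/Num.norm/= mx_normrE; apply/bigmax_leP; split; first exact: enorm_ge0.
move=> [i j] _ /=; rewrite (ord1 i) ler_norml ler_coord_enorm andbT.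
by have := ler_coord_enorm (- x) j; rewrite mxE enormN lerNl.
Qed.

Lemma ler_coord_norm x i : `|x ord0 i| <= `|x|.
Proof.
by rewrite [leRHS]/Num.norm/= mx_normrE; apply/bigmax_geP; right; exists (ord0, i).
Qed.

Lemma ler_enorm_norm x : enorm x <= Num.sqrt n%:R * `|x|.
Proof.
rewrite -ler_sqr ?nnegrE ?enorm_ge0 ?mulr_ge0// exprMn sqr_enorm sqr_sqrtr//.
apply: (@le_trans _ _ (\sum_(i < n) `|x| ^+ 2)).
  apply: ler_sum => i _; rewrite -expr2 -real_normK ?num_real//.
  by rewrite ler_sqr ?nnegrE// ler_coord_norm.
by rewrite sumr_const card_ord mulr_natl.
Qed.

(** The topology is that of the maximum norm, which bounds the Euclidean norm up to the factor sqrt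
    n. Adding 1 to |M| and to sqrt n keeps the modulus of continuity positive. *)
Lemma enorm_lipschitz_continuous (f : 'rV[R]_n -> R) (M : R) :
  (forall x y, `|f x - f y| <= M * enorm (x - y)) -> continuous f.
Proof.
move=> fM x; rewrite /continuous_at; apply/(@cvgrPdist_lt _ _ _ (nbhs x) (nbhs_filter x)) => e e0.
have M0 : 0 < `|M| + 1 by rewrite ltr_wpDl.
have n0 : 0 < Num.sqrt n%:R + 1 :> R by rewrite ltr_wpDl ?sqrtr_ge0.
pose d := e / ((`|M| + 1) * (Num.sqrt n%:R + 1)).
have d0 : 0 < d by rewrite divr_gt0// mulr_gt0.
have nb : \forall y \near x, `|x - y| < d.
  by apply/nbhs_normP; exists d.
apply: filterS nb => y xyd; apply: (le_lt_trans (fM x y)).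
apply: (@le_lt_trans _ _ ((`|M| + 1) * ((Num.sqrt n%:R + 1) * `|x - y|))).
  apply: (@le_trans _ _ ((`|M| + 1) * enorm (x - y))).
    by rewrite ler_wpM2r ?enorm_ge0// (le_trans (ler_norm M))// lerDl.
  rewrite ler_pM2l//; apply: (le_trans (ler_enorm_norm _)).
  by rewrite ler_wpM2r// lerDl.
by rewrite mulrA mulrC -ltr_pdivlMr ?mulr_gt0.
Qed.

Lemma closed_eball_compact (r : R) : compact [set x : 'rV[R]_n | enorm x <= r].
Proof.
apply: bounded_closed_compact.
  exists r; split; first exact: num_real.
  move=> M rM x /= xr; exact: le_trans (ler_norm_enorm x) (le_trans xr (ltW rM)).
have -> : [set x : 'rV[R]_n | enorm x <= r] = (@enorm R n) @^-1` [set t | t <= r] by [].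
suff /continuous_closedP ce : continuous (@enorm R n) by apply: ce; exact: closed_le.
apply: (@enorm_lipschitz_continuous _ 1) => a b; rewrite mul1r ler_norml.
have := ler_enormD (a - b) b; have := ler_enormD (b - a) a.
by rewrite !subrK (enormB b a); lra.
Qed.

End enorm_topology.

(** * Equality in Riesz' inequality *)

Section riesz_equality.
Context (R : realType).
Local Open Scope ereal_scope.

Section potential.
Context (n : nat).
Local Notation L := (borel_lebesgue R n).
Local Notation Rn := (borelRn R n).
Variable k : R -> R.
Hypothesis mk : measurable_fun setT k.
Hypothesis k0 : forall t, (0 < k t)%R.
Hypothesis k1 : forall t, (0 <= t)%R -> (k t <= 1)%R.
Hypothesis kd : forall s t, (0 <= s)%R -> (s < t)%R -> (k t < k s)%R.
Variable M : R.
Hypothesis M0 : (0 <= M)%R.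
Hypothesis klip : forall x x' y : 'rV[R]_n,
  (`|k (dist2 x y) - k (dist2 x' y)| <= M * enorm (x - x'))%R.
Hypothesis kdecay : forall e : R, (0 < e)%R -> exists T, forall t, (T <= t)%R -> (k t <= e)%R.

Let k0' t : (0 <= k t)%R. Proof. exact: ltW. Qed.
Let kni s t : (0 <= s)%R -> (s < t)%R -> (k t <= k s)%R.
Proof. by move=> s0 st; exact/ltW/kd. Qed.

Variable A : set Rn.
Hypotheses (mA : measurable A) (Aoo : L A < +oo).

Lemma pot_fin (C : set Rn) x : measurable C -> L C < +oo -> pot k C x \is a fin_num.
Proof.
move=> mC Coo; rewrite ge0_fin_numE ?pot_ge0//.
exact: le_lt_trans (pot_le mk k0' k1 x mC) Coo.
Qed.

Lemma measurable_pot_integrand (C : set Rn) x : measurable C ->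
  measurable_fun [set: Rn] (fun y => (k (dist2 x y) * \1_C y)%:E).
Proof.
move=> mC; apply/measurable_EFinP; apply: measurable_funM; last exact: measurable_indic.
by apply: measurable_kernel.
Qed.

Lemma pot_lipschitz x x' : pot k A x <= pot k A x' + (M * enorm (x - x')%R)%:E * L A.
Proof.
rewrite -[X in _ + _ * X](_ : \int[L]_y (\1_A y)%:E = _); last first.
  by rewrite integral_indic// setIT.
rewrite -ge0_integralZl//; last 2 first.
- by apply/measurable_EFinP; exact: measurable_indic.
- by rewrite lee_fin mulr_ge0// enorm_ge0.
rewrite -ge0_integralD//; last 4 first.
- by move=> y _; rewrite lee_fin mulr_ge0.
- exact: measurable_pot_integrand.
- by move=> y _; rewrite mule_ge0// lee_fin// mulr_ge0// enorm_ge0.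
- by apply/measurable_EFinP; apply: measurable_funM => //; exact: measurable_indic.
apply: ge0_le_integral => //.
- by move=> y _; rewrite lee_fin mulr_ge0.
- exact: measurable_pot_integrand.
- apply: emeasurable_funD; first exact: measurable_pot_integrand.
  by apply/measurable_EFinP; apply: measurable_funM => //; exact: measurable_indic.
- move=> y _; rewrite -EFinM -EFinD lee_fin -mulrDl ler_wpM2r//.
  by rewrite -lerBlDl (le_trans (ler_norm _))// klip.
Qed.

Lemma continuous_pot : continuous (fun x : 'rV[R]_n => fine (pot k A x)).
Proof.
apply: (@enorm_lipschitz_continuous _ _ _ (M * fine (L A))) => x y.
have LA : (fine (L A))%:E = L A by rewrite fineK// ge0_fin_numE.
have := pot_lipschitz x y; have := pot_lipschitz y x.
rewrite -(fineK (pot_fin x mA Aoo)) -(fineK (pot_fin y mA Aoo)) -LA.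
rewrite -!EFinM -!EFinD !lee_fin /= ler_norml (enormB y x) => H1 H2.
by apply/andP; split; lra.
Qed.

Lemma pot_gt0 x : 0 < L A -> 0 < pot k A x.
Proof.
move=> A0; have <- : \int[L]_y (0 : R)%:E = 0 by rewrite integral0.
apply: (@ge0_integral_lt _ _ _ _ _ _ A) => //.
- by apply: measurable_funM; [exact: measurable_kernel|exact: measurable_indic].
- by move=> y; rewrite mulr_ge0.
- by move=> y Ay; rewrite indicE mem_set// mulr1.
- by rewrite integral0 ltry.
Qed.

(** The potential is continuous, positive at 0 and, far away, smaller than its value at 0. Its
    maximum on a large closed ball is therefore a global one. *)
Lemma exists_pot_max : 0 < L A -> exists c, forall x, pot k A x <= pot k A c.
Proof.
move=> A0.
pose u x := fine (pot k A x).
have uE x : pot k A x = (u x)%:E by rewrite /u fineK// pot_fin.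
have u00 : (0 < u 0)%R by rewrite -lte_fin -uE pot_gt0.
(* Far away the potential has two contributions of at most e: decay of the kernel for the bounded
   part of [A], and measure for the tail. Then 2 e is below u 0. *)
pose e := (u 0 / 3)%R; have e0 : (0 < e)%R by rewrite divr_gt0.
have LA : (fine (L A))%:E = L A by rewrite fineK// ge0_fin_numE.
have LA0 : (0 <= fine (L A))%R by rewrite fine_ge0.
have [T HT] := kdecay (divr_gt0 e0 (ltr_wpDl LA0 ltr01)).
pose F N : set Rn := A `\` eball 0%R N%:R.
have mB N : measurable (eball 0%R N%:R : set Rn) by exact: measurable_eball.
have mF N : measurable (F N) by exact: measurableD.
have F0 : \bigcap_N F N = set0.
  apply/seteqP; split => // x H; have [_] := H (Num.truncn (enorm x)).+1 I; apply.
  by rewrite /eball/= subr0 truncnS_gt.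
have F0oo : L (F 0%N) < +oo.
  by apply: le_lt_trans Aoo; apply: le_borel_lebesgue => // x [].
have ndF : nonincreasing_seq F.
  move=> p q pq; apply/subsetPset => x [Ax nBx]; split => //.
  by apply: contra_not nBx; apply: le_eball; rewrite ler_nat.
have [N FN] := measure_small mF F0oo ndF F0 e0.
(* Beyond this norm, points of the ball of radius N are at distance at least |T| + 1, so the squared
   distance is at least T. *)
pose S := (N%:R + `|T| + 1)%R.
have S0 : (0 <= S)%R by rewrite !addr_ge0.
have far x : (S <= enorm x)%R -> (u x <= 2 * e)%R.
  move=> xS; rewrite -lee_fin -uE.
  have mAB : measurable (A `&` eball 0%R N%:R) by exact: measurableI.
  have -> : pot k A x = pot k (A `&` eball 0%R N%:R) x + pot k (F N) x.
    rewrite -ge0_integralD//; last 4 first.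
    - by move=> y _; rewrite lee_fin mulr_ge0.
    - exact: measurable_pot_integrand.
    - by move=> y _; rewrite lee_fin mulr_ge0.
    - exact: measurable_pot_integrand.
    apply: eq_integral => y _; rewrite -EFinD -mulrDr; congr (_ * _)%:E.
    rewrite !indicE /F in_setD in_setI.
    by case: (y \in A); case: (y \in eball _ _); rewrite ?addr0 ?add0r.
  rewrite mulr2n mulrDl mul1r EFinD; apply: leeD; last first.
    exact: (le_trans (pot_le mk k0' k1 x (mF N))).
  apply: (@le_trans _ _ (\int[L]_y ((e / (fine (L A) + 1))%:E * (\1_A y)%:E))).
    apply: ge0_le_integral => //.
    - by move=> y _; rewrite lee_fin mulr_ge0.
    - exact: measurable_pot_integrand.
    - by apply/measurable_EFinP; apply: measurable_funM => //; exact: measurable_indic.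
    - move=> y _; rewrite -EFinM lee_fin indicI /=.
      have ee : (0 <= e / (fine (L A) + 1))%R by rewrite divr_ge0 ?addr_ge0// ltW.
      rewrite [\1_(eball _ _) y]indicE; case: (boolP (y \in eball _ _)) => [yN|_]; last first.
        by rewrite mulr0 mulr0 mulr_ge0.
      rewrite mulr1 ler_wpM2r// HT// /dist2 -sqr_enorm.
      have : (`|T| + 1 <= enorm (x - y))%R.
        have := ler_enormD (x - y) y; rewrite subrK.
        move: yN xS; rewrite inE /eball/= subr0 /S; lra.
      have := ler_norm T; have := normr_ge0 T; nra.
  rewrite ge0_integralZl//; last 2 first.
  - by apply/measurable_EFinP; exact: measurable_indic.
  - by rewrite lee_fin divr_ge0 ?addr_ge0// ltW.
  rewrite [X in _ * X](_ : _ = (fine (L A))%:E); last by rewrite integral_indic// setIT LA.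
  rewrite -EFinM lee_fin mulrAC.
  by rewrite ler_pdivrMr ?ltr_wpDl// ler_pM2l// lerDl.
have K0 : [set x : 'rV[R]_n | (enorm x <= S)%R] !=set0.
  by exists 0%R; rewrite /= enorm0.
have [c cS cmax] := EVT_max_rV K0 (@closed_eball_compact R n S)
  (continuous_subspaceT continuous_pot).
exists c => x; rewrite !uE lee_fin.
have u0c : (u 0 <= u c)%R by apply: cmax; rewrite inE/= enorm0.
have [xS|/ltW/far xS] := leP (enorm x) S; first by apply: cmax; rewrite inE.
by apply: (le_trans xS); apply: le_trans u0c; rewrite /e; lra.
Qed.

Lemma pot_symset_refl v m x : v != 0%R ->
  pot k (symset v m A) (refl v m x) = pot k (symset v m A) x.
Proof.
move=> v0; have mS := measurable_symset v m mA.
by rewrite -[in RHS](symset_refl m v0) (pot_refl mk k0' m v0 _ mS).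
Qed.

Lemma potU (C D : set Rn) x : measurable C -> measurable D -> C `&` D = set0 ->
  pot k (C `|` D) x = pot k C x + pot k D x.
Proof.
move=> mC mD CD0; rewrite -ge0_integralD//; last 4 first.
- by move=> y _; rewrite lee_fin mulr_ge0.
- exact: measurable_pot_integrand.
- by move=> y _; rewrite lee_fin mulr_ge0.
- exact: measurable_pot_integrand.
apply: eq_integral => y _; rewrite -EFinD -mulrDr; congr (_ * _)%:E.
rewrite !indicE in_setU; have [yC|yC] := boolP (y \in C); last by rewrite add0r.
suff -> : (y \in D) = false by rewrite addr0.
apply/negP => yD; have : (C `&` D) y by split; exact/set_mem.
by rewrite CD0.
Qed.

(** Up to a null set [A] is its symmetric part and the reflection of [gainset]. The symmetric part
    contributes equally at [c] and at its mirror image; the other part lies on the side of the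
    mirror image, where its potential is strictly larger. *)
Lemma pot_keep_null v m c : v != 0%R -> (0 < side v m c)%R ->
  L (keepset v m A) = 0 -> 0 < L (gainset v m A) ->
  pot k A c < pot k A (refl v m c).
Proof.
move=> v0 sc Q0 P0.
have mP := measurable_gainset v m mA; have mQ := measurable_keepset v m mA.
have mS := measurable_symset v m mA; have msP := measurable_preimage_refl v m mP.
have pQ x : pot k (keepset v m A) x = 0.
  by apply/eqP; rewrite eq_le pot_ge0// andbT -Q0; exact: pot_le.
have AE x : pot k A x = pot k (symset v m A) x + pot k (gainset v m A) (refl v m x).
  transitivity (pot k ((symset v m A `|` keepset v m A) `|` refl v m @^-1` gainset v m A) x).
    by congr (pot k _ x); exact: set_polarE.
  rewrite (potU x (measurableU _ _ mS mQ) msP (SQsP0 m v0 A)).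
  by rewrite (potU x mS mQ (SQ0 v m A)) pQ adde0 (pot_refl mk k0' m v0 _ mP).
rewrite !AE pot_symset_refl// reflK//.
have Soo : L (symset v m A) < +oo.
  by apply: le_lt_trans Aoo; apply: le_borel_lebesgue => // x [].
rewrite lteD2lE ?pot_fin//.
apply: (pot_refl_lt mk k0' k1 kni v0 kd mP) => //; last by move=> y [].
rewrite -(borel_lebesgue_refl m v0 mP).
by apply: le_lt_trans Aoo; apply: le_borel_lebesgue => // x [_ _]; rewrite /= reflK.
Qed.

(** One swap at a small scale makes [gainset] non-null. A strict gain of energy also needs [keepset]
    to be non-null, which is what separates the two contradictions. *)
Lemma riesz_equality_ball c rho : L A = L (eball c rho) -> 0 < L A ->
  energy k A A = energy k (eball c rho) (eball c rho) ->
  (forall x, pot k A x <= pot k A c) ->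
  L (A `\` eball c rho) = 0.
Proof.
move=> AB A0 EE cmax; apply/eqP; apply: contrapT => /negP D0.
have mB : measurable (eball c rho : set Rn) by exact: measurable_eball.
have mD : measurable (A `\` eball c rho) by exact: measurableD.
have {}D0 : 0 < L (A `\` eball c rho) by rewrite lt_neqAle eq_sym D0 measure_ge0.
have Dfin : L (A `\` eball c rho) \is a fin_num.
  rewrite ge0_fin_numE//; apply: le_lt_trans Aoo.
  by apply: le_borel_lebesgue => // x [].
have DE := fineK Dfin; set d := fine _ in DE.
have d0 : (0 < d)%R by rewrite -lte_fin DE.
pose e := (d / 16)%R; have e0 : (0 < e)%R by rewrite divr_gt0.
have [r1 r10 H1] := Wnear_compl_small mA Aoo e0.
have [r2 r20 H2] := Wnear_compl_small mB (borel_lebesgue_eball_lty _ _) e0.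
pose r := Num.min r1 r2; have r0 : (0 < r)%R by rewrite lt_min r10.
have {}H1 : Wnear r A (~` A) <= e%:E * L (eball 0%R r).
  by apply: H1; rewrite r0 ge_min lexx.
have {}H2 : Wnear r (eball c rho) (~` eball c rho) <= e%:E * L (eball 0%R r).
  by apply: H2; rewrite r0 ge_min lexx orbT.
have [b _ Bb] := eball_fineE n r.
have b0 : (0 < b)%R by rewrite -lte_fin -Bb borel_lebesgue_eball_gt0.
rewrite Bb -EFinM in H1 H2.
have [||v [m [v0 sc Hs]]] := @exists_swap R n c rho r A d e b r0 mA (esym DE)
  _ Bb b0 d0 _ H1 H2.
- by rewrite setD_measure_eq// DE.
- by rewrite /e; lra.
have mP := measurable_gainset v m mA; have mQ := measurable_keepset v m mA.
have P0 : 0 < L (gainset v m A).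
  apply: (@lt_le_trans _ _ (b / 2)%:E); first by rewrite lte_fin divr_gt0.
  apply: (le_trans Hs); refine (le_borel_lebesgue _ mP _); last exact: swap_sub_gain.
  apply: measurableI; first exact: measurableD.
  exact: measurable_preimage_refl.
have Q0 : L (keepset v m A) = 0.
  apply/eqP; apply: contrapT => /negP Q0.
  have {}Q0 : 0 < L (keepset v m A) by rewrite lt_neqAle eq_sym Q0 measure_ge0.
  have := lt_energy_polar mk k0' k1 kni v0 mA Aoo kd P0 Q0.
  rewrite EE ltNge; apply/negP; rewrite negbK.
  apply: (riesz_ball mk k0' k1 kni); first exact: measurable_polar.
  by rewrite borel_lebesgue_polar.
have := pot_keep_null v0 sc Q0 P0.
by rewrite ltNge cmax.
Qed.

End potential.

End riesz_equality.

(** * Lebesgue measurable versus Borel *)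

Section completion.
Context (R : realType) (n : nat).
Local Open Scope ereal_scope.
Local Notation mu := (borel_lebesgue R n).
Local Notation nu := (lebesgue R n).
Local Notation Rn := (borelRn R n).
Local Notation Ln := (lebesgueRn R n).

Lemma measurable_lebesgueRn (A : set Rn) : measurable A -> measurable (A : set Ln).
Proof. exact: caratheodory_measurable_mu_ext. Qed.

Lemma lebesgue_borel (A : set Rn) : measurable A -> nu A = mu A.
Proof. exact: measurable_mu_extE. Qed.

Lemma measurable_fun_lebesgueRn d (T : measurableType d) (f : Rn -> T) :
  measurable_fun [set: Rn] f -> measurable_fun [set: Ln] (f : Ln -> T).
Proof.
by move=> mf _ Y mY; rewrite setTI; apply: measurable_lebesgueRn;
  rewrite -[X in measurable X]setTI; exact: mf.
Qed.

Lemma le_lebesgue (A B : set Ln) : A `<=` B -> nu A <= nu B.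
Proof. by move=> AB; exact: le_mu_ext. Qed.

(** The outer measure is an infimum over countable Borel covers; intersect the unions of covers with
    errors 1 / (k + 1). *)
Lemma borel_hull (A : set Ln) : nu A < +oo ->
  exists G : set Rn, [/\ measurable G, A `<=` G & mu G = nu A].
Proof.
move=> Aoo.
have Afin : ereal_inf [set \sum_(k <oo) mu (F k) | F in measurable_cover (A : set Rn)] \is a fin_num.
  by have : nu A \is a fin_num by rewrite ge0_fin_numE.
have H (k : nat) : exists G : set Rn, [/\ measurable G, A `<=` G & mu G <= nu A + (k.+1%:R^-1)%:E].
  have k0 : (0 < k.+1%:R^-1 :> R)%R by rewrite invr_gt0.
  have [x [F [mF AF] Fx] xA] := lb_ereal_inf_adherent k0 Afin.
  exists (\bigcup_k F k); split => //; first exact: bigcup_measurable.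
  apply: (le_trans _ (ltW xA)); rewrite -Fx.
  by apply: measure_sigma_subadditive => //; exact: bigcup_measurable.
have {H} [G HG] := choice H.
have mG : measurable (\bigcap_k G k).
  by apply: bigcapT_measurable => k; have [] := HG k.
exists (\bigcap_k G k); split => //.
  by move=> x Ax k _; have [_ + _] := HG k; apply.
apply/eqP; rewrite eq_le; apply/andP; split; last first.
  rewrite -lebesgue_borel//; apply: le_lebesgue => x Ax k _.
  by have [_ + _] := HG k; apply.
have nuA : nu A \is a fin_num by [].
rewrite -(fineK nuA); apply/lee_addgt0Pr => e e0.
have [k _ /(_ k (leqnn k))] := near_infty_natSinv_lt (PosNum e0).
move=> /= ke; have [mGk _ Gk] := HG k.
apply: (@le_trans _ _ (mu (G k))).
  by apply: le_borel_lebesgue => // x; apply.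
apply: (le_trans Gk); rewrite -{1}(fineK nuA) -!EFinD lee_fin lerD2l.
exact: ltW.
Qed.

(** Take hulls of the bounded pieces of [A] and unite them. The excess over [A] is null but only
    Lebesgue measurable, so it is enclosed in turn in a Borel null set [N]. *)
Lemma borel_approx (A : set Ln) : measurable A ->
  exists G N : set Rn, [/\ measurable G, measurable N, mu N = 0,
    A `<=` G & G `\` A `<=` N].
Proof.
move=> mA; pose B k : set Rn := eball 0%R k%:R.
have mB k : measurable (B k) by exact: measurable_eball.
have H k : exists GN : set Rn * set Rn, [/\ measurable GN.1, measurable GN.2, mu GN.2 = 0,
    A `&` B k `<=` GN.1 & GN.1 `\` (A `&` B k) `<=` GN.2].
  have mAB : measurable (A `&` B k : set Ln).
    by apply: measurableI => //; exact: measurable_lebesgueRn.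
  have ABoo : nu (A `&` B k) < +oo.
    apply: le_lt_trans (borel_lebesgue_eball_lty (0%R : 'rV[R]_n) k%:R).
    by rewrite -(lebesgue_borel (mB k)); apply: le_lebesgue => x [].
  have [G [mG AG GA]] := borel_hull ABoo.
  have D0 : nu (G `\` (A `&` B k)) = 0.
    have GAn : nu (G : set Ln) = nu (A `&` B k) by rewrite -GA; exact: lebesgue_borel.
    have Goo : nu (G : set Ln) < +oo by rewrite GAn.
    apply: (etrans (@measureD _ _ _ nu _ _ (measurable_lebesgueRn mG) mAB Goo)).
    rewrite setIidr//; have subE (a b : \bar R) : a = b -> b \is a fin_num -> a - b = 0.
      by move=> ->; exact: subee.
    by apply: (subE _ _ GAn); rewrite ge0_fin_numE.
  have Doo : nu (G `\` (A `&` B k)) < +oo by rewrite D0 ltry.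
  have [N [mN DN N0]] := borel_hull Doo.
  by exists (G, N); split => //=; rewrite N0.
have {H} [GN HGN] := choice H.
exists (\bigcup_k (GN k).1), (\bigcup_k (GN k).2); split.
- by apply: bigcup_measurable => k _; have [] := HGN k.
- by apply: bigcup_measurable => k _; have [] := HGN k.
- apply/eqP; rewrite eq_le measure_ge0 andbT.
  apply: (le_trans (@measure_sigma_subadditive _ _ _ mu _ (fun k => (GN k).2) _ _ _)) => //.
  + by move=> k; have [] := HGN k.
  + by apply: bigcup_measurable => k _; have [] := HGN k.
  + by rewrite eseries0// => k _ _; have [] := HGN k.
- move=> x Ax; exists (Num.truncn (enorm x)).+1 => //.
  have [_ _ _ + _] := HGN (Num.truncn (enorm x)).+1; apply; split => //.
  by rewrite /B /eball/= subr0 truncnS_gt.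
- move=> x [[k _ Gx] nAx]; exists k => //.
  by have [_ _ _ _] := HGN k; apply; split => // -[].
Qed.

(** Replace each superlevel set with rational threshold by a Borel hull. Countably many exceptional
    null sets are united, and outside of them the hulls are exactly the superlevel sets of [f]. *)
Lemma borel_representative (f : Ln -> R) : measurable_fun setT f ->
  exists (g : Rn -> R) (N : set Rn), [/\ measurable_fun setT g, measurable N, mu N = 0 &
    forall x, ~ N x -> f x = g x].
Proof.
move=> mf.
have H (q : rat) : exists GN : set Rn * set Rn, [/\ measurable GN.1, measurable GN.2,
    mu GN.2 = 0, [set x | (ratr q < f x)%R] `<=` GN.1 &
    GN.1 `\` [set x | (ratr q < f x)%R] `<=` GN.2].
  have [|G [N [? ? ? ? ?]]] := @borel_approx [set x | (ratr q < f x)%R].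
    have := mf measurableT `](ratr q), +oo[%classic (measurable_itv _).
    by rewrite setTI; congr measurable; apply/seteqP; split => x /=; rewrite in_itv/= andbT.
  by exists (G, N).
have {H} [GN HGN] := choice H.
pose N : set Rn := \bigcup_q (GN q).2.
have mN : measurable N.
  by apply: bigcupT_measurable_rat => q; have [] := HGN q.
have N0 : mu N = 0.
  have /card_esym/ppcard_eqP[r] := card_rat.
  apply/eqP; rewrite eq_le measure_ge0 andbT.
  have NE : N = \bigcup_k (GN (r k)).2.
    apply/seteqP; split => x [q _ Hx]; last by exists (r q).
    by have /(_ q I) [k _ rk] := @surj _ _ _ _ r; exists k => //; rewrite rk.
  rewrite NE; apply: (le_trans (@measure_sigma_subadditive _ _ _ mu _ (fun k => (GN (r k)).2) _ _ _)) => //.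
  + by move=> k; have [] := HGN (r k).
  + by apply: bigcup_measurable => k _; have [] := HGN (r k).
  + by rewrite eseries0// => k _ _; have [] := HGN (r k).
(* The constant value on [N] makes each superlevel set of [g] Borel: hulls off [N], and all or
   nothing of [N]. *)
pose g (x : Rn) : R := if x \in N then 0%R else f x.
exists g, N; split => //; last by move=> x nNx; rewrite /g memNset.
have gE a : g @^-1` `]a, +oo[ =
    (\bigcup_(q in [set q | (a < ratr q)%R]) (GN q).1 `\` N) `|` (N `&` [set x | (a < 0)%R]).
  apply/seteqP; split => x.
    rewrite /= in_itv/= andbT /g; case: ifPn => [xN a0|]; first by right; split => //; exact/set_mem.
    rewrite notin_setE => nNx afx; left; split => //.
    have [q] := rat_in_itvoo afx; rewrite in_itv/= => /andP[aq qf].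
    by exists q => //; have [_ _ _ + _] := HGN q; apply.
  rewrite /= in_itv/= andbT /g => -[[[q /= aq Gx] nNx]|[Nx a0]]; last by rewrite mem_set.
  rewrite memNset// (lt_trans aq)//.
  apply: contrapT => nqf; apply: nNx; exists q => //.
  by have [_ _ _ _] := HGN q; apply.
apply: (measurability _ (RGenOInfty.measurableE R)) => _ [_ [a ->] <-].
rewrite setTI gE; apply: measurableU.
  apply: measurableD => //; rewrite bigcup_mkcond; apply: bigcupT_measurable_rat => q.
  by case: ifPn => // _; have [] := HGN q.
apply: measurableI => //; have [a0|a0] := boolP (a < 0)%R.
  by rewrite (_ : mkset _ = setT)//; apply/seteqP; split => x.
by rewrite (_ : mkset _ = set0)//; apply/seteqP; split => x//=; move/negP: a0.
Qed.

(** The identity is measurable from the Lebesgue to the Borel sigma-algebra and pushes the completed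
    measure forward to the Borel one. *)
Lemma integral_lebesgue (f : Rn -> \bar R) : measurable_fun [set: Rn] f ->
  \int[nu]_x f x = \int[mu]_x f x.
Proof.
have ge0 (h : Rn -> \bar R) : measurable_fun [set: Rn] h -> (forall x, 0 <= h x) ->
    \int[nu]_x h x = \int[mu]_x h x.
  move=> mh h0.
  have mid : measurable_fun [set: Ln] (id : Ln -> Rn).
    by apply: measurable_fun_lebesgueRn; exact: measurable_id.
  have h0' y : y \in [set: Rn] -> 0 <= h y by [].
  have := @ge0_integral_pushforward _ _ Ln Rn R id mid nu setT h measurableT mh h0'.
  rewrite preimage_setT => <-.
  by apply: eq_measure_integral => A mA _; exact: lebesgue_borel.
move=> mf; rewrite integralE [RHS]integralE.
by rewrite !ge0//; [exact: measurable_funeneg|exact: measurable_funepos].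
Qed.

Lemma lebesgue_null (N : set Rn) : measurable N -> mu N = 0 ->
  forall (P : Ln -> Prop), (forall x, ~ N x -> P x) -> {ae nu, forall x, P x}.
Proof.
move=> mN N0 P H; exists N; split.
- exact: measurable_lebesgueRn.
- by rewrite [LHS]lebesgue_borel.
- by move=> x nPx; apply: contrapT => /H.
Qed.

End completion.

(** * Complex-valued L^2 spaces *)

Section complex_parts.
Context (R : realType).
Implicit Types x y : R[i].
Local Notation Re := complex.Re.
Local Notation Im := complex.Im.
Local Open Scope complex_scope.

Lemma ReD x y : Re (x + y) = Re x + Re y. Proof. by case: x y => ? ? [? ?]. Qed.
Lemma ImD x y : Im (x + y) = Im x + Im y. Proof. by case: x y => ? ? [? ?]. Qed.
Lemma ReN x : Re (- x) = - Re x. Proof. by case: x. Qed.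
Lemma ImN x : Im (- x) = - Im x. Proof. by case: x. Qed.
Lemma cReM x y : Re (x * y) = Re x * Re y - Im x * Im y.
Proof. by case: x y => ? ? [? ?]. Qed.
Lemma cImM x y : Im (x * y) = Re x * Im y + Im x * Re y.
Proof. by case: x y => ? ? [? ?]. Qed.
Lemma ReJ x : Re x^* = Re x. Proof. by case: x. Qed.
Lemma ImJ x : Im x^* = - Im x. Proof. by case: x. Qed.
Lemma Re0 : Re (0 : R[i]) = 0. Proof. by []. Qed.
Lemma Im0 : Im (0 : R[i]) = 0. Proof. by []. Qed.

Definition ReImE := (ReD, ImD, ReN, ImN, cReM, cImM, ReJ, ImJ, Re0, Im0).

Lemma conjcM x y : (x * y)^* = x^* * y^*.
Proof. by case: x y => a b [c e]; apply/eqP; rewrite eq_complex/=; apply/andP; split; apply/eqP; ring. Qed.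

Lemma complex_eq x y : Re x = Re y -> Im x = Im y -> x = y.
Proof. by case: x y => ? ? [? ?] /= -> ->. Qed.

(** The squared modulus as a real polynomial in the two parts, without square roots. *)
Definition sqn x : R := Re x ^+ 2 + Im x ^+ 2.

Lemma sqn_ge0 x : 0 <= sqn x. Proof. by rewrite addr_ge0// sqr_ge0. Qed.

Lemma sqn0 : sqn 0 = 0. Proof. by rewrite /sqn/= expr0n/= addr0. Qed.

Lemma sqnM x y : sqn (x * y) = sqn x * sqn y.
Proof. by rewrite /sqn !ReImE; ring. Qed.

Lemma sqnJ x : sqn x^* = sqn x. Proof. by rewrite /sqn !ReImE sqrrN. Qed.

Lemma sqnN x : sqn (- x) = sqn x. Proof. by rewrite /sqn !ReImE !sqrrN. Qed.

Lemma sqn_eq0 x : (sqn x == 0) = (x == 0).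
Proof.
apply/eqP/eqP => [|->]; last exact: sqn0.
move/eqP; rewrite /sqn paddr_eq0 ?sqr_ge0// !sqrf_eq0 => /andP[/eqP x0 /eqP y0].
exact: complex_eq.
Qed.

Lemma sqnE x : (sqn x)%:C = x * x^*.
Proof. by apply: complex_eq; rewrite ?ReImE/= /sqn; ring. Qed.

Lemma sqr_normcE x : Normc.normc x ^+ 2 = sqn x.
Proof. by case: x => a b; rewrite /= sqr_sqrtr// addr_ge0// sqr_ge0. Qed.

Lemma ReZ (a : R) x : Re (a%:C * x) = a * Re x. Proof. by rewrite cReM/=; ring. Qed.
Lemma ImZ (a : R) x : Im (a%:C * x) = a * Im x. Proof. by rewrite cImM/=; ring. Qed.

Lemma sqnD_le x y : sqn (x + y) <= 2 * (sqn x + sqn y).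
Proof.
rewrite /sqn !ReImE.
have := sqr_ge0 (Re x - Re y); have := sqr_ge0 (Im x - Im y); rewrite !expr2; lra.
Qed.

End complex_parts.

Section cint.
Context d (T : measurableType d) (R : realType) (mu : {measure set T -> \bar R}).
Local Open Scope complex_scope.
Local Notation Re := complex.Re.
Local Notation Im := complex.Im.
Implicit Types f g h : T -> R[i].

Definition cint f : R[i] := (\int[mu]_x Re (f x)) +i* (\int[mu]_x Im (f x)).

Definition cmeasurable f : Prop :=
  measurable_fun [set: T] (fun x => Re (f x)) /\
  measurable_fun [set: T] (fun x => Im (f x)).

Definition cintegrable f : Prop :=
  mu.-integrable [set: T] (EFin \o (fun x => Re (f x))) /\
  mu.-integrable [set: T] (EFin \o (fun x => Im (f x))).

Lemma cintegrable_measurable f : cintegrable f -> cmeasurable f.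
Proof.
by move=> [/measurable_int/measurable_EFinP ? /measurable_int/measurable_EFinP ?].
Qed.

Lemma cmeasurableD f g : cmeasurable f -> cmeasurable g -> cmeasurable (fun x => f x + g x).
Proof.
move=> [? ?] [? ?]; split.
  by under eq_fun do rewrite ReD; exact: measurable_funD.
by under eq_fun do rewrite ImD; exact: measurable_funD.
Qed.

Lemma cmeasurableM f g : cmeasurable f -> cmeasurable g -> cmeasurable (fun x => f x * g x).
Proof.
move=> [? ?] [? ?]; split.
  by under eq_fun do rewrite cReM; apply: measurable_funB; exact: measurable_funM.
by under eq_fun do rewrite cImM; apply: measurable_funD; exact: measurable_funM.
Qed.

Lemma cmeasurableJ f : cmeasurable f -> cmeasurable (fun x => (f x)^*).
Proof.
move=> [? ?]; split.
  by under eq_fun do rewrite ReJ.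
by under eq_fun do rewrite ImJ; exact: measurable_funN.
Qed.

Lemma cmeasurable_cst (c : R[i]) : cmeasurable (fun=> c).
Proof. by split; exact: measurable_cst. Qed.

Lemma cmeasurable_sqn f : cmeasurable f -> measurable_fun [set: T] (fun x => sqn (f x)).
Proof. by move=> [? ?]; apply: measurable_funD; exact: measurable_funX. Qed.

Lemma cintegrableD f g : cintegrable f -> cintegrable g -> cintegrable (fun x => f x + g x).
Proof.
move=> [? ?] [? ?]; split.
  rewrite (_ : _ \o _ = (EFin \o (fun x => Re (f x))) \+ (EFin \o (fun x => Re (g x))))%E.
    exact: integrableD.
  by apply/funext => x /=; rewrite ReD.
rewrite (_ : _ \o _ = (EFin \o (fun x => Im (f x))) \+ (EFin \o (fun x => Im (g x))))%E.
  exact: integrableD.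
by apply/funext => x /=; rewrite ImD.
Qed.

Lemma cintD f g : cintegrable f -> cintegrable g ->
  cint (fun x => f x + g x) = cint f + cint g.
Proof.
move=> [? ?] [? ?]; apply: complex_eq; rewrite ?ReImE/=.
  by under eq_Rintegral do rewrite ReD; exact: RintegralD.
by under eq_Rintegral do rewrite ImD; exact: RintegralD.
Qed.

Let integrableZ (a : R) (u : T -> R) : mu.-integrable [set: T] (EFin \o u) ->
  mu.-integrable [set: T] (EFin \o (fun x => a * u x)).
Proof.
move=> iu; rewrite (_ : _ \o _ = (fun x => a%:E * (EFin \o u) x))%E.
  exact: integrableZl.
by apply/funext => x /=; rewrite EFinM.
Qed.

Let integrableB2 (u v : T -> R) : mu.-integrable [set: T] (EFin \o u) ->
  mu.-integrable [set: T] (EFin \o v) ->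
  mu.-integrable [set: T] (EFin \o (fun x => u x - v x)).
Proof.
move=> iu iv; rewrite (_ : _ \o _ = (EFin \o u) \- (EFin \o v))%E.
  exact: integrableB.
by apply/funext => x /=; rewrite EFinB.
Qed.

Let integrableD2 (u v : T -> R) : mu.-integrable [set: T] (EFin \o u) ->
  mu.-integrable [set: T] (EFin \o v) ->
  mu.-integrable [set: T] (EFin \o (fun x => u x + v x)).
Proof.
move=> iu iv; rewrite (_ : _ \o _ = (EFin \o u) \+ (EFin \o v))%E.
  exact: integrableD.
by apply/funext => x /=; rewrite EFinD.
Qed.

Lemma cintegrableZ (c : R[i]) f : cintegrable f -> cintegrable (fun x => c * f x).
Proof.
move=> [? ?]; split.
  by under eq_fun do rewrite cReM; apply: integrableB2; exact: integrableZ.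
by under eq_fun do rewrite cImM; apply: integrableD2; exact: integrableZ.
Qed.

Lemma cintZ (c : R[i]) f : cintegrable f -> cint (fun x => c * f x) = c * cint f.
Proof.
move=> [? ?]; apply: complex_eq; rewrite ?ReImE/=.
  under eq_Rintegral do rewrite cReM.
  by rewrite RintegralB// ?RintegralZl//; exact: integrableZ.
under eq_Rintegral do rewrite cImM.
by rewrite RintegralD// ?RintegralZl//; exact: integrableZ.
Qed.

Lemma cintegrableJ f : cintegrable f -> cintegrable (fun x => (f x)^*).
Proof.
move=> [? H]; split; first by under eq_fun do rewrite ReJ.
under eq_fun do rewrite ImJ -mulN1r; exact: integrableZ.
Qed.

Lemma cintJ f : cintegrable f -> cint (fun x => (f x)^*) = (cint f)^*.
Proof.
move=> [? ?]; apply: complex_eq; rewrite ?ReImE/=.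
  by under eq_Rintegral do rewrite ReJ.
by under eq_Rintegral do rewrite ImJ -mulN1r; rewrite RintegralZl// mulN1r.
Qed.

Lemma cint0 : cint (fun=> 0) = 0.
Proof. by apply: complex_eq; rewrite /= /Rintegral integral0. Qed.

Lemma cintegrable0 : cintegrable (fun=> 0).
Proof. by split; exact: integrable0. Qed.

Lemma eq_cint f g : f =1 g -> cint f = cint g.
Proof. by move=> /funext ->. Qed.

Lemma cintegrable_le f (u : T -> R) : cmeasurable f ->
  mu.-integrable [set: T] (EFin \o u) ->
  (forall x, `|Re (f x)| <= u x) -> (forall x, `|Im (f x)| <= u x) -> cintegrable f.
Proof.
move=> [? ?] iu Hr Hi; split.
  apply: le_integrable iu => //; first exact/measurable_EFinP.
  by move=> x _ /=; rewrite lee_fin (le_trans (Hr x))// ler_norm.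
apply: le_integrable iu => //; first exact/measurable_EFinP.
by move=> x _ /=; rewrite lee_fin (le_trans (Hi x))// ler_norm.
Qed.

Definition sq f : \bar R := (\int[mu]_x (sqn (f x))%:E)%E.

Definition cL2 f : Prop := cmeasurable f /\ (sq f < +oo)%E.

Definition ip f g : R[i] := cint (fun x => f x * (g x)^*).

Lemma sq_ge0 f : (0 <= sq f)%E.
Proof. by apply: integral_ge0 => x _; rewrite lee_fin sqn_ge0. Qed.

Lemma sq_fin f : cL2 f -> (fine (sq f))%:E = sq f.
Proof. by move=> [_ fo]; rewrite fineK// ge0_fin_numE// sq_ge0. Qed.

Lemma cL2_integrable f : cL2 f -> mu.-integrable [set: T] (EFin \o (fun x => sqn (f x))).
Proof.
move=> [mf fo]; apply/integrableP; split.
  by apply/measurable_EFinP; exact: cmeasurable_sqn.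
rewrite (le_lt_trans _ fo)//; apply: ge0_le_integral => //.
- apply: measurableT_comp => //; apply/measurable_EFinP; exact: cmeasurable_sqn.
- by apply/measurable_EFinP; exact: cmeasurable_sqn.
- by move=> x _ /=; rewrite lee_fin ger0_norm// sqn_ge0.
Qed.

Lemma cL2_mul f g : cL2 f -> cL2 g -> cintegrable (fun x => f x * (g x)^*).
Proof.
move=> L2f L2g.
apply: (@cintegrable_le _ (fun x => sqn (f x) + sqn (g x))).
- by apply: cmeasurableM; [case: L2f|apply: cmeasurableJ; case: L2g].
- by apply: integrableD2; exact: cL2_integrable.
- move=> x; rewrite ReImE ReJ ImJ /sqn ler_norml.
  move: (Re _) (Im _) (Re _) (Im _) => a b c e.
  have := sqr_ge0 (a + c); have := sqr_ge0 (a - c).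
  have := sqr_ge0 (b + e); have := sqr_ge0 (b - e).
  have := sqr_ge0 a; have := sqr_ge0 b; have := sqr_ge0 c; have := sqr_ge0 e.
  by rewrite !expr2 => *; apply/andP; split; lra.
- move=> x; rewrite ReImE ReJ ImJ /sqn ler_norml.
  move: (Re _) (Im _) (Re _) (Im _) => a b c e.
  have := sqr_ge0 (a + e); have := sqr_ge0 (a - e).
  have := sqr_ge0 (b + c); have := sqr_ge0 (b - c).
  have := sqr_ge0 a; have := sqr_ge0 b; have := sqr_ge0 c; have := sqr_ge0 e.
  by rewrite !expr2 => *; apply/andP; split; lra.
Qed.

Lemma cL2_0 : cL2 (fun=> 0).
Proof.
split; first exact: cmeasurable_cst.
by rewrite /sq; under eq_integral do rewrite sqn0; rewrite integral0 ltry.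
Qed.

Lemma cL2Z (c : R[i]) f : cL2 f -> cL2 (fun x => c * f x).
Proof.
move=> L2f; have [mf fo] := L2f; split.
  by apply: cmeasurableM => //; exact: cmeasurable_cst.
rewrite /sq; under eq_integral do rewrite sqnM EFinM.
rewrite ge0_integralZl//.
- by rewrite -[X in (_ * X)%E](sq_fin L2f) -EFinM ltry.
- by apply/measurable_EFinP; exact: cmeasurable_sqn.
- by move=> x _; rewrite lee_fin sqn_ge0.
- by rewrite lee_fin sqn_ge0.
Qed.

Lemma cL2D f g : cL2 f -> cL2 g -> cL2 (fun x => f x + g x).
Proof.
move=> L2f L2g; have [mf fo] := L2f; have [mg go] := L2g.
split; first exact: cmeasurableD.
apply: (@le_lt_trans _ _ (\int[mu]_x (2%:E * ((sqn (f x))%:E + (sqn (g x))%:E)))%E).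
  apply: ge0_le_integral => //.
  - by move=> x _; rewrite lee_fin sqn_ge0.
  - by apply/measurable_EFinP; apply: cmeasurable_sqn; exact: cmeasurableD.
  - apply: emeasurable_funM => //; apply: emeasurable_funD;
      by apply/measurable_EFinP; exact: cmeasurable_sqn.
  - by move=> x _; rewrite -EFinD -EFinM lee_fin sqnD_le.
rewrite ge0_integralZl//; last 2 first.
- apply: emeasurable_funD; by apply/measurable_EFinP; exact: cmeasurable_sqn.
- by move=> x _; rewrite -EFinD lee_fin addr_ge0// sqn_ge0.
rewrite ge0_integralD//; last 4 first.
- by move=> x _; rewrite lee_fin sqn_ge0.
- by apply/measurable_EFinP; exact: cmeasurable_sqn.
- by move=> x _; rewrite lee_fin sqn_ge0.
- by apply/measurable_EFinP; exact: cmeasurable_sqn.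
by rewrite -[X in (_ * (X + _))%E](sq_fin L2f) -[X in (_ * (_ + X))%E](sq_fin L2g) -EFinD -EFinM ltry.
Qed.

Lemma cL2N f : cL2 f -> cL2 (fun x => - f x).
Proof. by move=> /(cL2Z (-1)); under eq_fun do rewrite mulN1r. Qed.

Lemma cL2B f g : cL2 f -> cL2 g -> cL2 (fun x => f x - g x).
Proof. by move=> L2f L2g; apply: cL2D => //; exact: cL2N. Qed.

Lemma ipDl f g h : cL2 f -> cL2 g -> cL2 h -> ip (fun x => f x + g x) h = ip f h + ip g h.
Proof.
move=> L2f L2g L2h; rewrite /ip -cintD; [|exact: cL2_mul|exact: cL2_mul].
by apply: eq_cint => x; rewrite mulrDl.
Qed.

Lemma ipZl c f h : cL2 f -> cL2 h -> ip (fun x => c * f x) h = c * ip f h.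
Proof.
move=> L2f L2h; rewrite /ip -cintZ; last exact: cL2_mul.
by apply: eq_cint => x; rewrite mulrA.
Qed.

Lemma ipJ f g : cL2 f -> cL2 g -> (ip f g)^* = ip g f.
Proof.
move=> L2f L2g; rewrite /ip -cintJ; last exact: cL2_mul.
by apply: eq_cint => x; apply: complex_eq; rewrite !ReImE; ring.
Qed.

Lemma ipNl f h : cL2 f -> cL2 h -> ip (fun x => - f x) h = - ip f h.
Proof.
move=> L2f L2h; rewrite -mulN1r -ipZl//; apply: eq_cint => x; by rewrite mulN1r.
Qed.

Lemma ipBl f g h : cL2 f -> cL2 g -> cL2 h -> ip (fun x => f x - g x) h = ip f h - ip g h.
Proof.
by move=> L2f L2g L2h; rewrite ipDl//; [rewrite ipNl|exact: cL2N].
Qed.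

Lemma ip_self f : cL2 f -> ip f f = (fine (sq f))%:C.
Proof.
move=> L2f; apply: complex_eq => /=.
  by rewrite /Rintegral; congr fine; apply: eq_integral => x _; rewrite -sqnE.
rewrite /Rintegral (_ : integral _ _ _ = 0%E)//.
by apply: integral0_eq => x _; rewrite -sqnE.
Qed.

Lemma fine_sqD f g : cL2 f -> cL2 g ->
  fine (sq (fun x => f x + g x)) = fine (sq f) + fine (sq g) + 2 * Re (ip f g).
Proof.
move=> L2f L2g; have L2fg := cL2D L2f L2g.
have := ip_self L2fg; rewrite ipDl// -(ipJ L2fg L2f) -(ipJ L2fg L2g) !ipDl//.
rewrite !ip_self// -(ipJ L2f L2g); move: (ip f g) => z.
by move=> /(congr1 (@complex.Re R)); rewrite !ReImE/= => <-; ring.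
Qed.

Lemma fine_sqZ c f : cL2 f -> fine (sq (fun x => c * f x)) = sqn c * fine (sq f).
Proof.
move=> L2f; have L2cf := cL2Z c L2f.
have := ip_self L2cf; rewrite ipZl// -(ipJ L2cf L2f) ipZl// ip_self//.
rewrite conjcM mulrA -sqnE; move=> /(congr1 (@complex.Re R)).
by rewrite ReZ ReJ /=.
Qed.

Lemma fine_sqN f : fine (sq (fun x => - f x)) = fine (sq f).
Proof. by rewrite /sq; under eq_integral do rewrite sqnN. Qed.

(** Positivity of the squared norm of f - t <f, g> g for real t, with t the inverse of the squared
    norm of g. *)
Lemma cauchy_schwarz f g : cL2 f -> cL2 g ->
  sqn (ip f g) <= fine (sq f) * fine (sq g).
Proof.
move=> L2f L2g; set F := fine (sq f); set G := fine (sq g); set a := ip f g.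
have G0 : 0 <= G by rewrite fine_ge0// sq_ge0.
have F0 : 0 <= F by rewrite fine_ge0// sq_ge0.
have H (t : R) : 0 <= F + t ^+ 2 * (sqn a * G) - 2 * t * sqn a.
  have L2t := cL2Z (- (t%:C * a)) L2g.
  have : 0 <= fine (sq (fun x => f x + - (t%:C * a) * g x)) by rewrite fine_ge0// sq_ge0.
  rewrite fine_sqD// fine_sqZ// -(ipJ L2t L2f) ReJ ipZl// -(ipJ L2f L2g) -/F -/G -/a.
  by rewrite sqnN sqnM mulNr -(mulrA t%:C) -sqnE ReN ReZ /= /sqn/=; lra.
have a0 := sqn_ge0 a.
have [G1|G1] := eqVneq G 0.
  rewrite G1 mulr0 leNgt; apply/negP => a1.
  (* If g is null, the expression is affine in t, and this t gives it the value -1. *)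
  have := H ((F + 1) / (2 * sqn a)); rewrite G1 !mulr0 addr0.
  have -> : 2 * ((F + 1) / (2 * sqn a)) * sqn a = F + 1.
    by field; rewrite gt_eqF.
  by lra.
have Gp : 0 < G by rewrite lt_def G1.
have := H G^-1.
have -> : F + G^-1 ^+ 2 * (sqn a * G) - 2 * G^-1 * sqn a = F - sqn a / G by field.
by rewrite subr_ge0 ler_pdivrMr.
Qed.

Lemma sq0_ae f : cL2 f -> sq f = 0%E -> {ae mu, forall x, f x = 0}.
Proof.
move=> [mf fo] f0.
have mq : measurable_fun [set: T] (EFin \o (fun x => sqn (f x))).
  by apply/measurable_EFinP; exact: cmeasurable_sqn.
have : (\int[mu]_x `|(sqn (f x))%:E| = 0)%E.
  rewrite -f0; apply: eq_integral => x _; by rewrite gee0_abs// lee_fin sqn_ge0.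
move/(ae_eq_integral_abs mu measurableT mq).1; apply: filterS => x /(_ I) /eqP.
by rewrite eqe sqn_eq0 => /eqP.
Qed.

Lemma ae_eq_cint f g : cmeasurable f -> cmeasurable g ->
  {ae mu, forall x, f x = g x} -> cint f = cint g.
Proof.
move=> [? ?] [? ?] fg; apply: complex_eq; rewrite /= /Rintegral; congr fine;
  apply: ae_eq_integral => //; try exact/measurable_EFinP;
  by apply: filterS fg => x -> _.
Qed.

Lemma ae_eq_sq f g : cmeasurable f -> cmeasurable g ->
  {ae mu, forall x, f x = g x} -> sq f = sq g.
Proof.
move=> mf mg fg; apply: ae_eq_integral => //; try by apply/measurable_EFinP; exact: cmeasurable_sqn.
by apply: filterS fg => x -> _.
Qed.

End cint.

(** * Domination and Fubini's theorem for complex-valued functions *)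

Section cabs.
Context d (T : measurableType d) (R : realType) (mu : {measure set T -> \bar R}).
Local Open Scope complex_scope.
Local Notation Re := complex.Re.
Local Notation Im := complex.Im.

(** A submultiplicative norm equivalent to the modulus, whose integrability is that of the two
    parts. *)
Definition cabs (z : R[i]) : R := `|Re z| + `|Im z|.

Lemma cabs_ge0 z : 0 <= cabs z. Proof. by rewrite addr_ge0. Qed.

Lemma cabsM_le z w : cabs (z * w) <= cabs z * cabs w.
Proof.
rewrite /cabs cReM cImM.
apply: (@le_trans _ _ ((`|Re z| * `|Re w| + `|Im z| * `|Im w|) +
  (`|Re z| * `|Im w| + `|Im z| * `|Re w|))).
  apply: lerD; [apply: (le_trans (ler_normB _ _))|apply: (le_trans (ler_normD _ _))];
    by rewrite !normrM.
by rewrite le_eqVlt; apply/orP; left; apply/eqP; ring.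
Qed.

Lemma cabs_sqn_le z (c : R) : 0 <= c -> sqn z <= c ^+ 2 -> cabs z <= 2 * c.
Proof.
move=> c0 zc.
have rc : `|Re z| <= c.
  rewrite -ler_sqr ?nnegrE// real_normK ?num_real// (le_trans _ zc)//.
  by rewrite /sqn lerDl sqr_ge0.
have ic : `|Im z| <= c.
  rewrite -ler_sqr ?nnegrE// real_normK ?num_real// (le_trans _ zc)//.
  by rewrite /sqn lerDr sqr_ge0.
by rewrite /cabs; lra.
Qed.

Lemma measurable_cabs (f : T -> R[i]) : cmeasurable f -> measurable_fun [set: T] (cabs \o f).
Proof.
move=> [mr mi]; apply: measurable_funD; exact: measurableT_comp.
Qed.

Lemma cintegrable_cabs (f : T -> R[i]) : cmeasurable f ->
  (\int[mu]_x (cabs (f x))%:E < +oo)%E -> cintegrable mu f.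
Proof.
move=> mf foo; have mc := measurable_cabs mf.
apply: (@cintegrable_le _ _ _ _ _ (cabs \o f)) => //.
- apply/integrableP; split; first exact/measurable_EFinP.
  apply: le_lt_trans foo; apply: ge0_le_integral => //.
  + by apply: measurableT_comp => //; exact/measurable_EFinP.
  + exact/measurable_EFinP.
  + by move=> x _ /=; rewrite lee_fin ger0_norm// cabs_ge0.
- by move=> x; rewrite /cabs/= lerDl.
- by move=> x; rewrite /cabs/= lerDr.
Qed.

Lemma cintegrable_cabs_lty (f : T -> R[i]) : cintegrable mu f ->
  (\int[mu]_x (cabs (f x))%:E < +oo)%E.
Proof.
move=> [ir ii]; rewrite /cabs; under eq_integral do rewrite EFinD.
have [/integrableP[mr ro] /integrableP[mi io]] := (ir, ii).
rewrite ge0_integralD//; last 2 first.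
- by apply/measurable_EFinP; apply: measurableT_comp => //; exact/measurable_EFinP.
- by apply/measurable_EFinP; apply: measurableT_comp => //; exact/measurable_EFinP.
by rewrite lte_add_pinfty.
Qed.

End cabs.

Lemma cmeasurable_comp d1 d2 (T1 : measurableType d1) (T2 : measurableType d2) (R : realType)
    (f : T2 -> R[i]) (g : T1 -> T2) :
  cmeasurable f -> measurable_fun setT g -> cmeasurable (fun x => f (g x)).
Proof.
by move=> [mr mi] mg; split; [exact: (measurableT_comp mr mg)|exact: (measurableT_comp mi mg)].
Qed.

Section cfubini.
Context d1 d2 (T1 : measurableType d1) (T2 : measurableType d2) (R : realType).
Variable m1 : {sigma_finite_measure set T1 -> \bar R}.
Variable m2 : {sigma_finite_measure set T2 -> \bar R}.
Local Open Scope complex_scope.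

(** The inner integrals are finite only almost everywhere, and [fine] gives 0 where they are
    infinite. The real-valued iterated integrals thus agree with the extended ones up to null
    sets. *)
Lemma Rfubini (u : T1 * T2 -> R) : (m1 \x m2)%E.-integrable setT (EFin \o u) ->
  [/\ m1.-integrable setT (EFin \o (fun x => \int[m2]_y u (x, y))),
      \int[m1]_x \int[m2]_y u (x, y) = \int[(m1 \x m2)%E]_p u p &
      \int[m2]_y \int[m1]_x u (x, y) = \int[(m1 \x m2)%E]_p u p].
Proof.
move=> iu.
have iF := integrable_fubini_F iu; have mGu := measurable_fubini_G iu.
have mF : measurable_fun setT (EFin \o (fun x => \int[m2]_y u (x, y))).
  apply/measurable_EFinP; apply: measurableT_comp => //; exact: measurable_int iF.
have mG : measurable_fun setT (EFin \o (fun y => \int[m1]_x u (x, y))).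
  apply/measurable_EFinP; apply: measurableT_comp => //; exact: mGu.
have FE : ae_eq m1 setT (fubini_F m2 (EFin \o u)) (EFin \o (fun x => \int[m2]_y u (x, y))).
  apply: filterS (integrable_ae measurableT iF) => x /= H _.
  by rewrite /= /Rintegral fineK//; exact: H.
have GE : ae_eq m2 setT (fubini_G m1 (EFin \o u)) (EFin \o (fun y => \int[m1]_x u (x, y))).
  apply: filterS (ae_integrable2 iu) => y /= H _.
  by rewrite /= /Rintegral fineK//; exact: integrable_fin_num H.
split.
- apply/integrableP; split => //; have /integrableP[mF' Foo] := iF.
  rewrite -(@ae_eq_integral _ _ _ m1 setT _ (fun x => `|fubini_F m2 (EFin \o u) x|%E))//.
  + exact: measurableT_comp.
  + exact: measurableT_comp.
  + by apply: filterS FE => x /(_ I) <- _.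
- rewrite [LHS]/Rintegral (_ : integral m1 _ _ = \int[m1]_x fubini_F m2 (EFin \o u) x)%E; last first.
    apply/esym; apply: ae_eq_integral FE => //; exact: measurable_int iF.
 
  by rewrite integral12_prod_meas1.
- rewrite [LHS]/Rintegral (_ : integral m2 _ _ = \int[m2]_x fubini_G m1 (EFin \o u) x)%E; last first.
    by apply/esym; apply: ae_eq_integral GE.
 
  by rewrite integral21_prod_meas1.
Qed.

Lemma cfubini (f : T1 * T2 -> R[i]) : cintegrable (m1 \x m2)%E f ->
  [/\ cintegrable m1 (fun x => cint m2 (fun y => f (x, y))),
      cint m1 (fun x => cint m2 (fun y => f (x, y))) = cint (m1 \x m2)%E f &
      cint m2 (fun y => cint m1 (fun x => f (x, y))) = cint (m1 \x m2)%E f].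
Proof.
move=> [/Rfubini[ir r1 r2] /Rfubini[ii i1 i2]]; split.
- by split.
- exact: complex_eq.
- exact: complex_eq.
Qed.

Lemma cmeasurable_fst (f : T1 -> R[i]) : cmeasurable f ->
  cmeasurable (fun p : T1 * T2 => f p.1).
Proof.
by move=> mf; exact: (cmeasurable_comp mf measurable_fst).
Qed.

Lemma cmeasurable_snd (f : T2 -> R[i]) : cmeasurable f ->
  cmeasurable (fun p : T1 * T2 => f p.2).
Proof.
by move=> mf; exact: (cmeasurable_comp mf measurable_snd).
Qed.

Lemma cint_tensor (F : T1 -> R[i]) (G : T2 -> R[i]) :
  cintegrable m1 F -> cintegrable m2 G ->
  cintegrable (m1 \x m2)%E (fun p => F p.1 * G p.2) /\
  cint (m1 \x m2)%E (fun p => F p.1 * G p.2) = cint m1 F * cint m2 G.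
Proof.
move=> iF iG; have mF := cintegrable_measurable iF; have mG := cintegrable_measurable iG.
have iFG : cintegrable (m1 \x m2)%E (fun p => F p.1 * G p.2).
  apply: cintegrable_cabs.
    by apply: cmeasurableM; [exact: cmeasurable_fst|exact: cmeasurable_snd].
  have mcF := measurable_cabs mF; have mcG := measurable_cabs mG.
  apply: (@le_lt_trans _ _ (\int[(m1 \x m2)%E]_p (cabs (F p.1) * cabs (G p.2))%:E)%E).
    apply: ge0_le_integral => //.
    - by move=> p _; rewrite lee_fin cabs_ge0.
    - apply/measurable_EFinP; apply: (measurable_cabs (f := fun p : T1 * T2 => F p.1 * G p.2)).
      by apply: cmeasurableM; [exact: cmeasurable_fst|exact: cmeasurable_snd].
    - apply/measurable_EFinP; apply: measurable_funM.
        exact: (measurableT_comp mcF measurable_fst).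
      exact: (measurableT_comp mcG measurable_snd).
    - by move=> p _; rewrite lee_fin cabsM_le.
  rewrite fubini_tonelli1; last 2 first.
  - apply/measurable_EFinP; apply: measurable_funM.
      exact: (measurableT_comp mcF measurable_fst).
    exact: (measurableT_comp mcG measurable_snd).
  - by move=> p; rewrite lee_fin mulr_ge0// cabs_ge0.
  have Goo := cintegrable_cabs_lty iG; have Foo := cintegrable_cabs_lty iF.
  have Gfin : (\int[m2]_y (cabs (G y))%:E)%E \is a fin_num.
    by rewrite ge0_fin_numE// integral_ge0// => y _; rewrite lee_fin cabs_ge0.
  have Ffin : (\int[m1]_x (cabs (F x))%:E)%E \is a fin_num.
    by rewrite ge0_fin_numE// integral_ge0// => y _; rewrite lee_fin cabs_ge0.
  rewrite (eq_integral (fun x => (cabs (F x))%:E * (\int[m2]_y (cabs (G y))%:E))%E); last first.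
    move=> x _; rewrite /fubini_F /= -ge0_integralZl ?lee_fin ?cabs_ge0//.
      exact/measurable_EFinP.
    by move=> y _; rewrite lee_fin cabs_ge0.
  rewrite ge0_integralZr//.
  - by rewrite -(fineK Gfin) -(fineK Ffin) -EFinM ltry.
  - exact/measurable_EFinP.
  - by move=> x _; rewrite lee_fin cabs_ge0.
  - by apply: integral_ge0 => y _; rewrite lee_fin cabs_ge0.
split => //; have [_ <- _] := cfubini iFG.
rewrite /= mulrC -cintZ//; apply: eq_cint => x; rewrite cintZ// mulrC//.
Qed.

End cfubini.

Section prod_measure.
Context d1 d2 (T1 : measurableType d1) (T2 : measurableType d2) (R : realType).
Variable m1 : {sigma_finite_measure set T1 -> \bar R}.
Variable m2 : {sigma_finite_measure set T2 -> \bar R}.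

(* An alias of [m1 \x m2] on which the sigma-finite structure can be inferred. *)
Definition prod_measure : set (T1 * T2) -> \bar R := (m1 \x m2)%E.

HB.instance Definition _ := Measure.copy prod_measure (m1 \x m2)%E.

Let prod_measure_sigma_finite : sigma_finite setT prod_measure.
Proof.
have /sigma_finiteP[F [TF ndF Foo]] := sigma_finiteT m1.
have /sigma_finiteP[G [TG ndG Goo]] := sigma_finiteT m2.
exists (fun n => F n `*` G n).
  apply/seteqP; split => // -[x y] _.
  have [k _ Fkx] : (\bigcup_k F k) x by rewrite -TF.
  have [l _ Gly] : (\bigcup_k G k) y by rewrite -TG.
  exists (maxn k l) => //; split => /=.
  - by move: x Fkx; exact/subsetPset/ndF/leq_maxl.
  - by move: y Gly; exact/subsetPset/ndG/leq_maxr.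
move=> k; have [mF Fk] := Foo k; have [mG Gk] := Goo k; split.
  exact: measurableX.
by rewrite /prod_measure product_measure1E// lte_mul_pinfty// ge0_fin_numE.
Qed.

HB.instance Definition _ := @Measure_isSigmaFinite.Build _ _ _ prod_measure
  prod_measure_sigma_finite.

End prod_measure.

Section kernel_fubini.
Context d1 d2 (X : measurableType d1) (Z : measurableType d2) (R : realType).
Variable m : {sigma_finite_measure set X -> \bar R}.
Variable nz : {sigma_finite_measure set Z -> \bar R}.
Local Open Scope complex_scope.
Variables (A B : X * Z -> R[i]) (a b : X * Z -> R) (chi : Z -> R) (Ca Cb : R).
Hypotheses (mA : cmeasurable A) (mB : cmeasurable B).
Hypotheses (ma : measurable_fun setT a) (mb : measurable_fun setT b).
Hypotheses (Aa : forall p, cabs (A p) <= a p) (Bb : forall p, cabs (B p) <= b p).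
Hypotheses (mchi : measurable_fun setT chi) (chi0 : forall z, 0 <= chi z).
Hypothesis aC : forall z, (\int[m]_x (a (x, z))%:E <= Ca%:E)%E.
Hypothesis bC : forall z, (\int[m]_x (b (x, z))%:E <= Cb%:E)%E.
Hypothesis chioo : (\int[nz]_z (chi z)%:E < +oo)%E.

Let a0 p : 0 <= a p. Proof. exact: le_trans (cabs_ge0 _) (Aa p). Qed.
Let b0 p : 0 <= b p. Proof. exact: le_trans (cabs_ge0 _) (Bb p). Qed.

Let Phi (p : (X * X) * Z) : R[i] := (chi p.2)%:C * (A (p.1.1, p.2) * B (p.1.2, p.2)).
Let u (p : (X * X) * Z) : R := chi p.2 * (a (p.1.1, p.2) * b (p.1.2, p.2)).

Let m13 : measurable_fun [set: (X * X) * Z] (fun p => (p.1.1, p.2)).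
Proof.
apply: measurable_fun_pair; last exact: measurable_snd.
exact: (measurableT_comp measurable_fst measurable_fst).
Qed.

Let m23 : measurable_fun [set: (X * X) * Z] (fun p => (p.1.2, p.2)).
Proof.
apply: measurable_fun_pair; last exact: measurable_snd.
exact: (measurableT_comp measurable_snd measurable_fst).
Qed.

Let mPhi : cmeasurable Phi.
Proof.
apply: cmeasurableM.
  by split; [exact: (measurableT_comp mchi measurable_snd)|exact: measurable_cst].
by apply: cmeasurableM; [exact: (cmeasurable_comp mA m13)|exact: (cmeasurable_comp mB m23)].
Qed.

Let mu_ : measurable_fun setT u.
Proof.
apply: measurable_funM; first exact: (measurableT_comp mchi measurable_snd).
by apply: measurable_funM; [exact: (measurableT_comp ma m13)|exact: (measurableT_comp mb m23)].
Qed.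

Let u0 p : 0 <= u p. Proof. by rewrite !mulr_ge0. Qed.

Let Phiu p : cabs (Phi p) <= u p.
Proof.
apply: (le_trans (cabsM_le _ _)).
rewrite /cabs/= normr0 addr0 (ger0_norm (chi0 _)) /u ler_wpM2l//.
by apply: (le_trans (cabsM_le _ _)); apply: ler_pM => //; exact: cabs_ge0.
Qed.

Let mslice (f : X * Z -> R) z : measurable_fun setT f -> measurable_fun setT (fun x => f (x, z)).
Proof. by move=> mf; exact: (measurableT_comp mf (pair2_measurable z)). Qed.

Lemma cintegrable_kernel_fubini : cintegrable (prod_measure m m \x nz)%E Phi.
Proof.
apply: cintegrable_cabs => //.
apply: (@le_lt_trans _ _ (\int[(prod_measure m m \x nz)%E]_p (u p)%:E)%E).
  apply: ge0_le_integral => //.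
  - by move=> p _; rewrite lee_fin cabs_ge0.
  - by apply/measurable_EFinP; exact: measurable_cabs.
  - exact/measurable_EFinP.
  - by move=> p _; rewrite lee_fin.
rewrite fubini_tonelli1; [rewrite fubini_tonelli|exact/measurable_EFinP|by move=> p; rewrite lee_fin]; [|exact/measurable_EFinP|by move=> p; rewrite lee_fin].
apply: (@le_lt_trans _ _ (\int[nz]_z ((Ca * Cb)%:E * (chi z)%:E))%E); last first.
  have chifin : (\int[nz]_z (chi z)%:E)%E \is a fin_num.
    by rewrite ge0_fin_numE// integral_ge0// => y _; rewrite lee_fin.
  (* The constants are nonnegative as soon as [Z] has a point; over an empty [Z] the integral is
     0. *)
  have C0 (c : X * Z -> R) (Cc : R) : (forall p, 0 <= c p) ->
      (forall z, (\int[m]_x (c (x, z))%:E <= Cc%:E)%E) -> forall z : Z, 0 <= Cc.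
    move=> c0 cC z; rewrite -lee_fin; apply: le_trans (cC z).
    by apply: integral_ge0 => x _; rewrite lee_fin.
  have [[z _]|nz0] := pselect (exists z : Z, True); last first.
    rewrite (_ : integral _ _ _ = 0%E) ?ltry//.
    by apply: integral0_eq => z _; case: nz0; exists z.
  rewrite ge0_integralZl//; [|exact/measurable_EFinP|by move=> ? _; rewrite lee_fin|by rewrite lee_fin mulr_ge0 ?(C0 _ _ a0 aC z) ?(C0 _ _ b0 bC z)].
  by rewrite -(fineK chifin) -EFinM ltry.
apply: ge0_le_integral => //.
- by move=> z _; apply: integral_ge0 => p _; rewrite lee_fin.
- apply: (@measurable_fun_fubini_tonelli_G _ _ _ _ _ (prod_measure m m) (EFin \o u)) => [|p].
    exact/measurable_EFinP.
  by rewrite lee_fin.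
- by apply: emeasurable_funM => //; exact/measurable_EFinP.
move=> z _.
have ge0a : (0 <= \int[m]_x (a (x, z))%:E)%E by apply: integral_ge0 => x _; rewrite lee_fin.
have ge0b : (0 <= \int[m]_x (b (x, z))%:E)%E by apply: integral_ge0 => x _; rewrite lee_fin.
rewrite [X in (X <= _)%E](_ : _ = \int[(m \x m)%E]_p (u (p, z))%:E)%E// fubini_tonelli1; last 2 first.
- by apply/measurable_EFinP; exact: (measurableT_comp mu_ (pair2_measurable z)).
- by move=> p; rewrite lee_fin.
rewrite (eq_integral (fun x => (chi z * a (x, z))%:E * \int[m]_y (b (y, z))%:E)%E); last first.
  move=> x _; rewrite /fubini_F/= -ge0_integralZl//.
  - by apply: eq_integral => y _; rewrite -EFinM /u/= mulrA.
  - by apply/measurable_EFinP; exact: mslice.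
  - by move=> y _; rewrite lee_fin.
  - by rewrite lee_fin mulr_ge0.
rewrite ge0_integralZr//; last 2 first.
- by apply/measurable_EFinP; apply: measurable_funM => //; exact: mslice.
- by move=> x _; rewrite lee_fin mulr_ge0.
under eq_integral do rewrite EFinM.
rewrite ge0_integralZl//; [|by apply/measurable_EFinP; exact: mslice|by move=> x _; rewrite lee_fin|by rewrite lee_fin].
rewrite -muleA muleC; apply: lee_wpmul2r; first by rewrite lee_fin.
by rewrite EFinM; apply: lee_pmul.
Qed.

(** To be applied with pairs of points of phase space as parameters: the left side becomes the
    double integral of |K|^2, and the right side the integral of the squared moduli of the inner
    products of coherent states. *)
Lemma kernel_fubini :
  cint (prod_measure m m) (fun p => cint nz (fun z => (chi z)%:C * (A (p.1, z) * B (p.2, z)))) =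
  cint nz (fun z => (chi z)%:C * (cint m (fun x => A (x, z)) * cint m (fun x => B (x, z)))).
Proof.
have [_ H1 H2] := cfubini cintegrable_kernel_fubini.
rewrite [LHS]H1 -H2; apply: eq_cint => z /=.
have islice (F : X * Z -> R[i]) (f : X * Z -> R) (Cf : R) : cmeasurable F ->
    measurable_fun setT f -> (forall p, cabs (F p) <= f p) ->
    (\int[m]_x (f (x, z))%:E <= Cf%:E)%E -> cintegrable m (fun x => F (x, z)).
  move=> mF mf Ff fC; have mFz := cmeasurable_comp mF (pair2_measurable z).
  apply: cintegrable_cabs => //.
  apply: le_lt_trans (ltry Cf); apply: le_trans fC; apply: ge0_le_integral => //.
  - by move=> x _; rewrite lee_fin cabs_ge0.
  - by apply/measurable_EFinP; exact: (measurable_cabs mFz).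
  - by apply/measurable_EFinP; exact: mslice.
  - by move=> x _; rewrite lee_fin.
have iA := islice A a Ca mA ma Aa (aC z).
have iB := islice B b Cb mB mb Bb (bC z).
have [iAB AB] := cint_tensor iA iB.
by rewrite -AB -cintZ.
Qed.

End kernel_fubini.

(** * Sums over arbitrary index sets *)

Section esum_extra.
Context (R : realType).

(** For each n, at most M (n + 1) terms exceed 1 / (n + 1). *)
Lemma countable_support (I : choiceType) (B : set I) (a : I -> R) (M : R) :
  (forall i, 0 <= a i) ->
  (forall s : seq I, uniq s -> {in s, forall i, B i} -> \sum_(i <- s) a i <= M) ->
  countable (B `&` [set i | a i != 0]).
Proof.
move=> a0 aM.
have -> : B `&` [set i | a i != 0] = \bigcup_n (B `&` [set i | n.+1%:R^-1 < a i]).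
  apply/seteqP; split=> [i [Bi /= ai]|i [n _ [Bi /= ai]]]; last first.
    by split => //=; rewrite gt_eqF// (lt_trans _ ai).
  have {}ai : 0 < a i by rewrite lt_neqAle eq_sym ai a0.
  exists (Num.truncn (a i)^-1) => //; split => //=.
  by rewrite invf_plt ?posrE// truncnS_gt.
apply: bigcup_countable => // n _; apply: finite_set_countable.
apply: contrapT => /(infinite_set_fset (Num.truncn (M * n.+1%:R)).+1)[X XB Xn].
pose s : seq I := finmap.enum_fset X.
have := aM s (finmap.fset_uniq X) (fun i iX => (XB i iX).1).
apply/negP; rewrite -ltNge.
have n0 : 0 < n.+1%:R^-1 :> R by rewrite invr_gt0.
apply: (@lt_le_trans _ _ (\sum_(i <- s) n.+1%:R^-1)).
  rewrite big_const_seq count_predT iter_addr_0 -[ltRHS]mulr_natl.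
  rewrite ltr_pdivlMr//; apply: (lt_le_trans (truncnS_gt _)).
  by rewrite ler_nat.
rewrite big_seq [leRHS]big_seq; apply: ler_sum => i iX; apply: ltW.
by have [] := XB i iX.
Qed.

(** A bijection with a set of natural numbers turns the sum into a series of nonnegative functions,
    to which monotone convergence applies. *)
Lemma integral_esum d (T : measurableType d) (mu : {measure set T -> \bar R})
    (I : choiceType) (B : set I) (f : I -> T -> R) : countable B ->
  (forall i, B i -> measurable_fun setT (f i)) -> (forall i x, 0 <= f i x) ->
  measurable_fun setT (fun x => \esum_(i in B) (f i x)%:E)%E /\
  (\int[mu]_x (\esum_(i in B) (f i x)%:E) = \esum_(i in B) \int[mu]_x (f i x)%:E)%E.
Proof.
elim/choicePpointed: I => I in B f *.
  move=> _ _ _; rewrite !emptyE esum_set0; split.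
    rewrite (_ : (fun x => _) = cst 0%E); first exact: measurable_cst.
    by apply/funext => x; exact: esum_set0.
  by under eq_integral do rewrite esum_set0; rewrite integral0.
move=> /countable_bijP[P /card_esym/card_set_bijP[e eB]] mf f0.
have Be n : P n -> B (e n) by move=> Pn; have [+ _ _] := eB; apply.
pose g n x : \bar R := if n \in P then (f (e n) x)%:E else 0%E.
have g0 n x : (0 <= g n x)%E by rewrite /g; case: ifP => // _; rewrite lee_fin.
have mg n : measurable_fun setT (g n).
  rewrite /g; case: (boolP (n \in P)) => [/set_mem Pn|_]; last exact: measurable_cst.
  by apply/measurable_EFinP; apply: mf; exact: Be.
have E : (fun x => \esum_(i in B) (f i x)%:E)%E = (fun x => \sum_(n <oo) g n x)%E.
  apply/funext => x; rewrite (reindex_esum _ _ _ _ eB) esum_mkcond -nneseries_esumT//.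
  by move=> n; exact: g0.
rewrite E; split.
  by apply: ge0_emeasurable_sum => // n x _ _; exact: g0.
rewrite (reindex_esum _ _ _ _ eB) esum_mkcond -nneseries_esumT; last first.
  by move=> n; case: ifP => // _; apply: integral_ge0 => x _; rewrite lee_fin.
rewrite integral_nneseries//; apply: eq_eseriesr => n _ /=.
by rewrite /g; case: (n \in P) => //; rewrite integral0.
Qed.

End esum_extra.

(** * Integrals depending on a parameter *)

Section parameter_integral.
Context d1 d2 (T1 : measurableType d1) (T2 : measurableType d2) (R : realType).
Local Open Scope complex_scope.

Lemma measurable_Rintegral (m2 : {sigma_finite_measure set T2 -> \bar R}) (u : T1 * T2 -> R) :
  measurable_fun setT u -> measurable_fun setT (fun x => \int[m2]_y u (x, y)).
Proof.
move=> mu; have mE : measurable_fun setT (EFin \o u) by exact/measurable_EFinP.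
rewrite /Rintegral; apply: measurableT_comp => //.
under eq_fun do rewrite integralE.
apply: emeasurable_funB.
  have := @measurable_fun_fubini_tonelli_F _ _ _ _ _ m2 _ (measurable_funepos mE) (fun x => funepos_ge0 _ x).
  by apply: eq_measurable_fun => x _; apply: eq_integral => y _; rewrite !funeposE.
have := @measurable_fun_fubini_tonelli_F _ _ _ _ _ m2 _ (measurable_funeneg mE) (fun x => funeneg_ge0 _ x).
by apply: eq_measurable_fun => x _; apply: eq_integral => y _; rewrite !funenegE.
Qed.

Lemma cmeasurable_cint (m2 : {sigma_finite_measure set T2 -> \bar R}) (f : T1 * T2 -> R[i]) :
  cmeasurable f -> cmeasurable (fun x => cint m2 (fun y => f (x, y))).
Proof.
move=> [mr mi]; split.
- exact: (@measurable_Rintegral m2 (fun p => complex.Re (f p))).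
- exact: (@measurable_Rintegral m2 (fun p => complex.Im (f p))).
Qed.

End parameter_integral.

Section weighted_fubini.
Context d1 d2 (X : measurableType d1) (Z : measurableType d2) (R : realType).
Variable m : {sigma_finite_measure set X -> \bar R}.
Variable nz : {sigma_finite_measure set Z -> \bar R}.
Local Open Scope complex_scope.
Variables (A : X * Z -> R[i]) (a : X * Z -> R) (w : Z -> R[i]) (chi : Z -> R) (Ca W : R).
Hypotheses (mA : cmeasurable A) (mw : cmeasurable w).
Hypotheses (ma : measurable_fun setT a).
Hypotheses (Aa : forall p, cabs (A p) <= a p) (wW : forall z, cabs (w z) <= W).
Hypotheses (mchi : measurable_fun setT chi) (chi0 : forall z, 0 <= chi z).
Hypothesis aC : forall z, (\int[m]_x (a (x, z))%:E <= Ca%:E)%E.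
Hypothesis chioo : (\int[nz]_z (chi z)%:E < +oo)%E.

Let a0 p : 0 <= a p. Proof. exact: le_trans (cabs_ge0 _) (Aa p). Qed.

Let Phi (p : X * Z) : R[i] := (chi p.2)%:C * (w p.2 * A p).
Let u (p : X * Z) : R := chi p.2 * (W * a p).

Let mslice (f : X * Z -> R) z : measurable_fun setT f -> measurable_fun setT (fun x => f (x, z)).
Proof. by move=> mf; exact: (measurableT_comp mf (pair2_measurable z)). Qed.

Lemma cintegrable_weighted : cintegrable (m \x nz)%E Phi.
Proof.
have [[z0 _]|nz0] := pselect (exists z : Z, True); last first.
  have -> : Phi = fun=> 0 by apply/funext => -[x z]; case: nz0; exists z.
  exact: cintegrable0.
have W0 : 0 <= W by exact: le_trans (cabs_ge0 _) (wW z0).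
have mPhi : cmeasurable Phi.
  apply: cmeasurableM; last by apply: cmeasurableM => //; exact: cmeasurable_snd.
  by split; [exact: (measurableT_comp mchi measurable_snd)|exact: measurable_cst].
have mu_ : measurable_fun setT u.
  apply: measurable_funM; first exact: (measurableT_comp mchi measurable_snd).
  exact: measurable_funM.
have u0 p : 0 <= u p by rewrite !mulr_ge0.
apply: cintegrable_cabs => //.
apply: (@le_lt_trans _ _ (\int[(m \x nz)%E]_p (u p)%:E)%E).
  apply: ge0_le_integral => //.
  - by move=> p _; rewrite lee_fin cabs_ge0.
  - by apply/measurable_EFinP; exact: measurable_cabs.
  - exact/measurable_EFinP.
  - move=> p _; rewrite lee_fin; apply: (le_trans (cabsM_le _ _)).
    rewrite /cabs/= normr0 addr0 (ger0_norm (chi0 _)) /u ler_wpM2l//.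
    by apply: (le_trans (cabsM_le _ _)); apply: ler_pM => //; exact: cabs_ge0.
rewrite fubini_tonelli1; [rewrite fubini_tonelli|exact/measurable_EFinP|by move=> p; rewrite lee_fin]; [|exact/measurable_EFinP|by move=> p; rewrite lee_fin].
apply: (@le_lt_trans _ _ (\int[nz]_z ((W * Ca)%:E * (chi z)%:E))%E); last first.
  have chifin : (\int[nz]_z (chi z)%:E)%E \is a fin_num.
    by rewrite ge0_fin_numE// integral_ge0// => y _; rewrite lee_fin.
  have Ca0 : 0 <= Ca.
    by rewrite -lee_fin; apply: le_trans (aC z0); apply: integral_ge0 => x _; rewrite lee_fin.
  rewrite ge0_integralZl//; [|exact/measurable_EFinP|by move=> ? _; rewrite lee_fin|by rewrite lee_fin mulr_ge0].
  by rewrite -(fineK chifin) -EFinM ltry.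
apply: ge0_le_integral => //.
- by move=> z _; apply: integral_ge0 => p _; rewrite lee_fin.
- apply: (@measurable_fun_fubini_tonelli_G _ _ _ _ _ m (EFin \o u)) => [|p].
    exact/measurable_EFinP.
  by rewrite lee_fin.
- by apply: emeasurable_funM => //; exact/measurable_EFinP.
move=> z _; rewrite /fubini_G /= /u /=.
rewrite (eq_integral (fun x => (chi z * W)%:E * (a (x, z))%:E)%E); last first.
  by move=> x _; rewrite -EFinM mulrA.
rewrite ge0_integralZl//; [|by apply/measurable_EFinP; exact: mslice|by move=> x _; rewrite lee_fin|by rewrite lee_fin mulr_ge0].
rewrite [X in (_ <= X)%E](_ : _ = (chi z * W)%:E * Ca%:E)%E.
  by rewrite lee_wpmul2l// lee_fin mulr_ge0.
by rewrite -!EFinM; congr EFin; ring.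
Qed.

Lemma weighted_fubini :
  cintegrable m (fun x => cint nz (fun z => (chi z)%:C * (w z * A (x, z)))) /\
  cint m (fun x => cint nz (fun z => (chi z)%:C * (w z * A (x, z)))) =
  cint nz (fun z => (chi z)%:C * (w z * cint m (fun x => A (x, z)))).
Proof.
have [H H1 H2] := cfubini cintegrable_weighted.
split=> //; rewrite [LHS]H1 -H2; apply: eq_cint => z /=.
have iA : cintegrable m (fun x => A (x, z)).
  have mAz := cmeasurable_comp mA (pair2_measurable z).
  apply: cintegrable_cabs => //.
  apply: le_lt_trans (ltry Ca); apply: le_trans (aC z); apply: ge0_le_integral => //.
  - by move=> x _; rewrite lee_fin cabs_ge0.
  - by apply/measurable_EFinP; exact: (measurable_cabs mAz).
  - by apply/measurable_EFinP; exact: mslice.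
  - by move=> x _; rewrite lee_fin.
by rewrite -cintZ// -cintZ//; exact: cintegrableZ.
Qed.

End weighted_fubini.

(** * Completeness of L^2 *)

Section fast_cauchy.
Context (R : realType).

Lemma cvg_pow2V : (2^-1 : R) ^+ n @[n --> \oo] --> 0.
Proof. by apply: cvg_expr; rewrite ger0_norm ?invr_ge0// invf_lt1// ltr1n. Qed.

(** Adding and subtracting the remainder bound 2 c / 2^n turns [u] into a decreasing and an
    increasing sequence with a common limit; monotonicity also gives the error bound. *)
Lemma fast_cauchy_cvg (u : R^nat) (c : R) : 0 <= c ->
  (forall n, `|u n.+1 - u n| <= c * 2^-1 ^+ n) ->
  cvgn u /\ forall n, `|limn u - u n| <= 2 * c * 2^-1 ^+ n.
Proof.
move=> c0 H.
pose a n := u n + 2 * c * 2^-1 ^+ n; pose b n := u n - 2 * c * 2^-1 ^+ n.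
have niA : nonincreasing_seq a.
  apply/nonincreasing_seqP => n; rewrite /a exprS.
  by have := H n; rewrite ler_norml => /andP[_]; lra.
have ndB : nondecreasing_seq b.
  apply/nondecreasing_seqP => n; rewrite /b exprS.
  by have := H n; rewrite ler_norml => /andP[]; lra.
have ab n : b n <= a n.
  rewrite /a /b; have : 0 <= c * 2^-1 ^+ n :> R by rewrite mulr_ge0// exprn_ge0.
  by lra.
have ca : cvgn a.
  apply: nonincreasing_is_cvgn => //; exists (b 0%N) => _ [n _ <-].
  by apply: le_trans (ab n); exact: ndB.
have cz : (2 * c * 2^-1 ^+ n : R) @[n --> \oo] --> 0.
  by rewrite -[X in _ --> X](mulr0 (2 * c)); apply: cvgM; [exact: cvg_cst|exact: cvg_pow2V].
have ua : u = a \- (fun n => 2 * c * 2^-1 ^+ n).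
  by apply/funext => n; rewrite /a/= addrK.
have cul : u @ \oo --> limn a.
  by rewrite -[X in _ --> X]subr0 {1}ua; apply: cvgB.
have cu : cvgn u by apply/cvg_ex; exists (limn a).
have cb : b @ \oo --> limn a.
  by rewrite -[X in _ --> X]subr0; apply: cvgB.
have -> : limn u = limn a by apply: cvg_lim.
split => // n; rewrite ler_norml; apply/andP; split.
  have := nondecreasing_cvgn_le ndB (cvgP _ cb) n.
  rewrite (cvg_lim _ cb)// /b.
  have : 0 <= c * 2^-1 ^+ n :> R by rewrite mulr_ge0// exprn_ge0.
  by lra.
by have := nonincreasing_cvgn_ge niA ca n; rewrite /a; lra.
Qed.

Lemma sum_pow4V_le (n : nat) : \sum_(0 <= i < n) (4^-1 : R) ^+ i <= 2.
Proof.
suff : \sum_(0 <= i < n) (4^-1 : R) ^+ i <= 2 - 2 * 4^-1 ^+ n.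
  by move/le_trans; apply; rewrite gerBl mulr_ge0// exprn_ge0.
elim: n => [|n IH]; first by rewrite big_nil expr0; lra.
rewrite big_nat_recr//= exprS; have : 0 <= (4^-1 : R) ^+ n by rewrite exprn_ge0.
by move: IH; lra.
Qed.

End fast_cauchy.

Section completeness.
Context d (T : measurableType d) (R : realType) (mu : {measure set T -> \bar R}).
Local Notation Re := complex.Re.
Local Notation Im := complex.Im.

(* The weights [4^n] make [H] integrable, and [H] dominates all the increments at once. *)
Lemma L2_fast_cauchy (u : nat -> T -> R) : (forall n, measurable_fun setT (u n)) ->
  (forall n, \int[mu]_x ((u n.+1 x - u n x) ^+ 2)%:E <= (16^-1 ^+ n)%:E)%E ->
  exists2 v : T -> R, measurable_fun setT v &
    forall n, (\int[mu]_x ((v x - u n x) ^+ 2)%:E <= (8 * 4^-1 ^+ n)%:E)%E.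
Proof.
move=> mu_ Hu.
pose D n x := (4 ^+ n * (u n.+1 x - u n x) ^+ 2)%:E.
have mD n : measurable_fun setT (D n).
  apply/measurable_EFinP; apply: measurable_funM => //.
  by apply: measurable_funX; exact: measurable_funB.
have D0 n x : (0 <= D n x)%E by rewrite lee_fin; apply: mulr_ge0; [exact: exprn_ge0|exact: sqr_ge0].
pose H x := (\sum_(n <oo) D n x)%E.
have H0 x : (0 <= H x)%E by apply: nneseries_ge0.
have mH : measurable_fun setT H by apply: ge0_emeasurable_sum.
have iH : (\int[mu]_x H x <= 2%:E)%E.
  rewrite integral_nneseries//; apply: lime_le.
    by apply: is_cvg_nneseries => n _ _; exact: integral_ge0.
  apply: nearW => n; apply: (@le_trans _ _ (\sum_(0 <= i < n) (4^-1 ^+ i)%:E)%E); last first.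
    by rewrite sumEFin lee_fin sum_pow4V_le.
  apply: lee_sum => i _; rewrite /D; under eq_integral do rewrite EFinM.
  rewrite ge0_integralZl//; last 2 first.
  - by apply/measurable_EFinP; apply: measurable_funX; exact: measurable_funB.
  - by move=> x _; rewrite lee_fin sqr_ge0.
  rewrite (_ : 4^-1 ^+ i = 4 ^+ i * 16^-1 ^+ i); last first.
    rewrite -exprMn; congr (_ ^+ _); by field.
  by rewrite EFinM lee_wpmul2l// lee_fin exprn_ge0.
have iHoo : mu.-integrable setT H.
  apply/integrableP; split => //; apply: le_lt_trans (ltry 2); apply: le_trans iH.
  by apply: ge0_le_integral => // [|x _]; [exact: measurableT_comp|rewrite gee0_abs].
(* Where [H] is infinite, on a null set, the sequence is replaced by 0, so that the limit exists
   everywhere and is measurable. *)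
pose W n x := if (H x < +oo)%E then u n x else 0.
have finc x n : (H x < +oo)%E ->
    `|u n.+1 x - u n x| <= Num.sqrt (fine (H x)) * 2^-1 ^+ n.
  move=> Hx; rewrite -ler_sqr ?nnegrE ?mulr_ge0 ?exprn_ge0 ?sqrtr_ge0//.
  rewrite real_normK ?num_real// exprMn sqr_sqrtr ?fine_ge0//.
  have : (D n x <= H x)%E.
    apply: le_trans (nneseries_lim_ge n.+1 _) => //.
    by rewrite big_nat_recr//= leeDr// sume_ge0.
  have Hf : H x \is a fin_num by rewrite ge0_fin_numE.
  rewrite -{1}(fineK Hf) lee_fin exprAC => K.
  rewrite (_ : (2^-1 ^+ 2 : R) ^+ n = (4 ^+ n)^-1); last first.
    by rewrite -exprVn; congr (_ ^+ _); field.
  by rewrite ler_pdivlMr ?exprn_gt0// mulrC.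
have cW x : cvgn (W ^~ x).
  rewrite /W; case: (boolP (H x < +oo)%E) => Hx.
    by have [] := fast_cauchy_cvg (sqrtr_ge0 _) (fun n => finc x n Hx).
  exact: is_cvg_cst.
pose v x := limn (W ^~ x).
have mW n : measurable_fun setT (W n).
  apply: measurable_fun_ifT => //; apply: measurable_fun_lte => //.
have mv : measurable_fun setT v.
  by apply: (@measurable_fun_cvg _ _ _ setT W) => // x _; exact: cW.
exists v => // n.
have Hae : {ae mu, forall x, (H x < +oo)%E}.
  apply: filterS (integrable_ae measurableT iHoo) => x /(_ I).
  by rewrite ge0_fin_numE.
(* The pointwise error is at most 2 sqrt (H x) / 2^n; its square is 4 H x / 4^n, and the integral of
   [H] is at most 2. *)
apply: (@le_trans _ _ (\int[mu]_x ((4 * 4^-1 ^+ n)%:E * H x))%E); last first.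
  rewrite ge0_integralZl// ?lee_fin ?mulr_ge0 ?exprn_ge0//.
  rewrite (_ : 8 * 4^-1 ^+ n = 4 * 4^-1 ^+ n * 2); last by ring.
  by rewrite [leRHS]EFinM lee_wpmul2l// lee_fin mulr_ge0// exprn_ge0.
apply: ae_ge0_le_integral => //.
- by move=> x _; rewrite lee_fin sqr_ge0.
- by apply/measurable_EFinP; apply: measurable_funX; exact: measurable_funB.
- by move=> x _; rewrite mule_ge0// lee_fin mulr_ge0// exprn_ge0.
- by apply: emeasurable_funM.
apply: filterS Hae => x Hx _.
have Hf : H x \is a fin_num by rewrite ge0_fin_numE.
rewrite -(fineK Hf) -EFinM lee_fin -real_normK ?num_real//.
have -> : v x = limn (u ^~ x) by rewrite /v /W Hx.
have [_ /(_ n) K] := fast_cauchy_cvg (sqrtr_ge0 _) (fun n => finc x n Hx).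
rewrite (le_trans (_ : _ <= (2 * Num.sqrt (fine (H x)) * 2^-1 ^+ n) ^+ 2))//.
  by rewrite ler_sqr ?nnegrE// mulr_ge0 ?exprn_ge0// mulr_ge0// sqrtr_ge0.
rewrite !exprMn sqr_sqrtr ?fine_ge0// exprAC.
rewrite (_ : 2^-1 ^+ 2 = 4^-1 :> R); last by field.
by rewrite (_ : 2 ^+ 2 = 4 :> R)//; [lra|ring].
Qed.

Lemma cL2_fast_cauchy (f : nat -> T -> R[i]) : (forall n, cL2 mu (f n)) ->
  (forall n, sq mu (fun x => f n.+1 x - f n x)%R <= (16^-1 ^+ n)%:E)%E ->
  exists2 g, cL2 mu g & forall n, (sq mu (fun x => g x - f n x)%R <= (16 * 4^-1 ^+ n)%:E)%E.
Proof.
move=> L2f Hf.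
have mre n : measurable_fun setT (fun x => Re (f n x)) by case: (L2f n) => [[]].
have mim n : measurable_fun setT (fun x => Im (f n x)) by case: (L2f n) => [[]].
have [|a ma Ha] := L2_fast_cauchy mre.
  move=> n; apply: le_trans (Hf n); apply: ge0_le_integral => //.
  - by move=> x _; rewrite lee_fin sqr_ge0.
  - by apply/measurable_EFinP; apply: measurable_funX; exact: measurable_funB.
  - apply/measurable_EFinP; apply: cmeasurable_sqn.
    by have [] := cL2B (L2f n.+1) (L2f n).
  - by move=> x _; rewrite lee_fin /sqn !ReImE lerDl sqr_ge0.
have [|b mb Hb] := L2_fast_cauchy mim.
  move=> n; apply: le_trans (Hf n); apply: ge0_le_integral => //.
  - by move=> x _; rewrite lee_fin sqr_ge0.
  - by apply/measurable_EFinP; apply: measurable_funX; exact: measurable_funB.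
  - apply/measurable_EFinP; apply: cmeasurable_sqn.
    by have [] := cL2B (L2f n.+1) (L2f n).
  - by move=> x _; rewrite lee_fin /sqn !ReImE lerDr sqr_ge0.
pose g x : R[i] := (a x +i* b x)%C.
have mg : cmeasurable g by split.
have Hg n : (sq mu (fun x => g x - f n x)%R <= (16 * 4^-1 ^+ n)%:E)%E.
  apply: (@le_trans _ _ ((8 * 4^-1 ^+ n)%:E + (8 * 4^-1 ^+ n)%:E)%E); last first.
    by rewrite -EFinD lee_fin; lra.
  apply: le_trans (leeD (Ha n) (Hb n)); rewrite -ge0_integralD//; last 4 first.
  - by move=> x _; rewrite lee_fin sqr_ge0.
  - by apply/measurable_EFinP; apply: measurable_funX; exact: measurable_funB.
  - by move=> x _; rewrite lee_fin sqr_ge0.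
  - by apply/measurable_EFinP; apply: measurable_funX; exact: measurable_funB.
  rewrite le_eqVlt; apply/orP; left; apply/eqP.
  by apply: eq_integral => x _; rewrite /sqn !ReImE/= EFinD.
exists g => //.
have L2d : cL2 mu (fun x => g x - f 0%N x).
  split; last by apply: (le_lt_trans (Hg 0%N)); rewrite ltry.
  have -> : (fun x => g x - f 0%N x) = (fun x => g x + (-1) * f 0%N x).
    by apply/funext => x; rewrite mulN1r.
  apply: cmeasurableD => //; apply: cmeasurableM; first exact: cmeasurable_cst.
  by case: (L2f 0%N).
have := cL2D L2d (L2f 0%N); congr cL2; by apply/funext => x; rewrite subrK.
Qed.

End completeness.

(** * Orthonormal families and Parseval's identity *)

Section orthonormal.
Context d (T : measurableType d) (R : realType) (mu : {measure set T -> \bar R}).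
Local Open Scope complex_scope.
Local Notation Re := complex.Re.
Local Notation Im := complex.Im.
Local Notation cL2 := (cL2 mu).
Local Notation ip := (ip mu).
Local Notation sq := (sq mu).
Implicit Types (e f g k : T -> R[i]) (B : set (T -> R[i])) (s t : seq (T -> R[i])).

Definition orthonormal B : Prop :=
  (forall e, B e -> cL2 e) /\ forall e e', B e -> B e' -> ip e e' = (e == e')%:R.

Definition total B : Prop :=
  forall f, cL2 f -> (forall e, B e -> ip f e = 0) -> sq f = 0%E.

Definition proj s k := fun x => \sum_(e <- s) ip k e * e x.

Lemma proj_nil k : proj [::] k = fun=> 0.
Proof. by apply/funext => x; rewrite /proj big_nil. Qed.

Lemma proj_cons e s k : proj (e :: s) k = fun x => ip k e * e x + proj s k x.
Proof. by apply/funext => x; rewrite /proj big_cons. Qed.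

Lemma proj_cat s t k : proj (s ++ t) k = fun x => proj s k x + proj t k x.
Proof. by apply/funext => x; rewrite /proj big_cat. Qed.

Lemma fine_sqD_le f g : cL2 f -> cL2 g ->
  fine (sq (fun x => f x + g x)) <= 2 * (fine (sq f) + fine (sq g)).
Proof.
move=> L2f L2g; have := fine_sqD L2f (cL2N L2g); rewrite fine_sqN.
have -> : ip f (fun x => - g x) = - ip f g.
  rewrite -(ipJ (cL2N L2g) L2f) ipNl// -(ipJ L2f L2g).
  by apply: complex_eq; rewrite !ReImE ?opprK.
rewrite (fine_sqD L2f L2g) ReN.
have : 0 <= fine (sq (fun x => f x - g x)) by rewrite fine_ge0// sq_ge0.
by lra.
Qed.

Variable B : set (T -> R[i]).
Hypothesis oB : orthonormal B.

Let BL2 e : B e -> cL2 e. Proof. by case: oB => + _; apply. Qed.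

Lemma cL2_proj s k : {in s, forall e, B e} -> cL2 (proj s k).
Proof.
elim: s => [|e s IH] sB; first by rewrite proj_nil; exact: cL2_0.
rewrite proj_cons; apply: cL2D.
  by apply/cL2Z/BL2/sB; rewrite mem_head.
by apply: IH => e' e's; apply: sB; rewrite in_cons e's orbT.
Qed.

Lemma ip_proj_eq0 s k g : {in s, forall e, B e} -> cL2 g ->
  {in s, forall e, ip e g = 0} -> ip (proj s k) g = 0.
Proof.
move=> + L2g; elim: s => [|e s IH] sB s0.
  by rewrite proj_nil -[RHS](cint0 mu); apply: eq_cint => x; rewrite mul0r.
have sB' : {in s, forall e, B e} by move=> e' e's; apply: sB; rewrite in_cons e's orbT.
have eB : B e by apply: sB; rewrite mem_head.
rewrite proj_cons ipDl//; [|exact/cL2Z/BL2|exact: cL2_proj].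
rewrite ipZl//; last exact: BL2.
rewrite s0 ?mem_head// mulr0 add0r IH// => e' e's.
by apply: s0; rewrite in_cons e's orbT.
Qed.

Lemma ip_proj s k e : uniq s -> {in s, forall e, B e} -> B e ->
  ip (proj s k) e = if e \in s then ip k e else 0.
Proof.
move=> + + Be; elim: s => [|e' s IH] us sB.
  by rewrite proj_nil -[RHS](cint0 mu); apply: eq_cint => x; rewrite mul0r.
have sB' : {in s, forall e, B e} by move=> e1 e1s; apply: sB; rewrite in_cons e1s orbT.
have eB : B e' by apply: sB; rewrite mem_head.
move: us => /= /andP[e's us].
rewrite proj_cons ipDl//; [|exact/cL2Z/BL2|exact: cL2_proj|exact: BL2].
rewrite ipZl; [|exact: BL2|exact: BL2].
have -> : ip e' e = (e' == e)%:R by case: oB => _; apply.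
rewrite IH// in_cons eq_sym.
have [ee'|ee'] := eqVneq e e'; last by rewrite mulr0 add0r.
by rewrite ee' (negPf e's) mulr1 addr0.
Qed.

Lemma fine_sq_unit e : B e -> fine (sq e) = 1.
Proof.
move=> Be; have := ip_self (BL2 Be).
have -> : ip e e = 1 by case: oB => _ /(_ e e Be Be); rewrite eqxx.
by move=> /(congr1 (@complex.Re R)).
Qed.

Lemma fine_sq_proj s k : uniq s -> {in s, forall e, B e} ->
  fine (sq (proj s k)) = \sum_(e <- s) sqn (ip k e).
Proof.
elim: s => [|e s IH] us sB.
  rewrite big_nil proj_nil /sq; under eq_integral do rewrite sqn0.
  by rewrite integral0.
have sB' : {in s, forall e, B e} by move=> e1 e1s; apply: sB; rewrite in_cons e1s orbT.
have eB : B e by apply: sB; rewrite mem_head.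
move: us => /= /andP[es us].
have L2e := BL2 eB; have L2s := cL2_proj k sB'; have L2ce := cL2Z (ip k e) L2e.
rewrite proj_cons big_cons fine_sqD// fine_sqZ// fine_sq_unit// mulr1 IH//.
rewrite ipZl// -(ipJ L2s L2e) ip_proj// (negPf es).
by rewrite conjc0 mulr0 mulr0 addr0.
Qed.

Lemma ip_sub_proj s k e : uniq s -> {in s, forall e, B e} -> cL2 k -> B e ->
  ip (fun x => k x - proj s k x) e = if e \in s then 0 else ip k e.
Proof.
move=> us sB L2k Be; rewrite ipBl//; [|exact: cL2_proj|exact: BL2].
by rewrite ip_proj//; case: ifP => _; rewrite ?subrr// subr0.
Qed.

Lemma fine_sq_sub_proj s k : uniq s -> {in s, forall e, B e} -> cL2 k ->
  fine (sq (fun x => k x - proj s k x)) = fine (sq k) - \sum_(e <- s) sqn (ip k e).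
Proof.
move=> us sB L2k; have L2p := cL2_proj k sB; have L2d := cL2B L2k L2p.
have := fine_sqD L2d L2p.
have -> : (fun x => k x - proj s k x + proj s k x) = k by apply/funext => x; rewrite subrK.
rewrite fine_sq_proj// -(ipJ L2p L2d) ip_proj_eq0//; first by rewrite conjc0/=; lra.
move=> e es; rewrite -(ipJ L2d (BL2 (sB e es))) ip_sub_proj//; last exact: sB.
by rewrite es conjc0.
Qed.

Lemma bessel s k : uniq s -> {in s, forall e, B e} -> cL2 k ->
  \sum_(e <- s) sqn (ip k e) <= fine (sq k).
Proof.
move=> us sB L2k; rewrite -subr_ge0 -fine_sq_sub_proj//.
by rewrite fine_ge0// sq_ge0.
Qed.

Lemma ler_sum_subset s t (a : (T -> R[i]) -> R) : uniq s -> uniq t ->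
  {subset s <= t} -> (forall e, 0 <= a e) -> \sum_(e <- s) a e <= \sum_(e <- t) a e.
Proof.
move=> us ut st a0; rewrite [leRHS](bigID (mem s))/=.
have ps : perm_eq s [seq e <- t | e \in s].
  apply: uniq_perm => //; first exact: filter_uniq.
  move=> e; rewrite mem_filter; apply/idP/andP => [es|[]//].
  by split => //; exact: st.
by rewrite (perm_big _ ps) big_filter lerDl sumr_ge0.
Qed.

Lemma le_pow4V_eq (a b C : R) : 0 <= C -> (forall n, a <= b + C * 4^-1 ^+ n) -> a <= b.
Proof.
move=> C0 H; apply/ler_addgt0Pr => e e0.
have C1 : 0 < C + 1 by rewrite ltr_wpDl.
have : (4^-1 : R) ^+ n @[n --> \oo] --> 0.
  by apply: cvg_expr; rewrite ger0_norm ?invr_ge0// invf_lt1// ltr1n.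
move=> /cvgr_lt /(_ _ (divr_gt0 e0 C1)) [n _ /(_ n (leqnn n)) Hn].
apply: (le_trans (H n)); rewrite lerD2l.
apply: (@le_trans _ _ ((C + 1) * 4^-1 ^+ n)).
  by rewrite ler_wpM2r ?exprn_ge0// lerDl.
by rewrite mulrC -ler_pdivlMr// ltW.
Qed.

Lemma parseval k : total B -> cL2 k -> (\esum_(e in B) (sqn (ip k e))%:E = sq k)%E.
Proof.
move=> tB L2k.
pose A := [set r : R | exists s, [/\ uniq s, {in s, forall e, B e} &
  r = \sum_(e <- s) sqn (ip k e)]].
have ubA : ubound A (fine (sq k)).
  by move=> _ [s [us sB ->]]; exact: bessel.
have A0 : A 0 by exists [::]; rewrite big_nil.
have supA : has_sup A by split; [exists 0|exists (fine (sq k))].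
pose S := sup A.
have SA s : uniq s -> {in s, forall e, B e} -> \sum_(e <- s) sqn (ip k e) <= S.
  by move=> us sB; apply: sup_upper_bound => //; exists s.
have esumS : (\esum_(e in B) (sqn (ip k e))%:E = S%:E)%E.
  apply/eqP; rewrite eq_le; apply/andP; split.
    apply: ge_ereal_sup => _ [F [finF FB] <-].
    rewrite fsbig_finite//= sumEFin lee_fin; apply: SA; first exact: finmap.fset_uniq.
    by move=> e; rewrite in_fset_set// inE => /FB.
  rewrite -ereal_sup_EFin; [|by exists (fine (sq k))|by exists 0].
  apply: ge_ereal_sup => _ [_ [s [us sB ->]] <-].
  apply: ereal_sup_ubound; exists [set` s].
    by split; [exact: finite_seq|move=> e /= es; exact: sB].
  by rewrite -fsbig_seq// sumEFin.
have HX n : exists s, [/\ uniq s, {in s, forall e, B e} &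
    S - 16^-1 ^+ n <= \sum_(e <- s) sqn (ip k e)].
  have e0 : 0 < (16^-1 : R) ^+ n by rewrite exprn_gt0.
  have [_ [s [us sB ->]] Hs] := sup_adherent e0 supA.
  by exists s; split => //; exact: ltW.
have {HX} [X HX] := choice HX.
(* The families [X n] are unrelated. Accumulating them without repetition makes them nested, so that
   consecutive projections differ by a projection. *)
pose Y := fix Y n := if n is m.+1 then Y m ++ [seq e <- X n | e \notin Y m] else X 0%N.
have YS n : Y n.+1 = Y n ++ [seq e <- X n.+1 | e \notin Y n] by [].
have HY n : [/\ uniq (Y n), {in Y n, forall e, B e} & {subset X n <= Y n}].
  elim: n => [|n [uY YB _]]; first by have [? ? _] := HX 0%N; split.
  have [uX XB _] := HX n.+1; rewrite YS; split.
  - rewrite cat_uniq uY filter_uniq// andbT; apply/hasPn => e.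
    by rewrite mem_filter => /andP[].
  - move=> e; rewrite mem_cat mem_filter => /orP[|/andP[_]]; [exact: YB|exact: XB].
  - by move=> e eX; rewrite mem_cat mem_filter eX andbT orbN.
have uY n : uniq (Y n) by case: (HY n).
have YB n : {in Y n, forall e, B e} by case: (HY n).
have SY n : S - 16^-1 ^+ n <= \sum_(e <- Y n) sqn (ip k e).
  have [uX _ SX] := HX n; apply: (le_trans SX); apply: ler_sum_subset => //.
    by case: (HY n).
  by move=> e; exact: sqn_ge0.
have L2Y n : cL2 (proj (Y n) k) by exact: cL2_proj.
have [|g L2g Hg] := @cL2_fast_cauchy _ _ _ mu (fun n => proj (Y n) k) L2Y.
  move=> n.
  have [uZ ZB] : uniq [seq e <- X n.+1 | e \notin Y n] /\
      {in [seq e <- X n.+1 | e \notin Y n], forall e, B e}.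
    have [uX XB _] := HX n.+1; split; first exact: filter_uniq.
    by move=> e; rewrite mem_filter => /andP[_]; exact: XB.
  have -> : (fun x => proj (Y n.+1) k x - proj (Y n) k x) =
      proj [seq e <- X n.+1 | e \notin Y n] k.
    by apply/funext => x; rewrite YS proj_cat addrC addrA addNr add0r.
  rewrite -(sq_fin (cL2_proj k ZB)) lee_fin fine_sq_proj//.
  have := SA _ (uY n.+1) (YB n.+1); rewrite YS big_cat/=.
  by have := SY n; lra.
have Hg' n : fine (sq (fun x => g x - proj (Y n) k x)) <= 16 * 4^-1 ^+ n.
  by rewrite -lee_fin sq_fin//; exact: cL2B.
have pow16 n : (16^-1 : R) ^+ n <= 4^-1 ^+ n.
  by rewrite lerXn2r ?nnegrE// lef_pV2 ?posrE// ler_nat.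
have L2kg := cL2B L2k L2g.
have kg0 : sq (fun x => k x - g x) = 0%E.
  apply: tB => // e Be; have L2e := BL2 Be; apply/eqP; rewrite -sqn_eq0 eq_le sqn_ge0 andbT.
  (* 34 = 2 (1 + 16): 1 bounds the coefficient of k minus its projection, 16 the distance of the
     projection to the limit, and 2 comes from [sqnD_le]. *)
  apply: (@le_pow4V_eq _ _ 34) => // n; rewrite add0r.
  have L2a := cL2B L2k (L2Y n); have L2b := cL2B (L2Y n) L2g.
  have -> : (fun x => k x - g x) = (fun x => (k x - proj (Y n) k x) + (proj (Y n) k x - g x)).
    by apply/funext => x; rewrite addrA subrK.
  rewrite ipDl//; apply: (le_trans (sqnD_le _ _)).
  have H1 : sqn (ip (fun x => k x - proj (Y n) k x) e) <= 16^-1 ^+ n.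
    rewrite ip_sub_proj//; case: ifPn => eY; first by rewrite sqn0 exprn_ge0.
    have : sqn (ip k e) + \sum_(e <- Y n) sqn (ip k e) <= S.
      have := SA (e :: Y n); rewrite big_cons; apply; first by rewrite /= eY uY.
      by move=> e'; rewrite in_cons => /orP[/eqP ->//|]; exact: YB.
    by have := SY n; lra.
  have H2 : sqn (ip (fun x => proj (Y n) k x - g x) e) <= 16 * 4^-1 ^+ n.
    apply: (le_trans (cauchy_schwarz L2b L2e)); rewrite (fine_sq_unit Be) mulr1.
    have -> : (fun x => proj (Y n) k x - g x) = (fun x => - (g x - proj (Y n) k x)).
      by apply/funext => x; rewrite opprB.
    by rewrite fine_sqN.
  by have := pow16 n; lra.
rewrite esumS -(sq_fin L2k); congr EFin; apply/eqP; rewrite eq_le; apply/andP; split.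
  by apply: sup_le_ub => //; exists 0.
apply: (@le_pow4V_eq _ _ 32) => // n.
have := fine_sq_sub_proj (uY n) (YB n) L2k.
have := fine_sqD_le L2kg (cL2B L2g (L2Y n)); rewrite kg0 /= add0r.
have -> : (fun x => k x - g x + (g x - proj (Y n) k x)) = (fun x => k x - proj (Y n) k x).
  by apply/funext => x; rewrite addrA subrK.
by have := Hg' n; have := SA _ (uY n) (YB n); lra.
Qed.

End orthonormal.

Section existence.
Context d (T : measurableType d) (R : realType) (mu : {measure set T -> \bar R}).
Local Open Scope complex_scope.

(** By Zorn's lemma there is a maximal orthonormal family; a non-null function orthogonal to it
    could be normalized and added. *)
Lemma exists_orthonormal_total : exists B : set (T -> R[i]),
  orthonormal mu B /\ total mu B.
Proof.
have [|A [oA Amax]] := @Zorn_bigcup _ (@orthonormal _ T R mu).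
  move=> F FP totF; split.
    by move=> e [X FX Xe]; have [+ _] := FP X FX; apply.
  move=> e e' [X FX Xe] [X' FX' X'e'].
  have [XX'|X'X] := totF _ _ FX FX'.
    by have [_ +] := FP X' FX'; apply => //; exact: XX'.
  by have [_ +] := FP X FX; apply => //; exact: X'X.
exists A; split => // f L2f f0; apply/eqP; apply: contrapT => /negP sf0.
have F0 : 0 < fine (sq mu f).
  by rewrite lt_def fine_ge0 ?sq_ge0// andbT fine_eq0// -(sq_fin L2f).
pose c := (Num.sqrt (fine (sq mu f)))^-1.
have c0 : 0 < c by rewrite invr_gt0 sqrtr_gt0.
pose g x := c%:C * f x.
have L2g : cL2 mu g by exact: cL2Z.
have gg : ip mu g g = 1.
  rewrite ip_self// fine_sqZ// /sqn/= expr0n/= addr0 /c exprVn sqr_sqrtr; last exact: ltW.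
  by rewrite mulVf// gt_eqF.
have gA e : A e -> ip mu g e = 0.
  by move=> Ae; rewrite ipZl//; [rewrite f0// mulr0|case: oA => + _; apply].
have nAg : ~ A g.
  move=> /gA; rewrite gg => /eqP; rewrite oner_eq0//.
apply: (Amax (A `|` [set g])).
  split; last by move=> /(_ g (or_intror erefl)).
  by move=> e; left.
have [AL2 Ao] := oA.
split; first by move=> e [/AL2//|->].
move=> e e' [Ae|->] [Ae'|->].
- exact: Ao.
- rewrite -(ipJ L2g (AL2 _ Ae)) gA// conjc0.
  by case: eqVneq => // eg; move: nAg; rewrite -eg.
- by rewrite gA//; case: eqVneq => // eg; move: nAg; rewrite eg.
- by rewrite gg eqxx.
Qed.

End existence.

(** * Fourier transform of the Gaussian *)

Section gaussian_fourier1.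
Context (R : realType).
Local Notation mu := (@lebesgue_measure R).
Variable a : R.
Hypothesis a0 : 0 < a.

Let gauss (b x : R) := expR (- (b * (x * x))).

Let integrable_gauss (b K : R) : 0 < b -> mu.-integrable setT (EFin \o (fun x => K * gauss b x)).
Proof.
move=> b0.
have mg : measurable_fun setT (EFin \o gauss b).
  apply/measurable_EFinP; apply: measurable_fun_expR; apply: measurable_funN.
  by apply: measurable_funM => //; apply: measurable_funM.
have ig : mu.-integrable setT (EFin \o gauss b).
  apply/integrableP; split => //.
  have -> : (\int[mu]_x `|(EFin \o gauss b) x| = (Num.sqrt (pi / b))%:E)%E.
    rewrite -ge0_integral_gauss1//; apply: eq_integral => x _ /=.
    by rewrite ger0_norm// expR_ge0.
  by rewrite ltry.
rewrite (_ : _ \o _ = (fun x => K%:E * (EFin \o gauss b) x))%E; first exact: integrableZl.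
by apply/funext => x /=; rewrite EFinM.
Qed.

Let measurable_gauss_fun (u v : R -> R) : continuous u -> continuous v ->
  measurable_fun setT (fun x => u x * v x).
Proof.
by move=> cu cv; apply: measurable_funM; exact: continuous_measurable_fun.
Qed.

Let integrable_mulc (K : R) (f : R -> R) : mu.-integrable setT (EFin \o f) ->
  mu.-integrable setT (EFin \o (fun x => K * f x)).
Proof.
move=> fi; rewrite (_ : _ \o _ = (fun x => K%:E * (EFin \o f) x))%E; first exact: integrableZl.
by apply/funext => x /=; rewrite EFinM.
Qed.

Let dominated (f : R -> R) (b K : R) : 0 < b -> measurable_fun setT f ->
  (forall x, `|f x| <= K * gauss b x) -> mu.-integrable setT (EFin \o f).
Proof.
move=> b0 mf H; apply: le_integrable (integrable_gauss K b0) => //.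
  exact/measurable_EFinP.
by move=> x _ /=; rewrite lee_fin (le_trans (H x))// ler_norm.
Qed.

Lemma ler_norm_gauss (x : R) : `|x| * gauss a x <= (1 + a^-1) * gauss (a / 2) x.
Proof.
have -> : gauss a x = gauss (a / 2) x * gauss (a / 2) x.
  by rewrite /gauss -expRD; congr expR; field.
rewrite mulrA ler_wpM2r ?expR_ge0// /gauss expRN ler_pdivrMr ?expR_gt0//.
have e1 : 1 + a / 2 * (x * x) <= expR (a / 2 * (x * x)) by exact: expR_ge1Dx.
have ai : 0 < a^-1 by rewrite invr_gt0.
apply: (@le_trans _ _ ((1 + a^-1) * (1 + a / 2 * (x * x)))); last first.
  by rewrite ler_wpM2l// addr_ge0// ltW.
have -> : (1 + a^-1) * (1 + a / 2 * (x * x)) =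
    1 + a / 2 * (x * x) + a^-1 + (x * x) / 2.
  by field; rewrite gt_eqF.
have : 0 <= a / 2 * (x * x) by apply: mulr_ge0; [rewrite divr_ge0// ltW|rewrite -expr2 sqr_ge0].
have := sqr_ge0 (x - 1); have := sqr_ge0 (x + 1); rewrite !expr2.
by case: (ler0P x); lra.
Qed.

Definition gauss_cos s := \int[mu]_x (gauss a x * cos (s * x)).

Let gauss_xsin s := \int[mu]_x (x * gauss a x * sin (s * x)).

Let continuous_gauss b : continuous (gauss b).
Proof.
move=> x; apply: (cvg_comp (fun x => - (b * (x * x))) expR); last exact: continuous_expR.
apply: (@cvgN _ R^o); apply: cvgM; first exact: cvg_cst.
by apply: cvgM; exact: cvg_id.
Qed.

Let continuous_lin s : continuous (fun x : R => s * x).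
Proof. by move=> x; apply: cvgM; [exact: cvg_cst|exact: cvg_id]. Qed.

Let measurable_gcos s : measurable_fun setT (fun x => gauss a x * cos (s * x)).
Proof.
apply: measurable_gauss_fun => // x.
by apply: (cvg_comp (fun x => s * x) cos); [exact: continuous_lin|exact: continuous_cos].
Qed.

Let measurable_gsin s : measurable_fun setT (fun x => gauss a x * sin (s * x)).
Proof.
apply: measurable_gauss_fun => // x.
by apply: (cvg_comp (fun x => s * x) sin); [exact: continuous_lin|exact: continuous_sin].
Qed.

Let norm_cos_le1 (t : R) : `|cos t| <= 1.
Proof. by rewrite ler_norml cos_geN1 cos_le1. Qed.

Let norm_sin_le1 (t : R) : `|sin t| <= 1.
Proof. by rewrite ler_norml sin_geN1 sin_le1. Qed.

Lemma integrable_gauss_cos s : mu.-integrable setT (EFin \o (fun x => gauss a x * cos (s * x))).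
Proof.
apply: (@dominated _ a 1) => // x.
by rewrite mul1r normrM (ger0_norm (expR_ge0 _)) ler_piMr// expR_ge0.
Qed.

Lemma integrable_gauss_sin s : mu.-integrable setT (EFin \o (fun x => gauss a x * sin (s * x))).
Proof.
apply: (@dominated _ a 1) => // x.
by rewrite mul1r normrM (ger0_norm (expR_ge0 _)) ler_piMr// expR_ge0.
Qed.

Let integrable_xsin s : mu.-integrable setT (EFin \o (fun x => x * gauss a x * sin (s * x))).
Proof.
have a20 : 0 < a / 2 by rewrite divr_gt0.
apply: (@dominated _ (a / 2) (1 + a^-1)) => //.
  under eq_fun do rewrite -mulrA; apply: measurable_funM => //.
move=> x; rewrite !normrM (ger0_norm (expR_ge0 _)).
apply: le_trans (ler_norm_gauss x); rewrite ler_piMr//.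
Qed.

Let is_derive_cos s x : is_derive s (1 : R) (fun s : R => gauss a x * cos (s * x))
  (- (x * gauss a x * sin (s * x))).
Proof.
have H : is_derive s (1 : R) (fun s : R => cos (s * x)) (- (x * sin (s * x))).
  apply: is_derive_eq; rewrite /GRing.scale/=; ring.
apply: is_derive_eq; rewrite /GRing.scale/=; ring.
Qed.

Lemma is_derive_gauss_cos s : is_derive s (1 : R) gauss_cos (- gauss_xsin s).
Proof.
have sI : `](s - 1), (s + 1)[%classic s by rewrite /= in_itv/= ltrBlDr ltrDl ltr01.
have a20 : 0 < a / 2 by rewrite divr_gt0.
have H1 x : `](s - 1), (s + 1)[%classic x -> mu.-integrable setT
   (EFin \o (fun y => gauss a y * cos (x * y))) by move=> _; exact: integrable_gauss_cos.
have H2 x y : `](s - 1), (s + 1)[%classic x -> [set: R] y ->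
    derivable (fun x : R => gauss a y * cos (x * y)) x 1.
  by move=> _ _; have [] := is_derive_cos x y.
have G0 y : 0 <= (1 + a^-1) * gauss (a / 2) y.
  by rewrite mulr_ge0 ?expR_ge0// addr_ge0// invr_ge0 ltW.
have H3 x y : `](s - 1), (s + 1)[%classic x -> [set: R] y ->
    `|partial1of2 (fun x y : R => gauss a y * cos (x * y)) x y| <= (1 + a^-1) * gauss (a / 2) y.
  move=> _ _; rewrite /partial1of2 derive1E.
  have [_ ->] := is_derive_cos x y.
  rewrite normrN !normrM (ger0_norm (expR_ge0 _)).
  by apply: le_trans (ler_norm_gauss y); rewrite ler_piMr.
split.
  exact: (derivable_under_integral measurableT sI H1 H2 G0 (integrable_gauss _ a20) H3).
rewrite -derive1E.
rewrite (differentiation_under_integral measurableT sI H1 H2 G0 (integrable_gauss _ a20) H3).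
rewrite -[RHS]mulN1r -RintegralZl//.
apply: eq_Rintegral => x _; rewrite /partial1of2 derive1E.
by have [_ ->] := is_derive_cos s x; rewrite mulN1r.
Qed.

Let h s y := gauss a y * sin (s * y).
Let h' s y := s * (gauss a y * cos (s * y)) - 2 * a * (y * gauss a y * sin (s * y)).

Let is_derive_h s t x : is_derive t (1 : R) (fun t : R => h s (x + t)) (h' s (x + t)).
Proof.
have H1 : is_derive t (1 : R) (fun t : R => gauss a (x + t))
    (- (2 * a * (x + t) * gauss a (x + t))).
  rewrite /gauss; apply: is_derive_eq; rewrite /GRing.scale/=; ring.
have H2 : is_derive t (1 : R) (fun t : R => sin (s * (x + t))) (s * cos (s * (x + t))).
  apply: is_derive_eq; rewrite /GRing.scale/=; ring.
rewrite /h; apply: is_derive_eq; rewrite /GRing.scale/= /h'; ring.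
Qed.

Lemma Rintegral_translate (f : R -> R) (t : R) : mu.-integrable setT (EFin \o f) ->
  \int[mu]_x f (x + t) = \int[mu]_x f x.
Proof.
move=> /measurable_int mf; rewrite /Rintegral; congr fine.
rewrite integralE [RHS]integralE.
rewrite -(ge0_integral_translate1 t (measurable_funepos mf)); last exact: funepos_ge0.
rewrite -(ge0_integral_translate1 t (measurable_funeneg mf)); last exact: funeneg_ge0.
by congr (_ - _)%E; apply: eq_integral => x _; rewrite ?funeposE ?funenegE.
Qed.

(* The integral of [h (x + t)] does not depend on [t]: its derivative at [0] vanishes. *)
Lemma gauss_by_parts s : gauss_xsin s = s / (2 * a) * gauss_cos s.
Proof.
have a20 : 0 < a / 2 by rewrite divr_gt0.
have a40 : 0 < a / 4 by rewrite divr_gt0.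
have sI : `](-1), 1[%classic (0 : R) by rewrite /= in_itv/= ltrN10 ltr01.
have mh (t : R) : measurable_fun setT (fun x : R => h s (x + t)).
  have mt : measurable_fun setT (fun x : R => x + t) by apply: measurable_funD.
  exact: (measurableT_comp (measurable_gsin s) mt).
pose K := (`|s| + 2 * a * (1 + a^-1)) * expR (a / 2).
have ai : 0 < a^-1 by rewrite invr_gt0.
have K1 : 0 <= 2 * a * (1 + a^-1) by rewrite !mulr_ge0 ?addr_ge0// ltW.
(* A bound uniform in |t| < 1, needed to differentiate under the integral: the difference of the
   exponents is a / 4 times 2 (1 - t^2) + (x + 2 t)^2. *)
have gle (x t : R) : `](-1), 1[%classic t -> gauss (a / 2) (x + t) <= expR (a / 2) * gauss (a / 4) x.
  rewrite /= in_itv/= => /andP[t1 t2]; rewrite /gauss -expRD ler_expR.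
  have : 0 <= a / 4 * (2 * (1 - t * t) + (x + 2 * t) * (x + 2 * t)).
    apply: mulr_ge0; first by rewrite divr_ge0// ltW.
    by apply: addr_ge0; [nra|rewrite -expr2 sqr_ge0].
  by lra.
have gale x : gauss a x <= gauss (a / 2) x.
  by rewrite /gauss ler_expR lerN2; apply: ler_wpM2r; [rewrite -expr2 sqr_ge0|lra].
have h'le (t x : R) : `](-1), 1[%classic t -> `|h' s (x + t)| <= K * gauss (a / 4) x.
  move=> tI; rewrite /K -mulrA; apply: le_trans (_ : _ <= (`|s| + 2 * a * (1 + a^-1)) * gauss (a / 2) (x + t)) _.
    rewrite mulrDl (le_trans (ler_normB _ _))// lerD//.
      rewrite normrM ler_wpM2l// normrM (ger0_norm (expR_ge0 _)).
      by rewrite (le_trans _ (gale _))// ler_piMr// expR_ge0.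
    rewrite !normrM (ger0_norm (expR_ge0 _)) (gtr0_norm a0) ger0_norm// -!mulrA.
    apply: ler_wpM2l => //; apply: ler_wpM2l; [exact: ltW|rewrite mulrA].
    by apply: le_trans (ler_norm_gauss (x + t)); rewrite ler_piMr.
  by rewrite ler_wpM2l ?gle// addr_ge0.
have H1 (t : R) : `](-1), 1[%classic t -> mu.-integrable setT (EFin \o (fun x : R => h s (x + t))).
  move=> tI; apply: (@dominated _ (a / 4) (expR (a / 2))) => //.
  move=> x; rewrite /h normrM (ger0_norm (expR_ge0 _)).
  apply: le_trans (gle x t tI); apply: le_trans (gale _).
  by rewrite ler_piMr// expR_ge0.
have H2 (t x : R) : `](-1), 1[%classic t -> [set: R] x -> derivable (fun t : R => h s (x + t)) t 1.
  by move=> _ _; have [] := is_derive_h s t x.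
have K0 : 0 <= K by rewrite mulr_ge0 ?expR_ge0// addr_ge0.
have G0 x : 0 <= K * gauss (a / 4) x by rewrite mulr_ge0// expR_ge0.
have H3 (t x : R) : `](-1), 1[%classic t -> [set: R] x ->
    `|partial1of2 (fun t x : R => h s (x + t)) t x| <= K * gauss (a / 4) x.
  move=> tI _; rewrite /partial1of2 derive1E.
  by have [_ ->] := is_derive_h s t x; exact: h'le.
have := differentiation_under_integral measurableT sI H1 H2 G0 (integrable_gauss _ a40) H3.
have -> : (fun t => \int[mu]_x h s (x + t)) = cst (\int[mu]_x h s x).
  by apply/funext => t; apply: Rintegral_translate; exact: integrable_gauss_sin.
rewrite derive1_cst => /esym H.
have : \int[mu]_x (h' s x) = 0.
  rewrite -H; apply: eq_Rintegral => x _; rewrite /partial1of2 derive1E.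
  by have [_ ->] := is_derive_h s 0 x; rewrite addr0.
rewrite RintegralB//; last 2 first.
- by apply: integrable_mulc; exact: integrable_gauss_cos.
- by apply: integrable_mulc; exact: integrable_xsin.
rewrite !RintegralZl//; try exact: integrable_xsin; try exact: integrable_gauss_cos.
rewrite -/(gauss_cos s) -/(gauss_xsin s) => /eqP; rewrite subr_eq0 => /eqP sc.
by rewrite mulrAC sc; field; rewrite gt_eqF.
Qed.

(** By [gauss_by_parts] the transform C satisfies C' = - s / (2 a) C. Multiplied by the integrating
    factor exp (s^2 / (4 a)) it is constant, with the Gaussian integral as value at 0. *)
Lemma gauss_cosE s : gauss_cos s = Num.sqrt (pi / a) * expR (- (s ^+ 2 / (4 * a))).
Proof.
pose H t := gauss_cos t * expR (t ^+ 2 / (4 * a)).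
have dH t : is_derive t (1 : R) H 0.
  have H1 := is_derive_gauss_cos t.
  have H2 : is_derive t (1 : R) (fun t : R => expR (t ^+ 2 / (4 * a)))
      (t / (2 * a) * expR (t ^+ 2 / (4 * a))).
    apply: is_derive_eq; rewrite /GRing.scale/=; field; rewrite gt_eqF//.
  apply: is_derive_eq; rewrite /GRing.scale/= gauss_by_parts; ring.
have H0 : H s = H 0 by apply: is_derive_0_is_cst.
have G0 : gauss_cos 0 = Num.sqrt (pi / a).
  rewrite /gauss_cos /Rintegral -[RHS]/(fine (Num.sqrt (pi / a))%:E); congr fine.
  rewrite -ge0_integral_gauss1//; apply: eq_integral => x _.
  by rewrite mul0r cos0 mulr1.
move: H0; rewrite /H G0 expr0n/= mul0r expR0 mulr1 => <-.
by rewrite -mulrA -expRD subrr expR0 mulr1.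
Qed.

End gaussian_fourier1.

Lemma sqr_poweR (R : realType) (x : \bar R) : (0 <= x)%E -> (x ^+ 2 = x `^ 2)%E.
Proof.
case: x => [r| |]//; last by rewrite poweRyr ?expe2 ?mulyy ?pnatr_eq0.
by rewrite lee_fin => r0; rewrite poweR_EFin powR_mulrn// expe2 -EFinM expr2.
Qed.

(** * L^2 of the completed measure, through Borel representatives *)

Section lebesgue_L2.
Context (R : realType) (n : nat).
Local Open Scope complex_scope.
Local Notation Rn := (borelRn R n).
Local Notation Ln := (lebesgueRn R n).
Local Notation L := (borel_lebesgue R n).
Local Notation nu := (lebesgue R n).
Implicit Types f g : Ln -> R[i].

Lemma sqr_l2norm f : (l2norm f ^+ 2 = sq nu f)%E.
Proof.
rewrite sqr_poweR ?Lnorm_ge0// powR_Lnorm; last by rewrite pnatr_eq0.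
apply: eq_integral => x _ /=.
rewrite powR_mulrn ?normr_ge0// real_normK ?num_real//; congr (_%:E); exact: sqr_normcE.
Qed.

Lemma l2norm_lty f : (l2norm f < +oo)%E <-> (sq nu f < +oo)%E.
Proof.
rewrite -sqr_l2norm; have : (0 <= l2norm f)%E by exact: Lnorm_ge0.
by case: (l2norm f) => [r| |]//= _; rewrite ?expe2 -?EFinM ?ltry.
Qed.

Lemma l2norm_eq0 f : l2norm f = 0%E <-> sq nu f = 0%E.
Proof.
rewrite -sqr_l2norm; split => [->|/eqP]; first by rewrite expe2 mule0.
by rewrite expe2 mule_eq0 orbb => /eqP.
Qed.

Lemma L2E f : L2 f <-> cL2 nu f.
Proof.
split=> [[mr mi /l2norm_lty foo]|[[mr mi] /l2norm_lty foo]]; first by split.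
by split.
Qed.

Lemma orthonormal_basisE (B : set (Ln -> R[i])) :
  orthonormal_basis B <-> orthonormal nu B /\ total nu B.
Proof.
split=> [[B1 B2 B3]|[[B1 B2] B3]].
  split; first by split => [e /B1/L2E//|]; exact: B2.
  by move=> f /L2E f2 fB; apply/l2norm_eq0; apply: B3.
split => [e /B1/L2E//||f /L2E f2 fB]; first exact: B2.
by apply/l2norm_eq0; apply: B3.
Qed.

Lemma onbP : orthonormal nu (@onb R n) /\ total nu (@onb R n).
Proof.
apply/orthonormal_basisE; rewrite /onb; case: xgetP => [B -> //|H].
by have [B /orthonormal_basisE oB] := exists_orthonormal_total nu; case: (H B).
Qed.

Lemma cmeasurable_lebesgueRn (f : Rn -> R[i]) : cmeasurable f ->
  cmeasurable (f : Ln -> R[i]).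
Proof. by move=> [mr mi]; split; exact: measurable_fun_lebesgueRn. Qed.

Lemma cint_lebesgue (f : Rn -> R[i]) : cmeasurable f -> cint nu f = cint L f.
Proof.
move=> [mr mi]; rewrite /cint /Rintegral.
rewrite (integral_lebesgue (f := fun x => (complex.Re (f x))%:E)); last exact/measurable_EFinP.
by rewrite (integral_lebesgue (f := fun x => (complex.Im (f x))%:E))//; exact/measurable_EFinP.
Qed.

Lemma sq_lebesgue (f : Rn -> R[i]) : cmeasurable f -> sq nu f = sq L f.
Proof.
move=> mf; rewrite /sq (integral_lebesgue (f := fun x => (sqn (f x))%:E))//.
by apply/measurable_EFinP; exact: cmeasurable_sqn.
Qed.

Lemma cL2_lebesgue (f : Rn -> R[i]) : cL2 L f -> cL2 nu f.
Proof.
move=> [mf foo]; split; first exact: cmeasurable_lebesgueRn.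
by rewrite sq_lebesgue.
Qed.

Lemma complex_representative f : cmeasurable f ->
  exists2 g : Rn -> R[i], cmeasurable g & {ae nu, forall x, f x = g x}.
Proof.
move=> [/borel_representative[gr [Nr [mgr mNr Nr0 Er]]]].
move=> /borel_representative[gi [Ni [mgi mNi Ni0 Ei]]].
exists (fun x => gr x +i* gi x) => //.
apply: (@lebesgue_null _ _ (Nr `|` Ni)); first exact: measurableU.
  by rewrite null_set_setU.
by move=> x /not_orP[/Er rx /Ei ix]; apply: complex_eq.
Qed.

Lemma cL2_representative f : cL2 nu f ->
  exists2 g : Rn -> R[i], cL2 L g & {ae nu, forall x, f x = g x}.
Proof.
move=> [mf foo]; have [g mg fg] := complex_representative mf.
exists g => //; split=> //; rewrite -sq_lebesgue//.
by rewrite -(ae_eq_sq mf (cmeasurable_lebesgueRn mg) fg).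
Qed.

Lemma ip_representative f g (f' g' : Rn -> R[i]) : cmeasurable f -> cmeasurable g ->
  cmeasurable f' -> cmeasurable g' ->
  {ae nu, forall x, f x = f' x} -> {ae nu, forall x, g x = g' x} -> ip nu f g = ip L f' g'.
Proof.
move=> mf mg mf' mg' ff' gg'.
rewrite /ip -cint_lebesgue; last by apply: cmeasurableM => //; exact: cmeasurableJ.
apply: ae_eq_cint.
- exact: (cmeasurableM mf (cmeasurableJ mg)).
- exact: (cmeasurable_lebesgueRn (cmeasurableM mf' (cmeasurableJ mg'))).
- by apply: filterS2 ff' gg' => x -> ->.
Qed.

End lebesgue_L2.

Section expi.
Context (R : realType).
Local Open Scope complex_scope.
Implicit Types s t : R.

Lemma expiD s t : expi (s + t) = expi s * expi t.
Proof.
by apply: complex_eq; rewrite !ReImE /= ?cosD ?sinD //; ring.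
Qed.

Lemma expiN t : expi (- t) = ((expi t)^*)%R.
Proof. by rewrite /expi cosN sinN. Qed.

Lemma sqn_expi t : sqn (expi t) = 1.
Proof. by rewrite /sqn /= cos2Dsin2. Qed.

Lemma sqn_real (a : R) : sqn a%:C = a ^+ 2.
Proof. by rewrite /sqn/= expr0n/= addr0. Qed.

Lemma cmeasurable_expi d (T : measurableType d) (f : T -> R) :
  measurable_fun setT f -> cmeasurable (fun x => expi (f x)).
Proof.
move=> mf; split => /=.
  by apply: (measurableT_comp _ mf); apply: continuous_measurable_fun; exact: continuous_cos.
by apply: (measurableT_comp _ mf); apply: continuous_measurable_fun; exact: continuous_sin.
Qed.

Lemma cmeasurable_real d (T : measurableType d) (f : T -> R) :
  measurable_fun setT f -> cmeasurable (fun x => (f x)%:C).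
Proof. by move=> mf; split => //; exact: measurable_cst. Qed.

End expi.

Section gaussian_fourier.
Context (R : realType).
Local Open Scope complex_scope.
Variable a : R.
Hypothesis a0 : 0 < a.

Lemma ge0_integral_opp1 (f : R -> \bar R) :
  measurable_fun [set: _] f -> (forall x, 0 <= f x)%E ->
  (\int[lebesgue_measure]_x f (- x)%R = \int[lebesgue_measure]_x f x)%E.
Proof.
move=> mf f0.
have mN : measurable_fun setT (-%R : measurableTypeR R -> measurableTypeR R).
  exact: measurable_funN.
have H : forall y, y \in [set: measurableTypeR R] -> (0 <= f y)%E by move=> y _; exact: f0.
have := @ge0_integral_pushforward _ _ _ _ R _ mN lebesgue_measure setT f measurableT mf H.
rewrite preimage_setT => <-.
by apply: eq_measure_integral => A mA _; exact: lebesgue_measureN.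
Qed.

Lemma Rintegral_odd (f : R -> R) : lebesgue_measure.-integrable setT (EFin \o f) ->
  (forall x, f (- x) = - f x) -> \int[lebesgue_measure]_x f x = 0.
Proof.
move=> iF fN; have mf := measurable_int _ iF.
have H : \int[lebesgue_measure]_x f x = \int[lebesgue_measure]_x (- f x).
  under [RHS]eq_Rintegral do rewrite -fN.
  rewrite /Rintegral; congr fine.
  rewrite integralE [RHS]integralE.
  rewrite -(ge0_integral_opp1 (measurable_funepos mf)); last exact: funepos_ge0.
  rewrite -(ge0_integral_opp1 (measurable_funeneg mf)); last exact: funeneg_ge0.
  by congr (_ - _)%E; apply: eq_integral => x _; rewrite ?funeposE ?funenegE.
have H2 : \int[lebesgue_measure]_x (- f x) = - \int[lebesgue_measure]_x f x.
  by under eq_Rintegral do rewrite -mulN1r; rewrite RintegralZl// mulN1r.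
by move: H; rewrite H2; move: (Rintegral _ _ _) => t; lra.
Qed.

Definition gauss_wave n (eta : 'rV[R]_n) (x : 'rV[R]_n) : R[i] :=
  (expR (- (a * dotprod x x)))%:C * expi (dotprod eta x).

Lemma cint_gauss_wave1 s :
  cintegrable lebesgue_measure (fun x : R => (expR (- (a * (x * x))))%:C * expi (s * x)) /\
  cint lebesgue_measure (fun x : R => (expR (- (a * (x * x))))%:C * expi (s * x)) =
  (Num.sqrt (pi / a) * expR (- (s * s / (4 * a))))%:C.
Proof.
have iC := integrable_gauss_cos a0 s; have iS := integrable_gauss_sin a0 s.
split; first by split; under eq_fun do rewrite ?ReZ ?ImZ.
apply: complex_eq => /=.
  under eq_Rintegral do rewrite mul0r subr0.
  by rewrite [LHS](gauss_cosE a0) expr2.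
under eq_Rintegral do rewrite mul0r addr0.
by apply: (Rintegral_odd iS) => x; rewrite mulrNN (mulrN s) sinN mulrN.
Qed.

(** Both the Gaussian and the character factor over the coordinates, so the dimension is raised by
    [cint_tensor]. *)
Lemma cint_gauss_wave n (eta : 'rV[R]_n) :
  cintegrable (borel_lebesgue R n) (gauss_wave eta) /\
  cint (borel_lebesgue R n) (gauss_wave eta) =
  (Num.sqrt (pi / a) ^+ n * expR (- (dotprod eta eta / (4 * a))))%:C.
Proof.
have mwave k (e : 'rV[R]_k) : cmeasurable (gauss_wave e : borelRn R k -> _).
  apply: cmeasurableM.
    apply: cmeasurable_real; have := @measurable_gaussianRn R k a 0.
    by under eq_fun do rewrite subr0.
  apply: cmeasurable_expi; exact: measurable_fun_dotprod.
elim: n eta => [|n IH] eta.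
  have -> : gauss_wave eta = fun=> 1.
    apply/funext => x; rewrite /gauss_wave /dotprod !big_ord0 mulr0 oppr0 expR0.
    by rewrite /expi cos0 sin0 mul1r.
  have LT : borel_lebesgue R 0 setT = 1%E by rewrite /= diracT.
  have E (c : R) : \int[borel_lebesgue R 0]_x c = c.
    rewrite /Rintegral (eq_integral (cst c%:E))// integral_cst//.
    by rewrite [X in (_ * X)%E]LT mule1.
  have C1 : cmeasurable (fun _ : borelRn R 0 => 1 : R[i]) by exact: cmeasurable_cst.
  split.
    apply: cintegrable_cabs => //.
    rewrite (eq_integral (cst (cabs (1 : R[i]))%:E))// integral_cst//.
    by rewrite [X in (_ * X)%E]LT mule1 ltry.
  by rewrite /cint !E /dotprod !big_ord0 expr0 mul0r oppr0 expR0 mulr1.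
rewrite (consRnE eta); case: (unconsRn eta) => e1 e2 {eta}.
pose eta := consRn (e1, e2); rewrite -/eta.
pose w (p : measurableTypeR R * borelRn R n) := gauss_wave eta (consRn p).
have wE : w = fun p => ((expR (- (a * (p.1 * p.1))))%:C * expi (e1 * p.1)) * gauss_wave e2 p.2.
  apply/funext => -[t x]; rewrite /w /gauss_wave /eta !dotprod_consRn expiD.
  rewrite mulrDr opprD expRD rmorphM/=.
  by rewrite -!mulrA; congr (_ * _); rewrite mulrCA.
have [i1 E1] := cint_gauss_wave1 e1.
have [i2 E2] := IH e2.
have [iw Ew] := cint_tensor i1 i2.
have {}Ew : cint (lebesgue_measure \x borel_lebesgue R n)%E w =
    (Num.sqrt (pi / a) ^+ n.+1 * expR (- (dotprod eta eta / (4 * a))))%:C.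
  rewrite wE Ew E1 E2 -rmorphM/=; congr (_%:C).
  rewrite /eta dotprod_consRn (mulrDl (e1 * e1)) opprD expRD exprS; ring.
rewrite -wE in iw.
have [mr mi] := mwave _ eta; have [ir ii] := iw.
have P (f : borelRn R n.+1 -> R) : measurable_fun setT f ->
  (lebesgue_measure \x borel_lebesgue R n)%E.-integrable setT (EFin \o (f \o @consRn R n)) ->
  (borel_lebesgue R n.+1).-integrable setT (EFin \o f) /\
  \int[borel_lebesgue R n.+1]_x f x = \int[(lebesgue_measure \x borel_lebesgue R n)%E]_p f (consRn p).
  move=> /measurable_EFinP mf fi.
  have mc := @measurable_consRn R n.
  split; first exact: (integrable_pushforward mc mf fi).
  by rewrite /Rintegral; congr fine; exact: (integral_pushforward mc mf fi).
have [jr Er] := P _ mr ir; have [ji Ei] := P _ mi ii.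
by split => //; rewrite -Ew; apply: complex_eq.
Qed.

End gaussian_fourier.

(** * The short-time Fourier transform *)

Section translate_cint.
Context (R : realType) (n : nat).
Local Notation Rn := (borelRn R n).
Local Notation L := (borel_lebesgue R n).

Lemma cint_translate (f : Rn -> R[i]) (t : 'rV[R]_n) : cintegrable L f ->
  cintegrable L (fun x : Rn => f (x + t)) /\ cint L (fun x : Rn => f (x + t)) = cint L f.
Proof.
have P (u : Rn -> R) : L.-integrable setT (EFin \o u) ->
    L.-integrable setT (EFin \o (fun x : Rn => u (x + t))) /\
    \int[L]_x u (x + t) = \int[L]_x u x.
  move=> iu; have mu := measurable_int _ iu; split.
    apply/integrableP; split.
      exact: (measurableT_comp mu (measurable_borelRn_translate t)).
    rewrite (ge0_integral_translate t (f := fun x => `|(u x)%:E|%E))//.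
      by have /integrableP[] := iu.
    exact: measurableT_comp.
  rewrite /Rintegral; congr fine.
  rewrite integralE [RHS]integralE.
  rewrite -(ge0_integral_translate t (measurable_funepos mu)); last exact: funepos_ge0.
  rewrite -(ge0_integral_translate t (measurable_funeneg mu)); last exact: funeneg_ge0.
  by congr (_ - _)%E; apply: eq_integral => x _; rewrite ?funeposE ?funenegE.
by move=> [/P[ir Er] /P[ii Ei]]; split => //; exact: complex_eq.
Qed.

End translate_cint.

Section psi.
Context (R : realType) (d : nat).
Local Open Scope complex_scope.
Local Notation X := (borelRn R d).
Local Notation Z := (borelRn R (d + d)).
Local Notation L := (borel_lebesgue R d).

(* [stft f z] is the integral of [f y * psi (y, z)]. *)
Definition psi (p : X * Z) : R[i] :=
  ((gaussian ((p.1 : 'rV[R]_d) - lsubmx (p.2 : 'rV[R]_(d + d))))%:C)^* *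
  expi (- (2 * pi * dotprod (rsubmx (p.2 : 'rV[R]_(d + d))) (p.1 : 'rV[R]_d))).

Lemma conjC_real (r : R) : ((r%:C)^*)%R = r%:C :> R[i].
Proof. by apply: complex_eq => //=; rewrite oppr0. Qed.

Lemma psiE (y : X) (z : Z) : psi (y, z) =
  (gaussian ((y : 'rV[R]_d) - lsubmx (z : 'rV[R]_(d + d))))%:C *
  expi (- (2 * pi * dotprod (rsubmx (z : 'rV[R]_(d + d))) (y : 'rV[R]_d))).
Proof. by rewrite /psi conjC_real. Qed.

Let G0 : R := 2 `^ (d%:R / 4).

Let G0_gt0 : 0 < G0. Proof. by rewrite powR_gt0. Qed.

Lemma gaussianE (x : 'rV[R]_d) : gaussian x = G0 * expR (- (pi * dotprod x x)).
Proof. by rewrite /gaussian sqr_enorm mulNr. Qed.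

Lemma gaussian_le (x : 'rV[R]_d) : gaussian x <= G0.
Proof.
rewrite gaussianE ler_piMr ?(ltW G0_gt0)// -expR0 ler_expR oppr_le0.
by rewrite mulr_ge0 ?pi_ge0 ?dotprod_ge0.
Qed.

(** The factor 2^(d/4) of the window makes its L^2 norm 1: the second factor is the integral of exp
    (- 2 pi |x|^2). *)
Let G0_normalization : G0 ^+ 2 * Num.sqrt (pi / (2 * pi)) ^+ d = 1 :> R.
Proof.
have p0 := pi_gt0 R.
have -> : pi / (2 * pi) = 2^-1 :> R by rewrite invfM mulrCA divff ?mulr1 ?gt_eqF.
have -> : G0 ^+ 2 = Num.sqrt 2 ^+ d :> R.
  rewrite -powR12_sqrt// -powR_mulrn ?powR_ge0// -powRrM.
  rewrite -powR_mulrn ?powR_ge0// -powRrM; congr (_ `^ _); by field.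
by rewrite -exprMn -sqrtrM// divff ?gt_eqF// sqrtr1 expr1n.
Qed.

Lemma sqn_psi p : sqn (psi p) = gaussian ((p.1 : 'rV[R]_d) - lsubmx (p.2 : 'rV[R]_(d + d))) ^+ 2.
Proof. by rewrite /psi sqnM sqn_expi mulr1 sqnJ sqn_real. Qed.

Lemma cmeasurable_psi : cmeasurable psi.
Proof.
have m1 : measurable_fun setT (fun p : X * Z => p.1 : borelRn R d) by exact: measurable_fst.
have m2 : measurable_fun setT (fun p : X * Z => lsubmx (p.2 : 'rV[R]_(d + d)) : borelRn R d).
  by apply: measurable_fun_lsubmx; exact: measurable_snd.
have m3 : measurable_fun setT (fun p : X * Z => rsubmx (p.2 : 'rV[R]_(d + d)) : borelRn R d).
  by apply: measurable_fun_rsubmx; exact: measurable_snd.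
apply: cmeasurableM.
  apply: cmeasurableJ; apply: cmeasurable_real; under eq_fun do rewrite gaussianE.
  apply: measurable_funM => //; apply: measurable_fun_expR; apply: measurable_funN.
  by apply: measurable_funM => //; apply: measurable_fun_dotprod; exact: measurable_borelRnB.
apply: cmeasurable_expi; apply: measurable_funN; apply: measurable_funM => //.
exact: measurable_fun_dotprod.
Qed.

Lemma cmeasurable_psi_slice z : cmeasurable (fun y : X => psi (y, z)).
Proof. exact: (cmeasurable_comp cmeasurable_psi (pair2_measurable z)). Qed.

Lemma cmeasurable_psi_at (x : X) : cmeasurable (fun z : Z => psi (x, z)).
Proof. exact: (cmeasurable_comp cmeasurable_psi (pair1_measurable x)). Qed.

Lemma sq_psi z : sq L (fun y : X => psi (y, z)) = 1%E.
Proof.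
rewrite /sq; under eq_integral do rewrite sqn_psi /=.
have mg : measurable_fun setT (fun x : X => expR (- (2 * pi * dotprod (x : 'rV[R]_d) x))).
  by have := @measurable_gaussianRn R d (2 * pi) 0; under eq_fun do rewrite subr0.
pose h (x : X) := (G0 ^+ 2 * expR (- (2 * pi * dotprod (x : 'rV[R]_d) x)))%:E.
rewrite (eq_integral (fun x : X => h (x - lsubmx (z : 'rV[R]_(d + d))))); last first.
  move=> x _; rewrite gaussianE /h exprMn; congr (_ * _)%:E.
  by rewrite -expRM_natl; congr expR; ring.
rewrite (ge0_integral_translate (- lsubmx (z : 'rV[R]_(d + d))) (f := h)); last 2 first.
- by apply/measurable_EFinP; exact: measurable_funM.
- by move=> x; rewrite lee_fin mulr_ge0 ?sqr_ge0 ?expR_ge0.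
rewrite /h; under eq_integral do rewrite EFinM.
rewrite ge0_integralZl ?lee_fin ?sqr_ge0//; last exact/measurable_EFinP.
rewrite ge0_integral_gaussRn ?mulr_gt0 ?pi_gt0// -EFinM.
by rewrite G0_normalization.
Qed.

Lemma dotprod_row (z w : 'rV[R]_(d + d)) :
  dotprod z w = dotprod (lsubmx z) (lsubmx w) + dotprod (rsubmx z) (rsubmx w).
Proof.
by rewrite /dotprod big_split_ord/=; congr (_ + _); apply: eq_bigr => i _; rewrite !mxE.
Qed.

(** The product of two shifted Gaussians is a Gaussian about the midpoint of the shifts, times a
    constant; the phases combine into one character and a constant of modulus 1. Its Fourier
    transform accounts for the frequency difference, the constant for the position difference. *)
Lemma sqn_gram (z w : Z) :
  sqn (cint L (fun y : X => (psi (y, z))^* * psi (y, w))) = expR (- (pi * dist2 z w)).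
Proof.
have p0 := pi_gt0 R.
pose a : 'rV[R]_d := lsubmx (z : 'rV[R]_(d + d)); pose b : 'rV[R]_d := lsubmx (w : 'rV[R]_(d + d)).
pose oz : 'rV[R]_d := rsubmx (z : 'rV[R]_(d + d)); pose ow : 'rV[R]_d := rsubmx (w : 'rV[R]_(d + d)).
(* Midpoint and half difference of the positions: |x - e|^2 + |x + e|^2 = 2 |x|^2 + 2 |e|^2 has no
   cross term. *)
pose c := 2^-1 *: (a + b); pose e := 2^-1 *: (a - b); pose eta := (2 * pi) *: (oz - ow).
have aE : a = c + e by apply/rowP => i; rewrite !mxE; field.
have bE : b = c - e by apply/rowP => i; rewrite !mxE; field.
have tp0 : 0 < 2 * pi :> R by rewrite mulr_gt0.
have [iw Ew] := @cint_gauss_wave R (2 * pi) tp0 d eta.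
have [it Et] := cint_translate (- c) iw.
pose C := G0 ^+ 2 * expR (- (2 * pi * dotprod e e)).
have E (y : X) : (psi (y, z))^* * psi (y, w) =
    (C%:C * expi (dotprod eta c)) * gauss_wave (2 * pi) eta ((y : 'rV[R]_d) - c).
  rewrite !psiE -/a -/b -/oz -/ow rmorphM/= conjC_real -expiN opprK.
  set x : 'rV[R]_d := y - c.
  have -> : y - a = x - e by rewrite aE opprD addrA.
  have -> : y - b = x + e by rewrite bE opprB /x -addrA (addrC e).
  have Ey : (y : 'rV[R]_d) = x + c by rewrite /x subrK.
  rewrite /gauss_wave mulrACA [RHS]mulrACA -!expiD -!(rmorphM (real_complex R)).
  congr (_%:C * expi _).
    rewrite !gaussianE /C mulrACA -expr2 -[RHS]mulrA -!expRD; congr (_ * expR _).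
    rewrite !dotprodE; ring.
  rewrite [in LHS]Ey /eta !dotprodE; ring.
rewrite (eq_cint _ E) cintZ// Et Ew !sqnM sqn_expi !sqn_real mulr1 /C.
have -> : (G0 ^+ 2 * expR (- (2 * pi * dotprod e e))) ^+ 2 *
  (Num.sqrt (pi / (2 * pi)) ^+ d * expR (- (dotprod eta eta / (4 * (2 * pi))))) ^+ 2 =
  (G0 ^+ 2 * Num.sqrt (pi / (2 * pi)) ^+ d) ^+ 2 *
  expR (- (2 * pi * dotprod e e)) ^+ 2 * expR (- (dotprod eta eta / (4 * (2 * pi)))) ^+ 2 by ring.
rewrite G0_normalization expr1n mul1r -!expRM_natl -expRD; congr expR.
have lB : lsubmx ((z : 'rV[R]_(d + d)) - w) = a - b by apply/rowP => i; rewrite !mxE.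
have rB : rsubmx ((z : 'rV[R]_(d + d)) - w) = oz - ow by apply/rowP => i; rewrite !mxE.
rewrite /dist2 dotprod_row lB rB /e /eta !dotprodE.
move: p0; move: (pi : R) => q q0.
by field; exact: lt0r_neq0.
Qed.

End psi.

Section cabs_sqn.
Context (R : realType).
Local Open Scope complex_scope.

Lemma cabs_mul_sqn (z w : R[i]) : cabs (z * w) <= sqn z + sqn w.
Proof.
apply: (le_trans (cabsM_le _ _)).
have H (v : R[i]) : cabs v ^+ 2 <= 2 * sqn v.
  rewrite /cabs /sqn -(real_normK (num_real (complex.Re v))) -(real_normK (num_real (complex.Im v))).
  by have := sqr_ge0 (`|complex.Re v| - `|complex.Im v|); nra.
by have := sqr_ge0 (cabs z - cabs w); have := H z; have := H w; nra.
Qed.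

Lemma cabs_real (r : R) : 0 <= r -> cabs (r%:C) = r.
Proof. by move=> r0; rewrite /cabs/= normr0 addr0 ger0_norm. Qed.

Lemma sqnCJ (z : R[i]) : sqn ((z^*)%R) = sqn z. Proof. exact: sqnJ. Qed.

End cabs_sqn.

(** * The integral kernel of the localization operator *)

Section stft_kernel.
Context (R : realType) (d : nat).
Local Open Scope complex_scope.
Local Notation X := (borelRn R d).
Local Notation Z := (borelRn R (d + d)).
Local Notation L := (borel_lebesgue R d).
Local Notation LZ := (borel_lebesgue R (d + d)).
Variable Om : set Z.
Hypothesis mOm : measurable Om.
Hypothesis Omoo : (LZ Om < +oo)%E.

Let chi (z : Z) : R := \1_Om z.

Let chi0 z : 0 <= chi z. Proof. by rewrite /chi indicE. Qed.
Let mchi : measurable_fun setT chi. Proof. exact: measurable_indic. Qed.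
Let chi2 z : chi z * chi z = chi z.
Proof. by rewrite /chi indicE; case: (z \in Om); rewrite /= ?mulr1 ?mulr0. Qed.
Let chiE : (\int[LZ]_z (chi z)%:E)%E = LZ Om.
Proof. by rewrite /chi integral_indic// setIT. Qed.
Let chioo : (\int[LZ]_z (chi z)%:E < +oo)%E. Proof. by rewrite chiE. Qed.

Definition coherent (z : Z) (y : X) : R[i] := ((psi (y, z))^*)%R.

Lemma cL2_coherent z : cL2 L (coherent z).
Proof.
split; first by apply: cmeasurableJ; exact: cmeasurable_psi_slice.
rewrite /sq; under eq_integral do rewrite sqnCJ.
by rewrite [X in (X < _)%E](sq_psi z) ltry.
Qed.

Lemma sq_coherent z : sq L (coherent z) = 1%E.
Proof. by rewrite /sq; under eq_integral do rewrite sqnCJ; exact: sq_psi. Qed.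

(** The short-time Fourier transform of a Borel function, with the Borel integral; [stftE] relates
    it to [stft]. *)
Definition transform (f : X -> R[i]) (z : Z) : R[i] := cint L (fun y : X => f y * psi (y, z)).

Lemma transformE f z : transform f z = ip L f (coherent z).
Proof. by apply: eq_cint => y; rewrite /coherent conjCK. Qed.

Lemma sqn_transform_le f z : cL2 L f -> sqn (transform f z) <= fine (sq L f).
Proof.
move=> L2f; rewrite transformE; apply: (le_trans (cauchy_schwarz L2f (cL2_coherent z))).
by rewrite sq_coherent mulr1.
Qed.

Lemma cmeasurable_transform f : cmeasurable f -> cmeasurable (transform f).
Proof.
move=> mf; apply: (@cmeasurable_cint _ _ Z X R L (fun p : Z * X => f p.2 * psi (p.2, p.1))).
have ms : measurable_fun setT (fun p : Z * X => (p.2, p.1)).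
  by apply: measurable_fun_pair; [exact: measurable_snd|exact: measurable_fst].
apply: cmeasurableM; first exact: cmeasurable_snd.
exact: (cmeasurable_comp (cmeasurable_psi R d) ms).
Qed.

(* The operator [V^* chi_Om] applied to [u]. *)
Definition synthesis (u : Z -> R[i]) (x : X) : R[i] :=
  cint LZ (fun z => (chi z)%:C * ((psi (x, z))^* * u z)%R).

Definition ckernel (p : X * X) : R[i] :=
  cint LZ (fun z => (chi z)%:C * ((psi (p.1, z))^* * psi (p.2, z))%R).

(** Conjugated so that the operator at x is the inner product with [kappa x], to which Parseval's
    identity applies. *)
Definition kappa (x y : X) : R[i] := ((ckernel (x, y))^*)%R.

Lemma cabs_psi : exists2 M : R, 0 <= M & forall p : X * Z, cabs (psi p) <= M.
Proof.
exists (2 * (2 `^ (d%:R / 4))); first by rewrite mulr_ge0 ?powR_ge0.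
move=> p; apply: cabs_sqn_le; first exact: powR_ge0.
rewrite sqn_psi ler_sqr ?nnegrE ?powR_ge0 ?gaussian_le//.
by rewrite gaussianE mulr_ge0 ?powR_ge0 ?expR_ge0.
Qed.

Lemma cabs_conjC (z : R[i]) : cabs ((z^*)%R) = cabs z.
Proof. by case: z => a b; rewrite /cabs/= normrN. Qed.

Let dom (f : X -> R[i]) (p : X * Z) : R := sqn (f p.1) + sqn (psi p).

Let mdom f : cmeasurable f -> measurable_fun setT (dom f).
Proof.
move=> mf; apply: measurable_funD.
  by apply: (cmeasurable_sqn (f := fun p : X * Z => f p.1)); exact: cmeasurable_fst.
by apply: cmeasurable_sqn; exact: cmeasurable_psi.
Qed.

Let domC f z : cL2 L f -> (\int[L]_x (dom f (x, z))%:E <= (fine (sq L f) + 1)%:E)%E.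
Proof.
move=> L2f; rewrite /dom /=; under eq_integral do rewrite EFinD.
rewrite ge0_integralD//; last 4 first.
- by move=> x _; rewrite lee_fin sqn_ge0.
- by apply/measurable_EFinP; apply: cmeasurable_sqn; case: L2f.
- by move=> x _; rewrite lee_fin sqn_ge0.
- by apply/measurable_EFinP; apply: cmeasurable_sqn; exact: cmeasurable_psi_slice.
by rewrite [X in (_ + X)%E](sq_psi z) EFinD sq_fin.
Qed.

(** The exchange of integrals behind both [synthesis_transform] and [ip_synthesis]. The product f
    psi is dominated by |f|^2 + |psi|^2, whose integral in y does not depend on z, and [Om] has
    finite measure. *)
Lemma transform_fubini f w M : cL2 L f -> cmeasurable w -> (forall z, cabs (w z) <= M) ->
  cintegrable L (fun x => cint LZ (fun z => (chi z)%:C * (w z * (f x * psi (x, z))))) /\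
  cint L (fun x => cint LZ (fun z => (chi z)%:C * (w z * (f x * psi (x, z))))) =
  cint LZ (fun z => (chi z)%:C * (w z * transform f z)).
Proof.
move=> L2f mw wM; have mf : cmeasurable f by case: L2f.
apply: (@weighted_fubini _ _ X Z R L LZ (fun p => f p.1 * psi p) (dom f) w chi
  (fine (sq L f) + 1) M) => //.
- by apply: cmeasurableM; [exact: cmeasurable_fst|exact: cmeasurable_psi].
- exact: mdom.
- by move=> p; exact: cabs_mul_sqn.
- by move=> z; exact: domC.
Qed.

Lemma cintegrable_chi w M : cmeasurable w -> (forall z, cabs (w z) <= M) ->
  cintegrable LZ (fun z => (chi z)%:C * w z).
Proof.
move=> mw wM; apply: cintegrable_cabs.
  by apply: cmeasurableM => //; exact: cmeasurable_real.
apply: (@le_lt_trans _ _ (\int[LZ]_z (`|M|%:E * (chi z)%:E))%E).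
  apply: ge0_le_integral => //.
  - by move=> z _; rewrite lee_fin cabs_ge0.
  - apply/measurable_EFinP; apply: measurable_cabs.
    by apply: cmeasurableM => //; exact: cmeasurable_real.
  - by apply: emeasurable_funM => //; exact/measurable_EFinP.
  - move=> z _; rewrite -EFinM lee_fin mulrC; apply: (le_trans (cabsM_le _ _)).
    rewrite cabs_real// ler_wpM2r//; exact: le_trans (wM z) (ler_norm _).
rewrite ge0_integralZl//; [|exact/measurable_EFinP|by move=> ? _; rewrite lee_fin].
by rewrite chiE lte_mul_pinfty.
Qed.

Lemma synthesis_transform f x : cL2 L f -> synthesis (transform f) x = ip L f (kappa x).
Proof.
move=> L2f; have [M M0 HM] := cabs_psi.
have mw : cmeasurable (fun z : Z => ((psi (x, z))^*)%R) by apply: cmeasurableJ; exact: cmeasurable_psi_at.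
have wM (z : Z) : cabs ((psi (x, z))^*)%R <= M by rewrite cabs_conjC.
have [_ H] := transform_fubini L2f mw wM.
rewrite /synthesis -[LHS]H; apply: eq_cint => y.
rewrite /kappa conjCK /ckernel -cintZ; first by apply: eq_cint => z /=; ring.
apply: (@cintegrable_chi _ (M * M)).
  by apply: cmeasurableM => //; exact: cmeasurable_psi_at.
move=> z; apply: (le_trans (cabsM_le _ _)).
by apply: ler_pM => //; exact: cabs_ge0.
Qed.

Lemma cmeasurable_synthesis u : cmeasurable u -> cmeasurable (synthesis u).
Proof.
move=> mu; apply: (@cmeasurable_cint _ _ X Z R LZ
  (fun p : X * Z => (chi p.2)%:C * ((psi p)^* * u p.2)%R)).
apply: cmeasurableM.
  by apply: cmeasurable_real; exact: (measurableT_comp mchi measurable_snd).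
by apply: cmeasurableM; [apply: cmeasurableJ; exact: cmeasurable_psi|exact: cmeasurable_snd].
Qed.

Lemma cmeasurable_ckernel : cmeasurable ckernel.
Proof.
have m13 : measurable_fun setT (fun p : (X * X) * Z => (p.1.1, p.2)).
  apply: measurable_fun_pair; last exact: measurable_snd.
  exact: (measurableT_comp measurable_fst measurable_fst).
have m23 : measurable_fun setT (fun p : (X * X) * Z => (p.1.2, p.2)).
  apply: measurable_fun_pair; last exact: measurable_snd.
  exact: (measurableT_comp measurable_snd measurable_fst).
have mp := cmeasurable_psi R d.
apply: (@cmeasurable_cint _ _ _ Z R LZ (fun p : (X * X) * Z =>
  (chi p.2)%:C * ((psi (p.1.1, p.2))^* * psi (p.1.2, p.2))%R)).
apply: cmeasurableM.
  by apply: cmeasurable_real; exact: (measurableT_comp mchi measurable_snd).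
apply: cmeasurableM.
  by apply: cmeasurableJ; exact: (cmeasurable_comp mp m13).
exact: (cmeasurable_comp mp m23).
Qed.

Lemma cmeasurable_kappa x : cmeasurable (kappa x).
Proof.
by apply: cmeasurableJ; exact: (cmeasurable_comp cmeasurable_ckernel (pair1_measurable x)).
Qed.

(** The relation that characterizes [adjoint]; it makes the explicit integral a value of the
    localization operator. *)
Lemma ip_synthesis f g : cL2 L f -> cL2 L g ->
  ip L g (synthesis (transform f)) =
  cint LZ (fun z => transform g z * (((chi z)%:C * transform f z)^*)%R).
Proof.
move=> L2f L2g; have [M M0 HM] := cabs_psi.
have mT := cmeasurable_transform (proj1 L2f).
have mw : cmeasurable (fun z => ((transform f z)^*)%R) by exact: cmeasurableJ.
pose W := 2 * Num.sqrt (fine (sq L f)).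
have TW (z : Z) : cabs (transform f z) <= W.
  apply: cabs_sqn_le; first exact: sqrtr_ge0.
  by rewrite sqr_sqrtr ?fine_ge0 ?sq_ge0// sqn_transform_le.
have wW (z : Z) : cabs ((transform f z)^*)%R <= W by rewrite cabs_conjC.
have [_ H] := transform_fubini L2g mw wW.
rewrite [RHS](eq_cint _ (g := fun z => (chi z)%:C * (((transform f z)^*)%R * transform g z))); last first.
  by move=> z; rewrite rmorphM/= conjC_real; ring.
rewrite -H; apply: eq_cint => x.
rewrite /synthesis -[X in _ * X]cintJ; last first.
  apply: (@cintegrable_chi _ (M * W)).
    by apply: cmeasurableM => //; apply: cmeasurableJ; exact: cmeasurable_psi_at.
  move=> z; apply: (le_trans (cabsM_le _ _)).
  by apply: ler_pM => //; rewrite ?cabs_ge0 ?cabs_conjC.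
rewrite -cintZ; last first.
  apply: cintegrableJ; apply: (@cintegrable_chi _ (M * W)).
    by apply: cmeasurableM => //; apply: cmeasurableJ; exact: cmeasurable_psi_at.
  move=> z; apply: (le_trans (cabsM_le _ _)).
  by apply: ler_pM => //; rewrite ?cabs_ge0 ?cabs_conjC.
apply: eq_cint => z.
rewrite [X in _ * X](_ : _ = (((chi z)%:C * ((psi (x, z))^* * transform f z)%R)^*)%R)//.
by move: (psi (x, z)) => p; rewrite !rmorphM/= conjC_real conjCK; ring.
Qed.

End stft_kernel.

(** * The Hilbert-Schmidt norm as an energy *)

Section hilbert_schmidt.
Context (R : realType) (d : nat).
Local Open Scope complex_scope.
Local Notation X := (borelRn R d).
Local Notation Z := (borelRn R (d + d)).
Local Notation L := (borel_lebesgue R d).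
Local Notation LZ := (borel_lebesgue R (d + d)).

Definition gauss_kernel (t : R) : R := expR (- (pi * t)).

Lemma measurable_gauss_kernel : measurable_fun setT gauss_kernel.
Proof. by apply: measurable_fun_expR; apply: measurable_funN; exact: measurable_funM. Qed.

Variable Om : set Z.
Hypothesis mOm : measurable Om.
Hypothesis Omoo : (LZ Om < +oo)%E.

Let chi (z : Z) : R := \1_Om z.
Let chi0 z : 0 <= chi z. Proof. by rewrite /chi indicE. Qed.
Let mchi : measurable_fun setT chi. Proof. exact: measurable_indic. Qed.
Let chiE : (\int[LZ]_z (chi z)%:E)%E = LZ Om.
Proof. by rewrite /chi integral_indic// setIT. Qed.

Let A (p : X * (Z * Z)) : R[i] := ((psi (p.1, p.2.1))^* * psi (p.1, p.2.2))%R.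
Let a (p : X * (Z * Z)) : R := sqn (psi (p.1, p.2.1)) + sqn (psi (p.1, p.2.2)).
Let chi2 (q : Z * Z) : R := chi q.1 * chi q.2.

Let m1 : measurable_fun [set: X * (Z * Z)] (fun p => (p.1, p.2.1)).
Proof.
apply: measurable_fun_pair; first exact: measurable_fst.
exact: (measurableT_comp measurable_fst measurable_snd).
Qed.

Let m2 : measurable_fun [set: X * (Z * Z)] (fun p => (p.1, p.2.2)).
Proof.
apply: measurable_fun_pair; first exact: measurable_fst.
exact: (measurableT_comp measurable_snd measurable_snd).
Qed.

Let mpsi1 : cmeasurable (fun p : X * (Z * Z) => psi (p.1, p.2.1)).
Proof. exact: (cmeasurable_comp (cmeasurable_psi R d) m1). Qed.

Let mpsi2 : cmeasurable (fun p : X * (Z * Z) => psi (p.1, p.2.2)).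
Proof. exact: (cmeasurable_comp (cmeasurable_psi R d) m2). Qed.

Let mA : cmeasurable A. Proof. by apply: cmeasurableM => //; exact: cmeasurableJ. Qed.

Let ma : measurable_fun setT a.
Proof. by apply: measurable_funD; exact: cmeasurable_sqn. Qed.

Let mchi2 : measurable_fun setT chi2.
Proof.
apply: measurable_funM; first exact: (measurableT_comp mchi measurable_fst).
exact: (measurableT_comp mchi measurable_snd).
Qed.

Let Aa p : cabs (A p) <= a p.
Proof. by rewrite /A /a -[X in _ <= X + _]sqnCJ; exact: cabs_mul_sqn. Qed.

Let aC q : (\int[L]_x (a (x, q))%:E <= 2%:E)%E.
Proof.
rewrite /a /=; under eq_integral do rewrite EFinD.
rewrite ge0_integralD//; last 4 first.
- by move=> x _; rewrite lee_fin sqn_ge0.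
- by apply/measurable_EFinP; apply: cmeasurable_sqn; exact: cmeasurable_psi_slice.
- by move=> x _; rewrite lee_fin sqn_ge0.
- by apply/measurable_EFinP; apply: cmeasurable_sqn; exact: cmeasurable_psi_slice.
by rewrite [X in (X + _)%E](sq_psi q.1) [X in (_ + X)%E](sq_psi q.2) -EFinD.
Qed.

Let u (q : Z * Z) : R := chi2 q * gauss_kernel (dist2 (q.1 : 'rV[R]_(d + d)) q.2).

Let energyE : (\int[prod_measure LZ LZ]_q (u q)%:E = energy gauss_kernel Om Om)%E.
Proof.
have mk := measurable_gauss_kernel.
have k0 t : 0 <= gauss_kernel t by exact: expR_ge0.
rewrite (fubini_tonelli1 (m1 := LZ) (m2 := LZ)); last 2 first.
- apply/measurable_EFinP; apply: measurable_funM => //.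
  by apply: measurable_kernel; [|exact: measurable_fst|exact: measurable_snd].
- by move=> q; rewrite lee_fin !mulr_ge0.
apply: eq_integral => z _; rewrite /fubini_F /pot -ge0_integralZl//; last 2 first.
- apply/measurable_EFinP; apply: measurable_funM; last exact: measurable_indic.
  by apply: measurable_kernel.
- by move=> w _; rewrite lee_fin mulr_ge0.
by apply: eq_integral => w _; rewrite -EFinM /u /chi2 /= mulrAC mulrA.
Qed.

Let chi2oo : (\int[prod_measure LZ LZ]_q (chi2 q)%:E < +oo)%E.
Proof.
rewrite (fubini_tonelli1 (m1 := LZ) (m2 := LZ)); last 2 first.
- exact/measurable_EFinP.
- by move=> q; rewrite lee_fin mulr_ge0.
rewrite (eq_integral (fun z => LZ Om * (chi z)%:E)%E); last first.
  move=> z _; rewrite /fubini_F /chi2 /=; under eq_integral do rewrite EFinM.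
  rewrite ge0_integralZl//; [by rewrite chiE muleC|exact/measurable_EFinP|by move=> w _; rewrite lee_fin|by rewrite lee_fin].
rewrite ge0_integralZl//; [|exact/measurable_EFinP|by move=> w _; rewrite lee_fin].
by rewrite chiE lte_mul_pinfty// ge0_fin_numE.
Qed.

(** |K|^2 is K times its conjugate, hence a double integral over pairs of phase-space points. In
    this form [kernel_fubini] can integrate out both space variables. *)
Let inner_q (p : X * X) :
  cint (prod_measure LZ LZ) (fun q => (chi2 q)%:C * (A (p.1, q) * ((A (p.2, q))^*)%R)) =
  (sqn (ckernel Om p))%:C.
Proof.
have [M M0 HM] := cabs_psi R d.
have mpsi := @cmeasurable_psi_at R d.
pose F (z : Z) : R[i] := (chi z)%:C * ((psi (p.1, z))^* * psi (p.2, z))%R.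
have iF : cintegrable LZ F.
  apply: (@cintegrable_chi R d Om mOm Omoo (fun z => ((psi (p.1, z))^* * psi (p.2, z))%R) (M * M)).
    by apply: cmeasurableM => //; exact: cmeasurableJ.
  move=> z; apply: (le_trans (cabsM_le _ _)).
  by apply: ler_pM; rewrite ?cabs_ge0 ?cabs_conjC.
have [_ E] := cint_tensor iF (cintegrableJ iF).
have -> : (sqn (ckernel Om p))%:C = cint LZ F * cint LZ (fun z => ((F z)^*)%C).
  by rewrite cintJ// -sqnE.
rewrite -E; apply: eq_cint => q.
rewrite [X in _ = _ * X](_ : _ = (((F q.2)^*)%R))// /A /F /chi2 /=.
move: (psi (p.1, q.1)) (psi (p.2, q.1)) (psi (p.1, q.2)) (psi (p.2, q.2)) => p1 p2 p3 p4.
rewrite (rmorphM (real_complex R)) !rmorphM/= conjC_real !conjCK; ring.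
Qed.

Lemma integral_sq_kappa :
  (\int[L]_x sq L (kappa Om x) = energy gauss_kernel Om Om)%E.
Proof.
have mJA : cmeasurable (fun p => ((A p)^*)%R) by exact: cmeasurableJ.
have JAa p : cabs ((A p)^*)%R <= a p by rewrite cabs_conjC.
have chi20 q : 0 <= chi2 q by rewrite mulr_ge0.
have KI := @cintegrable_kernel_fubini _ _ X _ R L (prod_measure LZ LZ) A (fun p => ((A p)^*)%R)
  a a chi2 2 2 mA mJA ma ma Aa JAa mchi2 chi20 aC aC chi2oo.
have KF := @kernel_fubini _ _ X _ R L (prod_measure LZ LZ) A (fun p => ((A p)^*)%R)
  a a chi2 2 2 mA mJA ma ma Aa JAa mchi2 chi20 aC aC chi2oo.
have [[iK _] _ _] := cfubini KI.
have {}iK : (prod_measure L L).-integrable setT (EFin \o (fun p => sqn (ckernel Om p))).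
  move: iK; apply: eq_integrable => // p _.
  by congr EFin; have /(congr1 (@complex.Re _)) H := inner_q p; exact: H.
have uE q : (chi2 q)%:C * (cint L (fun x => A (x, q)) * cint L (fun x => ((A (x, q))^*)%R)) = (u q)%:C.
  have -> : cint L (fun x => ((A (x, q))^*)%R) = ((cint L (fun x => A (x, q)))^*)%C.
    rewrite -cintJ//.
    rewrite (_ : (fun x => A (x, q)) = fun x => coherent q.1 x * ((coherent q.2 x)^*)%R).
      by apply: cL2_mul; exact: cL2_coherent.
    by apply/funext => x; rewrite /coherent conjCK.
  rewrite -sqnE -(rmorphM (real_complex R)); congr (_%:C); rewrite /u /gauss_kernel -sqn_gram//.
have energyoo : energy gauss_kernel Om Om \is a fin_num.
  have k0 t : 0 <= gauss_kernel t by exact: expR_ge0.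
  have k1 t : 0 <= t -> gauss_kernel t <= 1.
    by move=> t0; rewrite -expR0 ler_expR oppr_le0 mulr_ge0 ?pi_ge0.
  by have [e ->] := energy_fin measurable_gauss_kernel k0 k1 mOm mOm Omoo Omoo.
transitivity (\int[prod_measure L L]_p (sqn (ckernel Om p))%:E)%E.
  rewrite (fubini_tonelli1 (m1 := L) (m2 := L)); last 2 first.
  - by apply/measurable_EFinP; apply: cmeasurable_sqn; exact: cmeasurable_ckernel.
  - by move=> p; rewrite lee_fin sqn_ge0.
  by apply: eq_integral => x _; apply: eq_integral => y _; rewrite sqnCJ.
rewrite -[LHS]fineK ?integrable_fin_num// -energyE -[RHS]fineK ?energyE//.
have := congr1 (@complex.Re R) KF.
by rewrite (eq_cint _ inner_q) (eq_cint _ uE) -energyE => H; congr EFin; exact: H.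
Qed.

Lemma measurable_sq_kappa : measurable_fun setT (fun x : X => sq L (kappa Om x)).
Proof.
apply: (@measurable_fun_fubini_tonelli_F _ _ X X R L (fun p => (sqn ((ckernel Om p)^*)%R)%:E)).
  by apply/measurable_EFinP; apply: cmeasurable_sqn; apply: cmeasurableJ; exact: cmeasurable_ckernel.
by move=> p; rewrite lee_fin sqn_ge0.
Qed.

Let energyoo : (energy gauss_kernel Om Om < +oo)%E.
Proof.
have k0 t : 0 <= gauss_kernel t by exact: expR_ge0.
have k1 t : 0 <= t -> gauss_kernel t <= 1.
  by move=> t0; rewrite -expR0 ler_expR oppr_le0 mulr_ge0 ?pi_ge0.
by have [e ->] := energy_fin measurable_gauss_kernel k0 k1 mOm mOm Omoo Omoo; rewrite ltry.
Qed.

Lemma ae_kappa : {ae L, forall x, (sq L (kappa Om x) < +oo)%E}.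
Proof.
have H : L.-integrable setT (fun x : X => sq L (kappa Om x)).
  apply/integrableP; split; first exact: measurable_sq_kappa.
  under eq_integral do rewrite gee0_abs ?sq_ge0//.
  by rewrite integral_sq_kappa.
by apply: filterS (integrable_ae measurableT H) => x /(_ I); rewrite ge0_fin_numE ?sq_ge0.
Qed.

Lemma cL2_kappa x : (sq L (kappa Om x) < +oo)%E -> cL2 L (kappa Om x).
Proof. by split => //; exact: cmeasurable_kappa. Qed.

Lemma cL2_synthesis f : cL2 L f -> cL2 L (synthesis Om (transform f)).
Proof.
move=> L2f; have mS : cmeasurable (synthesis Om (transform f)).
  by apply: cmeasurable_synthesis => //; apply: cmeasurable_transform; case: L2f.
split => //.
have f0 : 0 <= fine (sq L f) by rewrite fine_ge0 ?sq_ge0.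
(* The added 1 makes the bound +oo where [kappa] has infinite norm, even if f is null. *)
apply: (@le_lt_trans _ _ (\int[L]_x ((fine (sq L f) + 1)%:E * sq L (kappa Om x)))%E).
  apply: ge0_le_integral => //.
  - by move=> x _; rewrite lee_fin sqn_ge0.
  - by apply/measurable_EFinP; exact: cmeasurable_sqn.
  - by apply: emeasurable_funM => //; exact: measurable_sq_kappa.
  - move=> x _; have [koo|] := boolP (sq L (kappa Om x) < +oo)%E; last first.
      rewrite ltey negbK => /eqP ->; rewrite gt0_muley ?leey// lte_fin.
      by rewrite ltr_wpDl.
    rewrite synthesis_transform// -(sq_fin (cL2_kappa koo)) -EFinM lee_fin.
    apply: (le_trans (cauchy_schwarz L2f (cL2_kappa koo))).
    by rewrite ler_wpM2r ?fine_ge0 ?sq_ge0// lerDl.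
rewrite ge0_integralZl//; last 3 first.
- exact: measurable_sq_kappa.
- by move=> x _; exact: sq_ge0.
- by rewrite lee_fin addr_ge0.
by rewrite integral_sq_kappa lte_mul_pinfty ?lee_fin ?addr_ge0.
Qed.

Local Notation nu := (lebesgue R d).

(** The transform is an integral at each z, so changing [f] on a null set does not change any of its
    values. *)
Lemma stftE (f : lebesgueRn R d -> R[i]) (g : X -> R[i]) : cmeasurable f -> cmeasurable g ->
  {ae nu, forall x, f x = g x} -> @stft R d f = transform g.
Proof.
move=> mf mg fg; apply/funext => z; rewrite /transform.
have mp := cmeasurable_psi_slice z.
rewrite -(cint_lebesgue (f := fun y : X => g y * psi (y, z))); last exact: cmeasurableM.
transitivity (cint nu (fun y => f y * psi (y, z))).
  by apply: eq_cint => y; rewrite /psi mulrA.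
have mp' := cmeasurable_lebesgueRn mp.
apply: (ae_eq_cint (mu := nu) (f := fun y => f y * psi (y, z))).
- exact: (cmeasurableM mf mp').
- exact: (cmeasurableM (cmeasurable_lebesgueRn mg) mp').
- by apply: filterS fg => x ->.
Qed.

Section basis.
Variable B : set (lebesgueRn R d -> R[i]).
Hypotheses (onB : orthonormal nu B) (totB : total nu B).

Let rep e : B e -> exists2 g : X -> R[i], cL2 L g & {ae nu, forall x, e x = g x}.
Proof. by move=> Be; apply: cL2_representative; have [+ _] := onB; apply. Qed.

Let stft_rep e g : B e -> cL2 L g -> {ae nu, forall x, e x = g x} -> @stft R d e = transform g.
Proof.
by move=> Be [mg _] eg; exact: (stftE (proj1 (proj1 onB _ Be)) mg eg).
Qed.

Let ip_rep e g k : B e -> cL2 L g -> {ae nu, forall x, e x = g x} -> cL2 L k ->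
  sqn (ip L g k) = sqn (ip nu k e).
Proof.
move=> Be L2g eg L2k; rewrite -(ipJ L2k L2g) sqnJ; congr sqn; apply/esym.
exact: (ip_representative (cmeasurable_lebesgueRn (proj1 L2k)) (proj1 (proj1 onB _ Be))
  (proj1 L2k) (proj1 L2g) (aeW _ (fun x => erefl)) eg).
Qed.

Let sqn_stft e z : B e -> sqn (@stft R d e z) = sqn (ip nu (coherent z : lebesgueRn R d -> R[i]) e).
Proof.
move=> Be; have [g L2g eg] := rep Be.
by rewrite (stft_rep Be L2g eg) transformE (ip_rep Be L2g eg)//; exact: cL2_coherent.
Qed.

(** Set to 0 outside [B], so that measurability and bounds hold for every function e. *)
Let h (e : lebesgueRn R d -> R[i]) (z : Z) : R := if e \in B then sqn ((chi z)%:C * @stft R d e z) else 0.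

Let h0 e z : 0 <= h e z. Proof. by rewrite /h; case: ifP => // _; exact: sqn_ge0. Qed.

Let mchi_stft e : B e -> cmeasurable (fun z : Z => (chi z)%:C * @stft R d e z).
Proof.
move=> Be; have [g L2g eg] := rep Be; rewrite (stft_rep Be L2g eg).
apply: cmeasurableM; first exact: cmeasurable_real.
by apply: cmeasurable_transform; case: L2g.
Qed.

Let mh e : measurable_fun setT (h e).
Proof.
rewrite /h; case: (boolP (e \in B)) => [/set_mem Be|_]; last exact: measurable_cst.
by apply: cmeasurable_sqn; exact: mchi_stft.
Qed.

Let sum_h s z : uniq s -> {in s, forall e, B e} -> \sum_(e <- s) h e z <= chi z.
Proof.
move=> us sB; have [mc coo] := cL2_lebesgue (cL2_coherent z).
apply: (@le_trans _ _ (chi z * \sum_(e <- s) sqn (ip nu (coherent z : lebesgueRn R d -> R[i]) e))).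
  rewrite big_distrr/= big_seq [leRHS]big_seq; apply: ler_sum => e es.
  rewrite /h (mem_set (sB e es)) sqnM sqn_real sqn_stft; last exact: sB.
  rewrite /chi indicE; case: (z \in Om); rewrite /= ?expr1n ?expr0n//.
rewrite ler_piMr//; have L2c : cL2 nu (coherent z : lebesgueRn R d -> R[i]) by split.
apply: (le_trans (bessel onB us sB L2c)).
by rewrite (sq_lebesgue (f := coherent z)) ?sq_coherent//; case: (cL2_coherent z).
Qed.

Let h_fin e : (\int[LZ]_z (h e z)%:E < +oo)%E.
Proof.
apply: (@le_lt_trans _ _ (\int[LZ]_z (chi z)%:E)%E); last by rewrite chiE.
apply: ge0_le_integral => //.
- by move=> z _; rewrite lee_fin.
- exact/measurable_EFinP.
- exact/measurable_EFinP.
- move=> z _; rewrite lee_fin; have [/set_mem Be|eB] := boolP (e \in B); last first.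
    by rewrite /h (negbTE eB).
  have := @sum_h [:: e] z isT; rewrite big_seq1; apply.
  by move=> x; rewrite inE => /eqP ->.
Qed.

(** At each z the values |Ve(z)|^2 have finite sums at most 1, by Bessel for a unit coherent state.
    Integrated over [Om], finite sums are at most |Om|, so only countably many terms are nonzero. *)
Let countable_stft : countable (B `&` [set e | fine (\int[LZ]_z (h e z)%:E)%E != 0]).
Proof.
apply: (@countable_support _ _ _ _ (fine (LZ Om))) => [e|s us sB].
  by rewrite fine_ge0// integral_ge0// => z _; rewrite lee_fin.
rewrite -lee_fin fineK ?ge0_fin_numE// -sumEFin.
rewrite (eq_bigr (fun e => \int[LZ]_z (h e z)%:E)%E); last first.
  by move=> e _; rewrite fineK// ge0_fin_numE// integral_ge0// => z _; rewrite lee_fin.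
rewrite -ge0_integral_sum//; last 2 first.
- by move=> e; exact/measurable_EFinP.
- by move=> e z _; rewrite lee_fin.
rewrite -chiE; apply: ge0_le_integral => //.
- by move=> z _; rewrite sume_ge0// => e _; rewrite lee_fin.
- by apply: emeasurable_sum => e; exact/measurable_EFinP.
- exact/measurable_EFinP.
- by move=> z _; rewrite sumEFin lee_fin sum_h.
Qed.

Let synthesis_eq0 e x : B e -> fine (\int[LZ]_z (h e z)%:E)%E = 0 ->
  synthesis Om (@stft R d e) x = 0.
Proof.
move=> Be.
have hE z : h e z = sqn ((chi z)%:C * @stft R d e z) by rewrite /h mem_set.
under eq_integral do rewrite hE.
move=> H.
have hoo : (sq LZ (fun z : Z => (chi z)%:C * @stft R d e z)%R < +oo)%E.
  by have := h_fin e; under eq_integral do rewrite hE.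
have L2h : cL2 LZ (fun z : Z => (chi z)%:C * @stft R d e z) by split => //; exact: mchi_stft.
have /(sq0_ae L2h) H0 : sq LZ (fun z : Z => (chi z)%:C * @stft R d e z) = 0%E.
  by rewrite -(sq_fin L2h) [X in X%:E]H.
have mps : cmeasurable (fun z : Z => ((psi (x, z))^*)%R).
  by apply: cmeasurableJ; exact: cmeasurable_psi_at.
rewrite /synthesis -[RHS](cint0 LZ).
rewrite (eq_cint _ (g := fun z => ((psi (x, z))^*)%R * ((chi z)%:C * @stft R d e z))); last first.
  by move=> z; rewrite mulrCA.
apply: ae_eq_cint; [|exact: cmeasurable_cst|by apply: filterS H0 => z ->; rewrite mulr0].
by apply: cmeasurableM => //; exact: mchi_stft.
Qed.

(** The basis elements outside the countable set [J] are annihilated by the operator. The sum is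
    reduced to [J], exchanged with the integral, and extended back to [B] at almost every point,
    where Parseval's identity for [kappa] needs the whole basis. *)
Lemma esum_synthesis :
  (\esum_(e in B) sq L (synthesis Om (@stft R d e)) = energy gauss_kernel Om Om)%E.
Proof.
pose J := [set e | fine (\int[LZ]_z (h e z)%:E)%E != 0].
have J0 e x : B e -> ~ J e -> synthesis Om (@stft R d e) x = 0.
  by move=> Be /negP/negPn/eqP; exact: synthesis_eq0.
have mS e : B e -> cmeasurable (synthesis Om (@stft R d e)).
  move=> Be; have [g L2g eg] := rep Be; rewrite (stft_rep Be L2g eg).
  by have [] := cL2_synthesis L2g.
transitivity (\esum_(e in B `&` J) sq L (synthesis Om (@stft R d e)))%E.
  rewrite esum_mkcondr; apply: eq_esum => e Be.
  case: ifPn => // /negP eJ; rewrite /sq integral0_eq// => x _.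
  by rewrite J0 ?sqn0// => Je; apply: eJ; exact: mem_set.
have [mes ies] := @integral_esum R _ _ L _ (B `&` J) (fun e x => sqn (synthesis Om (@stft R d e) x))
  countable_stft (fun e BJ => cmeasurable_sqn (mS e BJ.1)) (fun e x => sqn_ge0 _).
rewrite -[LHS]ies//.
rewrite -integral_sq_kappa; apply: ae_eq_integral => //; first exact: measurable_sq_kappa.
apply: filterS ae_kappa => x koo _.
transitivity (\esum_(e in B) (sqn (synthesis Om (@stft R d e) x))%:E)%E.
  rewrite esum_mkcondr; apply: eq_esum => e Be.
  case: ifPn => // /negP eJ; rewrite J0 ?sqn0// => Je; apply: eJ; exact: mem_set.
have L2k := cL2_kappa koo.
rewrite -(sq_lebesgue (f := kappa Om x)); last by case: L2k.
rewrite -(parseval onB totB (cL2_lebesgue L2k)); apply: eq_esum => e Be.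
have [g L2g eg] := rep Be.
by rewrite (stft_rep Be L2g eg) synthesis_transform// (ip_rep Be L2g eg).
Qed.

End basis.
End hilbert_schmidt.

(** * Identification of the localization operator *)

Section localization_operator.
Context (R : realType) (d : nat).
Local Open Scope complex_scope.
Local Notation X := (borelRn R d).
Local Notation Z := (borelRn R (d + d)).
Local Notation L := (borel_lebesgue R d).
Local Notation LZ := (borel_lebesgue R (d + d)).
Local Notation nu := (lebesgue R d).
Local Notation nuZ := (lebesgue R (d + d)).

Lemma ipBr dd (T : measurableType dd) (mu : {measure set T -> \bar R}) (f g h : T -> R[i]) :
  cL2 mu f -> cL2 mu g -> cL2 mu h -> ip mu f (fun x => g x - h x) = ip mu f g - ip mu f h.
Proof.
move=> Lf Lg Lh; rewrite -(ipJ (cL2B Lg Lh) Lf) ipBl// -(ipJ Lg Lf) -(ipJ Lh Lf).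
by apply: complex_eq; rewrite !ReImE; ring.
Qed.

Variable Omega : set (lebesgueRn R (d + d)).
Hypothesis mOmega : measurable Omega.
Variable Om : set Z.
Hypothesis mOm : measurable Om.
Hypothesis Omoo : (LZ Om < +oo)%E.
Hypothesis OmE : {ae nuZ, forall z, \1_Omega z = \1_Om z :> R}.

Let synthesis_adjoint f g f' g' : cL2 nu f -> cL2 L g -> {ae nu, forall x, f x = g x} ->
  cL2 nu f' -> cL2 L g' -> {ae nu, forall x, f' x = g' x} ->
  inner (@stft R d f') (fun z => (\1_Omega z)%:C * @stft R d f z) =
  ip nu f' (synthesis Om (transform g) : lebesgueRn R d -> R[i]).
Proof.
move=> Lf Lg fg Lf' Lg' fg'.
have LS := cL2_synthesis mOm Omoo Lg.
rewrite (ip_representative (proj1 Lf') (cmeasurable_lebesgueRn (proj1 LS)) (proj1 Lg') (proj1 LS)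
  fg' (aeW _ (fun x => erefl))).
rewrite (ip_synthesis mOm Omoo Lg Lg').
rewrite (stftE (proj1 Lf) (proj1 Lg) fg) (stftE (proj1 Lf') (proj1 Lg') fg').
have mT := cmeasurable_transform (proj1 Lg); have mT' := cmeasurable_transform (proj1 Lg').
have mI : cmeasurable (fun z : Z => (\1_Om z : R)%:C) by apply: cmeasurable_real; exact: measurable_indic.
have mI' : cmeasurable (fun z : lebesgueRn R (d + d) => (\1_Omega z : R)%:C).
  by apply: cmeasurable_real; exact: measurable_indic.
have mc := cmeasurableM mT' (cmeasurableJ (cmeasurableM mI mT)).
rewrite -[RHS](cint_lebesgue mc).
apply: ae_eq_cint.
- exact: (cmeasurableM (cmeasurable_lebesgueRn mT')
    (cmeasurableJ (cmeasurableM mI' (cmeasurable_lebesgueRn mT)))).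
- exact: (cmeasurable_lebesgueRn mc).
- by apply: filterS OmE => z ->.
Qed.

(** [adjoint] picks an unspecified solution of its defining relation. The synthesis integral is one,
    so the default value is excluded, and any two solutions agree almost everywhere. *)
Lemma sq_localization f : cL2 nu f ->
  sq nu (localization Omega f) = sq L (synthesis Om (@stft R d f)).
Proof.
move=> Lf; have [g Lg fg] := cL2_representative Lf.
have LS := cL2_synthesis mOm Omoo Lg.
have LS' := cL2_lebesgue LS.
have SE : @stft R d f = transform g := stftE (proj1 Lf) (proj1 Lg) fg.
rewrite SE -(sq_lebesgue (proj1 LS)).
rewrite /localization /adjoint; case: xgetP => [h _ [/L2E Lh hE]|H]; last first.
  case: (H (synthesis Om (transform g))); split; first exact/L2E.
  move=> f' /L2E Lf'; have [g' Lg' fg'] := cL2_representative Lf'.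
  exact: (synthesis_adjoint Lf Lg fg Lf' Lg' fg').
have LhS := cL2B Lh LS'.
(* Both solutions have the same inner product with every L^2 function, in particular with their
   difference. *)
have E : ip nu (fun x => h x - synthesis Om (transform g) x) (fun x => h x - synthesis Om (transform g) x) = 0.
  rewrite ipBr//.
  have [g' Lg' fg'] := cL2_representative LhS.
  rewrite -(synthesis_adjoint Lf Lg fg LhS Lg' fg').
  have /L2E /hE -> := LhS.
  by rewrite /inner subrr.
have sq0 : sq nu (fun x => h x - synthesis Om (transform g) x) = 0%E.
  rewrite -(sq_fin LhS); congr EFin.
  by have := congr1 (@complex.Re _) E; rewrite ip_self.
apply: ae_eq_sq; [by case: Lh|by case: LS'|].
by apply: filterS (sq0_ae LhS sq0) => x /eqP; rewrite subr_eq0 => /eqP.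
Qed.

Lemma hs_norm_localization :
  hs_norm (localization Omega) = (energy (@gauss_kernel R) Om Om `^ 2^-1)%E.
Proof.
have [onB totB] := onbP R d.
rewrite /hs_norm -(esum_synthesis mOm Omoo onB totB); congr (_ `^ _)%E.
by apply: eq_esum => e Be; rewrite sqr_l2norm; exact: (sq_localization (proj1 onB _ Be)).
Qed.

End localization_operator.

(** * Rearrangement for the Gaussian kernel *)

Section gauss_kernel_properties.
Context (R : realType).
Local Notation k := (@gauss_kernel R).

Lemma gauss_kernel_gt0 t : 0 < k t. Proof. exact: expR_gt0. Qed.

Lemma gauss_kernel_le1 t : 0 <= t -> k t <= 1.
Proof. by move=> t0; rewrite -expR0 ler_expR oppr_le0 mulr_ge0 ?pi_ge0. Qed.

Lemma gauss_kernel_lt s t : 0 <= s -> s < t -> k t < k s.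
Proof. by move=> _ st; rewrite ltr_expR ltrN2 ltr_pM2l ?pi_gt0. Qed.

Lemma gauss_kernel_decay e : 0 < e -> exists T, forall t, T <= t -> k t <= e.
Proof.
move=> e0; exists e^-1 => t et.
rewrite /gauss_kernel expRN invf_ple ?posrE ?expR_gt0//; apply: (le_trans et).
apply: le_trans (expR_ge1Dx _).
have t0 : 0 <= t by apply: le_trans et; rewrite invr_ge0 ltW.
by have := pi_ge2 R; nra.
Qed.

(** For distances a <= b: if b >= a + 1, the kernel being between 0 and 1 suffices. Otherwise 1 -
    exp (- t) <= t reduces the bound to (a + b) k (a^2) <= 2, which follows from k (a^2) (1 + pi
    a^2) <= 1. *)
Lemma gauss_kernel_lipschitz n (x x' y : 'rV[R]_n) :
  `|k (dist2 x y) - k (dist2 x' y)| <= 2 * pi * enorm (x - x').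
Proof.
have p2 := pi_ge2 R.
have H (a b : R) : 0 <= a -> a <= b -> k (a ^+ 2) - k (b ^+ 2) <= 2 * pi * (b - a).
  move=> a0 ab.
  have [ba|ba] := leP (a + 1) b.
    have := gauss_kernel_le1 (sqr_ge0 a); have := gauss_kernel_gt0 (b ^+ 2); nra.
  have -> : k (b ^+ 2) = k (a ^+ 2) * expR (- (pi * (b ^+ 2 - a ^+ 2))).
    by rewrite /gauss_kernel -expRD; congr expR; ring.
  have e1 := expR_ge1Dx (- (pi * (b ^+ 2 - a ^+ 2))).
  have ka : k (a ^+ 2) * (1 + pi * a ^+ 2) <= 1.
    rewrite /gauss_kernel expRN ler_pdivrMl ?expR_gt0// mulr1; exact: expR_ge1Dx.
  have ka0 := gauss_kernel_gt0 (a ^+ 2).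
  apply: (@le_trans _ _ (k (a ^+ 2) * (pi * (b ^+ 2 - a ^+ 2)))).
    rewrite -{1}(mulr1 (k (a ^+ 2))) -mulrBr ler_wpM2l ?(ltW ka0)//.
    rewrite lerBlDr -lerBlDl; exact: e1.
  have -> : k (a ^+ 2) * (pi * (b ^+ 2 - a ^+ 2)) = pi * (b - a) * (k (a ^+ 2) * (b + a)) by ring.
  rewrite [leRHS](_ : _ = pi * (b - a) * 2); last by ring.
  apply: ler_wpM2l; first by rewrite mulr_ge0 ?pi_ge0 ?subr_ge0.
  have H1 : b + a <= 2 * (1 + pi * a ^+ 2).
    have a1 : 2 * a <= 1 + a ^+ 2 by have := sqr_ge0 (a - 1); nra.
    have a2 : 2 * a ^+ 2 <= pi * a ^+ 2 by rewrite ler_wpM2r ?sqr_ge0.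
    have a3 := sqr_ge0 a; move: a2 a1 a3 ba; move: (a ^+ 2) => t.
    by move: (pi * t) => q; lra.
  apply: (le_trans (ler_wpM2l (ltW ka0) H1)).
  by rewrite mulrCA -[leRHS]mulr1 ler_wpM2l.
rewrite /dist2 -!sqr_enorm.
have [ab|ba] := leP (enorm (x - y)) (enorm (x' - y)).
- have := H _ _ (enorm_ge0 _) ab.
  have kk : k (enorm (x' - y) ^+ 2) <= k (enorm (x - y) ^+ 2).
    by rewrite ler_expR lerN2 ler_wpM2l ?pi_ge0// ler_sqr ?nnegrE ?enorm_ge0.
  rewrite ger0_norm ?subr_ge0// => /le_trans; apply.
  rewrite ler_wpM2l ?mulr_ge0 ?pi_ge0// lerBlDr (enormB x x').
  exact: ler_enorm_distD.
- have := H _ _ (enorm_ge0 _) (ltW ba).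
  have kk : k (enorm (x - y) ^+ 2) <= k (enorm (x' - y) ^+ 2).
    by rewrite ler_expR lerN2 ler_wpM2l ?pi_ge0// ler_sqr ?nnegrE ?enorm_ge0// ltW.
  rewrite ler0_norm ?subr_le0// opprB => /le_trans; apply.
  rewrite ler_wpM2l ?mulr_ge0 ?pi_ge0// lerBlDr.
  exact: ler_enorm_distD.
Qed.

End gauss_kernel_properties.

Section gauss_riesz.
Context (R : realType) (n : nat).
Local Open Scope ereal_scope.
Local Notation Rn := (borelRn R n).
Local Notation L := (borel_lebesgue R n).
Local Notation k := (@gauss_kernel R).

Lemma gauss_riesz (A : set Rn) c rho : measurable A -> L A = L (eball c rho) ->
  energy k A A <= energy k (eball c rho) (eball c rho).
Proof.
move=> mA AB; apply: (@riesz_ball R n c rho k) => //.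
- exact: measurable_gauss_kernel.
- by move=> t; apply: ltW; exact: gauss_kernel_gt0.
- exact: gauss_kernel_le1.
- by move=> s t s0 st; apply: ltW; exact: gauss_kernel_lt.
Qed.

(** The energy of a ball does not depend on its center, by [gauss_riesz] in both directions, so the
    ball can be moved to a maximum of the potential. Equal measures then make both halves of the
    symmetric difference null. *)
Lemma gauss_riesz_eq (A : set Rn) rho : measurable A -> 0 < L A -> L A = L (eball 0%R rho) ->
  energy k A A = energy k (eball 0%R rho : set Rn) (eball 0%R rho) ->
  exists c : 'rV[R]_n, L (A `+` eball c rho) = 0.
Proof.
move=> mA A0 AB EE.
have Aoo : L A < +oo by rewrite AB; exact: borel_lebesgue_eball_lty.
have mk := @measurable_gauss_kernel R; have k0 := @gauss_kernel_gt0 R.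
have k1 := @gauss_kernel_le1 R; have kd := @gauss_kernel_lt R.
have M0 : (0 <= 2 * pi :> R)%R by rewrite mulr_ge0 ?pi_ge0.
have klip := @gauss_kernel_lipschitz R n; have kdec := @gauss_kernel_decay R.
have [c cmax] := exists_pot_max mk k0 k1 M0 klip kdec mA Aoo A0.
exists c.
have ABc : L A = L (eball c rho) by rewrite borel_lebesgue_eball.
have mB := @measurable_eball R n c rho.
have EEc : energy k A A = energy k (eball c rho : set Rn) (eball c rho).
  apply/le_anti/andP; split; first exact: gauss_riesz.
  by rewrite EE; apply: gauss_riesz; rewrite // -ABc AB.
have D0 := riesz_equality_ball mk k0 k1 kd mA Aoo ABc A0 EEc cmax.
have D1 := setD_measure_eq mA ABc.
exact: (null_set_setU (measurableD mA mB) (measurableD mB mA) D0 (etrans D1 D0)).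
Qed.

End gauss_riesz.

(** * From Borel sets back to Lebesgue measurable sets *)

Section final.
Context (R : realType) (m : nat).
Local Open Scope ereal_scope.
Local Notation Z := (borelRn R m).
Local Notation LZ := (borel_lebesgue R m).
Local Notation nuZ := (lebesgue R m).

Lemma lebesgue_eq_ae (Omega : set (lebesgueRn R m)) (G : set Z) : measurable Omega ->
  measurable G -> {ae nuZ, forall z, \1_Omega z = \1_G z :> R} -> nuZ Omega = LZ G.
Proof.
move=> mO mG OG; rewrite -lebesgue_borel//.
have mG' := measurable_lebesgueRn mG.
transitivity (\int[nuZ]_z (\1_Omega z)%:E); first by rewrite integral_indic// setIT.
transitivity (\int[nuZ]_z (\1_(G : set (lebesgueRn R m)) z)%:E); last by rewrite integral_indic// setIT.
apply: (@ae_eq_integral _ _ _ nuZ setT _ _ measurableT).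
- by apply/measurable_EFinP; exact: measurable_indic.
- by apply/measurable_EFinP; exact: measurable_indic.
- by apply: filterS OG => z -> _.
Qed.

Lemma indic_ae_setY (Omega : set (lebesgueRn R m)) (G : set Z) : measurable Omega ->
  measurable G -> {ae nuZ, forall z, \1_Omega z = \1_G z :> R} <-> nuZ (Omega `+` G) = 0.
Proof.
move=> mO mG; have mG' := measurable_lebesgueRn mG.
have mY : measurable (Omega `+` G : set (lebesgueRn R m)) by apply: measurableU; exact: measurableD.
have OGE z : (Omega `+` G) z <-> \1_Omega z <> \1_G z :> R.
  have F (b b' : bool) : b%:R = b'%:R :> R -> b = b'.
    by move=> /eqP; rewrite eqr_nat; case: b b' => [] [].
  rewrite !indicE; split.
    move=> [[Oz nGz]|[Gz nOz]] /F.
      by rewrite mem_set//; move/esym/set_mem.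
    by rewrite [in RHS]mem_set// => /set_mem.
  move=> H; have [Oz|nOz] := pselect (Omega z); have [Gz|nGz] := pselect (G z).
  - by case: H; rewrite !mem_set.
  - by left.
  - by right.
  - by case: H; rewrite !memNset.
split=> [[N [mN N0 NE]]|Y0].
  apply/eqP; rewrite -measure_le0 -N0; apply: le_measure; rewrite ?inE//.
  by move=> z /OGE Yz; apply: NE => /= /Yz.
exists (Omega `+` G); split => // z /= H; apply/OGE; exact: H.
Qed.

Lemma poweR_half_inj (x y : \bar R) : 0 <= x -> 0 <= y ->
  (x `^ 2^-1 = y `^ 2^-1) -> x = y.
Proof.
have H (z : \bar R) : 0 <= z -> z = (z `^ 2^-1) `^ 2.
  by move=> z0; rewrite -poweRrM mulVf ?pnatr_eq0// poweRe1.
by move=> x0 y0 xy; rewrite (H _ x0) xy -H.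
Qed.

End final.

Theorem corollary3p5 (R : realType) (d : nat) (Omega : set (lebesgueRn R (d + d))) :
  (1 <= d)%N ->
  measurable Omega ->
  (lebesgue R (d + d) Omega < +oo)%E ->
  (hs_norm (localization Omega) <= hs_norm (localization (symmetrization Omega)))%E
  /\
  (hs_norm (localization Omega) = hs_norm (localization (symmetrization Omega)) <->
   exists (c : 'rV[R]_(d + d)) (r : R),
     0 <= r /\ lebesgue R (d + d) (Omega `+` eball c r) = 0%E).
Proof.
move=> d1 mO Ooo.
(* The Borel hull [G] replaces [Omega] from here on: the Hilbert-Schmidt norm and the measure depend
   only on the class of the set modulo null sets. *)
have [G [N [mG mN N0 OG GN]]] := borel_approx mO.
have OGae : {ae lebesgue R (d + d), forall z, \1_Omega z = \1_G z :> R}.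
  apply: (lebesgue_null mN N0) => z nNz; rewrite !indicE.
  have [Oz|nOz] := pselect (Omega z); first by rewrite !mem_set//; exact: OG.
  have nGz : ~ G z by move=> Gz; apply: nNz; apply: GN.
  by rewrite !memNset.
have LG := lebesgue_eq_ae mO mG OGae.
have Goo : (borel_lebesgue R (d + d) G < +oo)%E by rewrite -LG.
have [r r0 [Sr Lr]] : exists2 r, 0 <= r & symmetrization Omega = eball 0 r /\
    borel_lebesgue R (d + d) (eball 0 r) = borel_lebesgue R (d + d) G.
  rewrite /symmetrization; case: xgetP => [r _ [r0 rE]|H].
    exists r => //; split => //; rewrite -LG -rE; apply/esym/lebesgue_borel; exact: measurable_eball.
  have [r r0 rE] : exists2 r, 0 <= r & borel_lebesgue R (d + d) (eball 0 r) = (fine (borel_lebesgue R (d + d) G))%:E.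
    have M0 : 0 <= fine (borel_lebesgue R (d + d) G) by exact: fine_ge0.
    (* [exists_eball_volume] is stated in a successor dimension; 1 <= d is used to write d + d as
       one. *)
    have ex D q : D = q.+1 -> exists2 r : R, 0 <= r &
        borel_lebesgue R D (eball 0 r) = (fine (borel_lebesgue R (d + d) G))%:E.
      by move=> ->; exact: exists_eball_volume.
    by apply: (ex _ (d + d).-1); rewrite prednK// addn_gt0 d1.
  case: (H r); split => //.
  rewrite lebesgue_borel ?LG; last exact: measurable_eball.
  by rewrite [LHS]rE fineK// ge0_fin_numE.
have mB c rho : measurable (eball c rho : set (borelRn R (d + d))) by exact: measurable_eball.
have Boo c rho : (borel_lebesgue R (d + d) (eball c rho) < +oo)%E by exact: borel_lebesgue_eball_lty.
pose k := @gauss_kernel R.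
have k0 t : 0 <= k t by exact: expR_ge0.
have hsG := hs_norm_localization mO mG Goo OGae.
have hsB : hs_norm (localization (symmetrization Omega)) =
    (energy k (eball 0 r : set (borelRn R (d + d))) (eball 0 r) `^ 2^-1)%E.
  rewrite Sr; apply: hs_norm_localization => //; first exact: measurable_lebesgueRn.
  exact: aeW.
have le_GB : (energy k G G <= energy k (eball 0 r : set (borelRn R (d + d))) (eball 0 r))%E.
  exact: gauss_riesz.
pose P := exists (c : 'rV[R]_(d + d)) (r : R),
  0 <= r /\ lebesgue R (d + d) (Omega `+` eball c r) = 0%E.
suff H (a b : \bar R) : a = (energy k G G `^ 2^-1)%E ->
    b = (energy k (eball 0 r : set (borelRn R (d + d))) (eball 0 r) `^ 2^-1)%E ->
    (a <= b)%E /\ (a = b <-> P) by exact: H hsG hsB.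
move=> -> ->; split.
  by apply: gt0_ler_poweR => //; rewrite in_itv/= energy_ge0// leey.
split=> [/poweR_half_inj EE|[c [rho [rho0 /(indic_ae_setY mO (mB c rho)) Oc]]]].
  have {}EE := EE (energy_ge0 k0 _ _) (energy_ge0 k0 _ _).
  (* A null set is equivalent to the ball of radius 0, and its potential has no distinguished
     maximum; [gauss_riesz_eq] requires positive measure. *)
  have [G0|G0] := eqVneq (borel_lebesgue R (d + d) G) 0%E.
    exists 0, 0; split; first exact: lexx.
    rewrite eball0// setY0.
    by rewrite LG.
  have {}G0 : (0 < borel_lebesgue R (d + d) G)%E by rewrite lt_neqAle eq_sym G0 measure_ge0.
  have [c cE] := gauss_riesz_eq mG G0 (esym Lr) EE.
  exists c, r; split; first exact: r0.
  apply/(indic_ae_setY mO (mB c r)).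
  have mB' := measurable_lebesgueRn (mB c r); have mG' := measurable_lebesgueRn mG.
  have /(indic_ae_setY mG' (mB c r)) GB : lebesgue R (d + d) (G `+` eball c r) = 0%E.
    by rewrite lebesgue_borel//; apply: measurableU; exact: measurableD.
  by apply: filterS2 OGae GB => z -> ->.
(* Conversely, if [Omega] is a ball up to a null set, that ball has the measure of the symmetrized
   one, and [gauss_riesz] in both directions equates their energies. *)
have hsC := hs_norm_localization mO (mB c rho) (Boo c rho) Oc.
have -> : (energy k G G `^ 2^-1)%E = (energy k (eball c rho : set (borelRn R (d + d))) (eball c rho) `^ 2^-1)%E.
  exact: etrans (esym hsG) hsC.
apply: (f_equal (fun e => e `^ 2^-1)%E).
have LC := lebesgue_eq_ae mO (mB c rho) Oc.
by apply/le_anti/andP; split; apply: gauss_riesz; rewrite // Lr -LG LC.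
Qed.
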